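(* Let $n=2$ and let $\mathbb{F}$ be a finite field of odd order $|\mathbb{F}|>3$. Let $\Delta_2$ be the dual polar space associated to a non-singular quadratic form of Witt index $2$ on $V(5,\mathbb{F})$. Then the veronesean Weyl embedding $\tilde{\varepsilon}_2$ of $\Delta_2$ is relatively universal.
   Context: $V(m,\mathbb{F})$ is an $m$-dimensional vector space over $\mathbb{F}$. A veronesean embedding of a point-line geometry $\Gamma=(\mathcal{P},\mathcal{L})$ in a vector space $W$ is an injective map $\varepsilon$ from $\mathcal{P}$ to the set of points (1-dimensional subspaces) of $\mathrm{PG}(W)$ mapping every line of $\Gamma$ onto a non-singular conic of $\mathrm{PG}(W)$, with $\varepsilon(p)\cap\langle\varepsilon(l)\rangle=0$ for every non-incident point-line pair $(p,l)$ and with $\varepsilon(\mathcal{P})$ spanning $W$. A morphism from $\varepsilon_1:\Gamma\to W_1$ to $\varepsilon_2:\Gamma\to W_2$ is a semilinear map $f:W_1\to W_2$ with $\varepsilon_2=f\circ\varepsilon_1$ (it is then surjective); if it exists, $\varepsilon_2$ is called a quotient of $\varepsilon_1$, a proper quotient if $f$ is not bijective. A veronesean embedding of $\Gamma$ is relatively universal if it is not a proper quotient of any other veronesean embedding of $\Gamma$. $\Delta_2$ is the point-line geometry whose points are the 2-dimensional totally singular subspaces of $V(5,\mathbb{F})$ and whose lines are the sets $l_X$ of all 2-dimensional totally singular subspaces containing a given 1-dimensional totally singular subspace $X$. $G=\mathrm{Spin}(5,\mathbb{F})$ is the universal Chevalley group of type $B_2$, $\lambda_2$ the fundamental dominant weight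 of the short simple root, and $V(2\lambda_2)$ the Weyl $G$-module of highest weight $2\lambda_2$ (of dimension 10). The veronesean Weyl embedding $\tilde{\varepsilon}_2:\Delta_2\to V(2\lambda_2)$ maps $g(X_0)$ to $g(\langle v_0\rangle)$ for $g\in G$, where $v_0$ is a highest weight vector of $V(2\lambda_2)$ and $X_0$ is the point of $\Delta_2$ stabilized by the stabilizer of $\langle v_0\rangle$ in $G$. *)

(* Defs.v *)
From HB Require Import structures.
From mathcomp Require Import all_boot all_order all_algebra.
From mathcomp Require Import all_fingroup all_character.

Set Implicit Arguments.
Unset Strict Implicit.
Unset Printing Implicit Defensive.

Import GRing.Theory.
Local Open Scope ring_scope.

(** * Quadratic forms *)

Section QuadraticForms.
Variables (K : fieldType) (W : vectType K).

Definition polar (q : W -> K) (u v : W) : K := q (u + v) - q u - q v.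

Definition quadratic_form (q : W -> K) : Prop :=
  [/\ forall a u, q (a *: u) = a ^+ 2 * q u,
      forall a u v w, polar q (a *: u + v) w = a * polar q u w + polar q v w
    & forall a u v w, polar q w (a *: u + v) = a * polar q w u + polar q w v].

Definition nonsingular_on (q : W -> K) (U : {vspace W}) : Prop :=
  forall u, u \in U -> q u = 0 -> (forall w, w \in U -> polar q u w = 0) ->
  u = 0.

Definition tot_singular (q : W -> K) (U : {vspace W}) : Prop :=
  forall u, u \in U -> q u = 0.

Definition witt_index (q : W -> K) (m : nat) : Prop :=
  (exists U, tot_singular q U /\ \dim U = m) /\
  (forall U, tot_singular q U -> (\dim U <= m)%N).

(* A set of points (1-dimensional subspaces) of PG(W).  Every quadratic form
   on the plane U extends to W, so q may be taken to be defined on W. *)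
Definition nonsingular_conic (C : {vspace W} -> Prop) : Prop :=
  exists (U : {vspace W}) (q : W -> K),
    [/\ \dim U = 3, quadratic_form q, nonsingular_on q U
      & forall P, C P <-> [/\ \dim P = 1, (P <= U)%VS & tot_singular q P]].

Definition spans (C : {vspace W} -> Prop) (U : {vspace W}) : Prop :=
  (forall P, C P -> (P <= U)%VS) /\
  (forall U' : {vspace W}, (forall P, C P -> (P <= U')%VS) -> (U <= U')%VS).

End QuadraticForms.

(** * Veronesean embeddings *)

(* A line is identified with the set of points incident with it. *)
Record geometry := Geometry {
  point : Type;
  line : Type;
  incident : point -> line -> Prop
}.

Section Veronesean.
Variable Gamma : geometry.

Definition line_image (K : fieldType) (W : vectType K)
    (eps : point Gamma -> {vspace W}) (l : line Gamma) (P : {vspace W}) : Prop :=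
  exists2 p, incident p l & P = eps p.

Record veronesean_embedding (K : fieldType) (W : vectType K)
    (eps : point Gamma -> {vspace W}) : Prop := {
  ver_point : forall p, \dim (eps p) = 1;
  ver_inj : injective eps;
  ver_conic : forall l, nonsingular_conic (line_image eps l);
  ver_disjoint : forall p l, ~ incident p l ->
    forall U, spans (line_image eps l) U -> (eps p :&: U)%VS = 0%VS;
  ver_span : spans (fun P => exists p, P = eps p) fullv
}.

Definition semilinear (K1 K2 : fieldType) (W1 : vectType K1) (W2 : vectType K2)
    (f : W1 -> W2) : Prop :=
  exists2 sigma : {rmorphism K1 -> K2}, bijective sigma
    & forall a u v, f (a *: u + v) = sigma a *: f u + f v.

(* eps2 = f \o eps1, where f maps a subspace onto its set of images. *)
Definition ver_morphism (K1 K2 : fieldType) (W1 : vectType K1)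
    (W2 : vectType K2) (eps1 : point Gamma -> {vspace W1})
    (eps2 : point Gamma -> {vspace W2}) (f : W1 -> W2) : Prop :=
  semilinear f /\
  (forall p w2, w2 \in eps2 p <-> exists2 w1, w1 \in eps1 p & f w1 = w2).

Definition relatively_universal (K : fieldType) (W : vectType K)
    (eps : point Gamma -> {vspace W}) : Prop :=
  veronesean_embedding eps /\
  (forall (K1 : fieldType) (W1 : vectType K1)
          (eps1 : point Gamma -> {vspace W1}) (f : W1 -> W),
     veronesean_embedding eps1 -> ver_morphism eps1 eps f -> bijective f).

End Veronesean.

(** * The dual polar space *)

Section DualPolarSpace.
Variables (F : finFieldType) (d : nat) (Q : 'cV[F]_d -> F).

(* F being finite, total singularity is decidable, so that the points and
   lines below are subtypes, with the equality of subspaces. *)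
Definition tot_singularb (U : {vspace 'cV[F]_d}) : bool :=
  [forall u : 'cV[F]_d, (u \in U) ==> (Q u == 0)].

Lemma tot_singularP U : reflect (tot_singular Q U) (tot_singularb U).
Proof.
apply: (iffP forallP) => [QU u uU | QU u].
  exact/eqP/(implyP (QU u)).
by apply/implyP=> uU; apply/eqP/QU.
Qed.

Definition dual_polar_space : geometry :=
  {| point := {U : {vspace 'cV[F]_d} | tot_singularb U && (\dim U == 2%N)};
     line := {X : {vspace 'cV[F]_d} | tot_singularb X && (\dim X == 1%N)};
     incident := fun p l => (val l <= val p)%VS |}.

End DualPolarSpace.

(** * Rational modules for the simple Lie algebra of type B2 *)

Definition lie n (A B : 'M[rat]_n) : 'M[rat]_n := A *m B - B *m A.

(* The simple roots are indexed by 'I_2: index 0 is the long one and index 1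
   the short one.  [cartan_B2 i j] is the value of the j-th simple root at the
   i-th simple coroot. *)
Definition cartan_B2 (i j : 'I_2) : int :=
  if i == j then 2 else if i == 0 then -1 else -2.

(* Weights are given by their values at the two simple coroots. *)
Definition omega (i : 'I_2) : 'rV[int]_2 := delta_mx 0 i.

Section RationalModules.
Variables (n : nat) (e f : 'I_2 -> 'M[rat]_n).

Definition coroot (i : 'I_2) : 'M[rat]_n := lie (e i) (f i).

(* The Chevalley-Serre presentation: the matrices e i, f i define an action of
   the Lie algebra of type B2 on the column space rat^n. *)
Definition B2_action : Prop :=
  [/\ forall i j, lie (coroot i) (coroot j) = 0,
      forall i j, i != j -> lie (e i) (f j) = 0,
      forall i j, lie (coroot i) (e j) = (cartan_B2 i j)%:~R *: e j,
      forall i j, lie (coroot i) (f j) = - ((cartan_B2 i j)%:~R *: f j)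
    & forall i j, i != j ->
        iter `|1 - cartan_B2 i j|%N (lie (e i)) (e j) = 0 /\
        iter `|1 - cartan_B2 i j|%N (lie (f i)) (f j) = 0].

(* The root vectors of a Chevalley basis, for the roots a, b, a + b, a + 2b
   (a long, b short) and then for their opposites in the same order. *)
Definition root_vector (r : 'I_8) : 'M[rat]_n :=
  nth 0 [:: e 0; e 1; lie (e 0) (e 1); 2^-1 *: lie (lie (e 0) (e 1)) (e 1);
            f 0; f 1; lie (f 1) (f 0); 2^-1 *: lie (f 1) (lie (f 1) (f 0))] r.

Definition divided_power (r : 'I_8) (k : nat) : 'M[rat]_n :=
  (k`!%:R)^-1 *: root_vector r ^+ k.

Definition weight_vector (mu : 'rV[int]_2) (v : 'cV[rat]_n) : Prop :=
  forall i, coroot i *m v = (mu 0 i)%:~R *: v.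

Definition is_weight (mu : 'rV[int]_2) : Prop :=
  exists2 v, v != 0 & weight_vector mu v.

Definition integral_vector (v : 'cV[rat]_n) : Prop :=
  forall i, v i 0 \is a Num.int.

(* The lattice Z^n is stable under the Kostant Z-form of the universal
   enveloping algebra. *)
Definition admissible : Prop :=
  forall r k v, integral_vector v -> integral_vector (divided_power r k *m v).

(* The additive subgroup U_Z v, with U_Z the Kostant Z-form, i.e. the ring
   generated by the divided powers of the root vectors. *)
Inductive kostant_span (v : 'cV[rat]_n) : 'cV[rat]_n -> Prop :=
| Kostant_gen : kostant_span v v
| Kostant_sub u w :
    kostant_span v u -> kostant_span v w -> kostant_span v (u - w)
| Kostant_act r k u :
    kostant_span v u -> kostant_span v (divided_power r k *m u).

Definition irreducible_action : Prop :=
  forall U : {vspace 'cV[rat]_n},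
    (forall i u, u \in U -> e i *m u \in U /\ f i *m u \in U) ->
    U = 0%VS \/ U = fullv.

(* rat^n is the irreducible module of highest weight lam, with highest weight
   vector v, written in a Z-basis of its minimal admissible lattice U_Z v. *)
Definition minimal_lattice_module (lam : 'rV[int]_2) (v : 'cV[rat]_n) : Prop :=
  [/\ B2_action, irreducible_action,
      [/\ v != 0, weight_vector lam v & forall i, e i *m v = 0]
    & forall u, kostant_span v u <-> integral_vector u].

(* exp (t e_r), for t in an arbitrary field: the divided powers are integral,
   hence reduced entrywise by [ratr], and they vanish for k >= n. *)
Definition root_element (F : fieldType) (r : 'I_8) (t : F) : 'M[F]_n :=
  \sum_(k < n) t ^+ k *: map_mx ratr (divided_power r k).

End RationalModules.

(** * The universal Chevalley group of type B2 and its Weyl modules *)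

Section ChevalleyGroup.
Variables (F : finFieldType) (gT : finGroupType) (G : {group gT}).
Variable x : 'I_8 -> F -> gT.

(* The weights of the defining module generate the whole weight lattice. *)
Definition weights_generate n (e f : 'I_2 -> 'M[rat]_n) : Prop :=
  forall S : 'rV[int]_2 -> Prop,
    (forall mu, is_weight e f mu -> S mu) ->
    (forall mu nu, S mu -> S nu -> S (mu - nu)) -> forall mu, S mu.

(* G, with root elements x r t, is the group generated by the elements
   exp (t e_r) acting on the reduction of an admissible lattice in a module
   whose weights generate the weight lattice. *)
Definition universal_chevalley_B2 : Prop :=
  G :=: <<[set x p.1 p.2 | p in [set: 'I_8 * F]]>>%g /\
  exists n (e f : 'I_2 -> 'M[rat]_n) (rG : mx_representation F G n),
    [/\ B2_action e f, admissible e f, weights_generate e f, mx_faithful rG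
      & forall r t, rG (x r t) = root_element e f r t].

(* Representations act on the left on column vectors.  rG is isomorphic,
   through B, to the Weyl module of highest weight lam, and v0 corresponds to
   the highest weight vector. *)
Definition weyl_module (lam : 'rV[int]_2) n (rG : mx_representation F G n)
    (v0 : 'cV[F]_n) : Prop :=
  exists (e f : 'I_2 -> 'M[rat]_n) (v : 'cV[rat]_n) (B : 'M[F]_n),
    [/\ minimal_lattice_module e f lam v, B \in unitmx,
        forall r t, rG (x r t) *m B = B *m root_element e f r t
      & v0 = B *m map_mx ratr v].

Definition gact n (rG : mx_representation F G n) (g : gT)
    (U : {vspace 'cV[F]_n}) : {vspace 'cV[F]_n} :=
  (linfun (mulmx (rG g)) @: U)%VS.

(* F^d, with the form Q, is the natural module of G, i.e. its Weyl module for
   the first fundamental weight. *)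
Definition natural_orthogonal_module d (Q : 'cV[F]_d -> F)
    (rV : mx_representation F G d) : Prop :=
  (exists w, weyl_module (omega 0) rV w) /\
  (forall g u, g \in G -> Q (rV g *m u) = Q u).

Definition veronesean_weyl_embedding d (Q : 'cV[F]_d -> F)
    (rV : mx_representation F G d) n (rW : mx_representation F G n)
    (eps : point (dual_polar_space Q) -> {vspace 'cV[F]_n}) : Prop :=
  exists (v0 : 'cV[F]_n) (X0 : point (dual_polar_space Q)),
    [/\ weyl_module (omega 1 *+ 2) rW v0,
        forall g, g \in G -> gact rW g <[v0]>%VS = <[v0]>%VS ->
          gact rV g (val X0) = val X0
      & forall g X, g \in G -> val X = gact rV g (val X0) ->
          eps X = gact rW g <[v0]>%VS].

End ChevalleyGroup.

(* Main.v *)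
Require Import Defs.
From HB Require Import structures.
From mathcomp Require Import all_boot all_order all_algebra.
From mathcomp Require Import all_fingroup all_character cyclic finfield ring.
From Stdlib Require Import Classical ClassicalEpsilon.

Set Implicit Arguments.
Unset Strict Implicit.
Unset Printing Implicit Defensive.

Import GRing.Theory Num.Theory.
Local Open Scope ring_scope.

(** Let [V] be the 4-dimensional spin module of [G] with its alternating form.
    In odd characteristic everything lives in the tensor square of [V]: the
    Weyl module of highest weight [omega 1 *+ 2] is the space of symmetric
    tensors, and the natural module is the space of alternating tensors that
    are traceless for the form.  A nonzero vector [u] of [V], or spinor,
    determines the totally singular plane of all wedges of [u] with the
    vectors orthogonal to [u]
    ([spinor_plane]); all totally singular planes arise in this way, the lines
    of the dual polar space are the totally isotropic planes of [V], and the
    Weyl embedding is the quadratic Veronese map that sends [u] to the tensor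
    square of [u] ([weyl_embeddingE]).  A totally isotropic plane goes to the
    conic of the tensors of rank one in its symmetric square, which gives
    [eps_veronesean].

    Suppose that another veronesean embedding covers this one through a
    semilinear map [f].  Each tensor square has a unique lift [vlift u] in the
    corresponding point of the covering space.  A nonsingular conic spans only
    a 3-space, and [f] maps three suitable points of it to independent points,
    so the relations between the tensor squares of the vectors of a totally
    isotropic plane lift ([vlift_plane]): [vlift] is quadratic on every
    totally isotropic plane.  The heart of the proof,
    [quadratic_of_isotropic], says that such a function is quadratic on all
    of [V].  Hence ten vectors, lying over a basis of the symmetric tensors,
    span the covering space, and [f] is bijective ([morphism_bijective]).

    For [quadratic_of_isotropic], let [h] be quadratic on totally isotropic
    planes, and let [T] be an anti-isometry from a hyperbolic plane to its
    orthogonal complement.  The graphs of [T] and [- T] are totally isotropic,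
    so [h x + h (T x)] is quadratic in [x].  Composing [T] with elements of
    SL2 shows that [h] differs from its SL2-translates by quadratic functions,
    and [SL2_invariant_quadratic] deduces that [h] is quadratic on the
    hyperbolic plane: the obstruction is a derivation of the field, and finite
    fields have none.  A square other than 0 and 1 is needed there, whence
    the hypothesis that the field has more than three elements.  Now [h] is
    quadratic on every plane, so it satisfies the parallelogram law, and the
    argument of Jordan and von Neumann makes its polarization bilinear.

    The modules are identified by [highest_weight_iso]: the submodule
    generated by a pair of highest weight vectors in a direct sum is the graph
    of an isomorphism, which respects the minimal admissible lattices and so
    survives reduction to the finite field.  The abstract group [G] is never
    identified with a symplectic group; it suffices that each product of
    symplectic root elements is matched by an element of [G] acting in the
    same way on both modules ([spin_lift]). *)

(** * Functions on a plane that are quadratic up to the action of SL2 *)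

Section InvariantQuadratic.
Variable K : fieldType.

Definition quadratic2 (g : K -> K -> K) : Prop :=
  exists A B C, forall a b, g a b = A * a ^+ 2 + B * (a * b) + C * b ^+ 2.

(** Every element is an n-th power with n = 0 in the field, so its derivative
    vanishes. *)
Lemma derivation_eq0 (n : nat) (p : K -> K) :
  n%:R = 0 :> K -> (forall x : K, x ^+ n = x) ->
  (forall x y, p (x * y) = x * p y + y * p x) -> forall x, p x = 0.
Proof.
move=> n0 xn pM x.
have p1 : p 1 = 0.
  by have /eqP := pM 1 1; rewrite !mul1r -subr_eq0 opprD addrA subrr sub0r oppr_eq0 => /eqP.
have pX m : p (x ^+ m.+1) = m.+1%:R * x ^+ m * p x.
  elim: m => [|m IHm]; first by rewrite expr1 expr0 !mul1r.
  by rewrite exprS pM IHm -[m.+2]add1n natrD exprS; ring.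
case: n n0 xn => [|n] n0 xn; last by rewrite -[x in LHS]xn pX n0 !mul0r.
by rewrite -[x]mulr1 -(xn x) expr0 mulr1.
Qed.

Hypothesis two_neq0 : 2 != 0 :> K.

(** Normalize [g] to vanish at three points and write [p] for its values in an
    affine coordinate.  Unipotent elements show that the failure of [p] to be
    additive is [A * (x * y)]; the torus shows that [p] satisfies the Leibniz
    rule when one factor is a square.  A square other than 0 and 1 then forces
    [A = 0], and as every element is a difference of two squares, [p] is a
    derivation. *)
Lemma SL2_invariant_quadratic (n : nat) (s : K) (g : K -> K -> K) :
    n%:R = 0 :> K -> (forall x : K, x ^+ n = x) -> s != 0 -> s ^+ 2 != 1 ->
    (forall c a b, g (c * a) (c * b) = c ^+ 2 * g a b) ->
    (forall t, quadratic2 (fun a b => g (a + t * b) b - g a b)) ->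
    (forall t, t != 0 -> quadratic2 (fun a b => g (t * a) (t^-1 * b) - g a b)) ->
  quadratic2 g.
Proof.
move=> n0 xn s0 s1.
pose B (g : K -> K -> K) := g 1 1 - g 1 0 - g 0 1.
pose q (g : K -> K -> K) a b :=
  g 1 0 * a ^+ 2 + B g * (a * b) + g 0 1 * b ^+ 2.
wlog: g / [/\ g 1 0 = 0, g 0 1 = 0 & g 1 1 = 0] => [IH | [g10 g01 g11]] gZ gU gT.
  have [||||A [B0 [C gE]]] := IH (fun a b => g a b - q g a b).
  - by split; rewrite /q /B; ring.
  - by move=> c a b; rewrite gZ /q; ring.
  - move=> t; have [A [B0 [C gE]]] := gU t.
    exists A, (B0 - 2 * g 1 0 * t), (C - g 1 0 * t ^+ 2 - B g * t) => a b.
    transitivity (g (a + t * b) b - g a b - (q g (a + t * b) b - q g a b)); first by ring.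
    by rewrite gE /q; ring.
  - move=> t t0; have [A [B0 [C gE]]] := gT t t0.
    exists (A - g 1 0 * t ^+ 2 + g 1 0), B0,
      (C - g 0 1 * t^-1 ^+ 2 + g 0 1) => a b.
    transitivity (g (t * a) (t^-1 * b) - g a b -
                  (q g (t * a) (t^-1 * b) - q g a b)); first by ring.
    by rewrite gE /q; field.
  exists (A + g 1 0), (B0 + B g), (C + g 0 1) => a b.
  have -> : g a b = (g a b - q g a b) + q g a b by ring.
  by rewrite gE /q; ring.
pose p x := g x 1.
have p0 : p 0 = 0 by [].
have pU t : exists A, forall x, p (x + t) = p x + p t + A * x.
  have [A [B0 [C gE]]] := gU t; exists B0 => y.
  have := gE 1 0; have := gE 0 1; have := gE y 1.
  rewrite /p !(mulr1, mulr0, addr0, add0r, expr1n, expr0n) /= g10 g01 !subr0.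
  by move=> /(canRL (subrK _)) -> -> <-; ring.
have pT t : t != 0 -> forall x, p (t ^+ 2 * x) = t ^+ 2 * p x + p (t ^+ 2) * x.
  move=> t0; have [A [B0 [C gE]]] := gT t t0 => y.
  have gt a : g (t * a) (t^-1 * 1) = t^-1 ^+ 2 * p (t ^+ 2 * a).
    by rewrite -gZ; congr g; field.
  have gt1 : g (t * 1) (t^-1 * 0) = 0.
    by have -> : t^-1 * 0 = t * 0; rewrite ?gZ ?g10 ?mulr0.
  have A0 : A = 0.
    by have := gE 1 0; rewrite gt1 g10 expr1n expr0n /= !(mulr0, mulr1, addr0, subr0).
  have C0 : C = 0.
    have := gE 0 1; rewrite gt g01 expr0n expr1n /=.
    by rewrite !(mulr0, mul0r, p0, mulr1, add0r, subr0).
  have E1 := gE 1 1; have Ey := gE y 1; move: E1 Ey.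
  rewrite !gt -/(p y) g11 !mulr1 A0 C0 !mul0r !add0r !addr0 subr0 => <-.
  move=> /(canRL (subrK _)) E.
  have -> : p (t ^+ 2 * y) = t ^+ 2 * (t^-1 ^+ 2 * p (t ^+ 2 * y)) by field.
  by rewrite E; field.
(* The defect of additivity is linear in each variable and symmetric. *)
have [A pD] : exists A, forall x y, p (x + y) = p x + p y + A * (x * y).
  have [A pD1] := pU 1; exists A => x y.
  have [A' pDy] := pU y.
  have := pDy 1; rewrite addrC pD1 => /eqP.
  rewrite (addrC (p 1)) -subr_eq0 [X in X == 0](_ : _ = A * y - A'); last by ring.
  by rewrite subr_eq0 pDy => /eqP <-; ring.
(* Compare [p] at twice [s ^+ 2] and at twice 1. *)
have A0 : A = 0.
  have := pD (s ^+ 2 * 1) (s ^+ 2 * 1); rewrite -mulrDr.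
  rewrite !pT // pD [p 1]g11 => /eqP; rewrite -subr_eq0.
  rewrite [X in X == 0](_ : _ = A * s ^+ 2 * (1 - s ^+ 2)); last by ring.
  rewrite -mulrA mulf_eq0 => /orP[/eqP //|].
  by rewrite mulf_eq0 subr_eq0 expf_eq0 /= (negPf s0) eq_sym (negPf s1).
have {}pD x y : p (x + y) = p x + p y by rewrite pD A0 mul0r addr0.
have {A0} pN x : p (- x) = - p x.
  by apply/eqP; rewrite -addr_eq0 -pD addNr p0.
have {}pT t x : p (t ^+ 2 * x) = t ^+ 2 * p x + p (t ^+ 2) * x.
  have [->|/pT //] := eqVneq t 0.
  by rewrite expr0n /= mul0r p0; ring.
have pM x y : p (x * y) = x * p y + y * p x.
  (* Every element is a difference of two squares. *)
  have xE : x = ((x + 1) / 2) ^+ 2 - ((x - 1) / 2) ^+ 2 by field.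
  rewrite [in LHS]xE mulrBl pD pN !pT [in X in _ = X + _]xE.
  by rewrite [in X in _ = _ + X]xE pD pN; ring.
exists 0, 0, 0 => a b; rewrite !mul0r !addr0.
have [->|b0] := eqVneq b 0.
  by rewrite -[a]mulr1 -[X in g _ X](mulr0 a) gZ g10 mulr0.
have -> : g a b = b ^+ 2 * p (a / b) by rewrite -gZ; congr g; field.
by rewrite (derivation_eq0 n0 xn pM) mulr0.
Qed.

End InvariantQuadratic.

(** * Functions quadratic on the totally isotropic planes of a symplectic 4-space *)

Notation o0 := (@Ordinal 4 0 isT).
Notation o1 := (@Ordinal 4 1 isT).
Notation o2 := (@Ordinal 4 2 isT).
Notation o3 := (@Ordinal 4 3 isT).

Definition sform (R : comRingType) (u w : 'cV[R]_4) : R :=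
  u o0 0 * w o3 0 - u o3 0 * w o0 0 + (u o1 0 * w o2 0 - u o2 0 * w o1 0).

(** The entries on or above the diagonal of a symmetric matrix of size 4. *)
Definition sym_pos (k : 'I_10) : 'I_4 * 'I_4 :=
  nth (o0, o0) [:: (o0, o0); (o0, o1); (o0, o2); (o0, o3); (o1, o1);
                   (o1, o2); (o1, o3); (o2, o2); (o2, o3); (o3, o3)] k.

Lemma col4E (R : comRingType) (u : 'cV[R]_4) :
  u = u o0 0 *: delta_mx o0 0 + u o1 0 *: delta_mx o1 0 +
      u o2 0 *: delta_mx o2 0 + u o3 0 *: delta_mx o3 0.
Proof.
apply/matrixP=> i j; rewrite !mxE (ord1 j) eqxx.
by case: i => [[|[|[|[|//]]]] lti]; rewrite ?mulr1 ?mulr0 ?addr0 ?add0r;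
   congr (u _ _); apply: val_inj.
Qed.

Section QuadraticOnTotallyIsotropic.
Variables (K : fieldType) (h : 'cV[K]_4 -> K).
Hypothesis two_neq0 : 2 != 0 :> K.

Definition polarization (V : zmodType) (W : zmodType) (h : V -> W) u w :=
  h (u + w) - h u - h w.

Let quad u w := quadratic2 (fun a b => h (a *: u + b *: w)).

Lemma quad_polar u w a b : quad u w ->
  h (a *: u + b *: w) =
  a ^+ 2 * h u + (a * b) * polarization h u w + b ^+ 2 * h w.
Proof.
move=> [A [B [C hE]]].
have hu : h u = A by have := hE 1 0; rewrite scale0r addr0 scale1r => ->; ring.
have hw : h w = C by have := hE 0 1; rewrite scale0r add0r scale1r => ->; ring.
have huw : h (u + w) = A + B + C.
  by have := hE 1 1; rewrite !scale1r => ->; ring.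
by rewrite hE /polarization hu hw huw; ring.
Qed.

Lemma sformDl (u v w : 'cV[K]_4) : sform (u + v) w = sform u w + sform v w.
Proof. by rewrite /sform !mxE; ring. Qed.
Lemma sformDr (u v w : 'cV[K]_4) : sform w (u + v) = sform w u + sform w v.
Proof. by rewrite /sform !mxE; ring. Qed.
Lemma sformZl a (u w : 'cV[K]_4) : sform (a *: u) w = a * sform u w.
Proof. by rewrite /sform !mxE; ring. Qed.
Lemma sformZr a (u w : 'cV[K]_4) : sform u (a *: w) = a * sform u w.
Proof. by rewrite /sform !mxE; ring. Qed.
Lemma sformC (u w : 'cV[K]_4) : sform w u = - sform u w.
Proof. by rewrite /sform; ring. Qed.
Lemma sformxx (u : 'cV[K]_4) : sform u u = 0.
Proof. by rewrite /sform; ring. Qed.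
Let sformE := (sformDl, sformDr, sformZl, sformZr, sformxx).

(** Project onto the orthogonal complement of the hyperbolic plane [e, f].  The
    projections of the two standard hyperbolic pairs have forms adding up to
    1, so one of the two pairs stays hyperbolic. *)
Lemma sform_complement (m : K) (e f : 'cV[K]_4) : sform e f != 0 ->
  exists e' f', [/\ sform e e' = 0, sform e f' = 0, sform f e' = 0,
                    sform f f' = 0 & sform e' f' = m].
Proof.
move=> ef0; set d := sform e f in ef0.
pose pr x := x - (sform x f / d) *: e + (sform x e / d) *: f.
have pre x : sform e (pr x) = 0.
  by rewrite /pr -scaleNr !sformE (sformC e x) -/d; field.
have prf x : sform f (pr x) = 0.
  by rewrite /pr -scaleNr !sformE (sformC e f) (sformC f x) -/d; field.
have sc x y : sform (pr x) (pr y) != 0 -> exists e' f',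
    [/\ sform e e' = 0, sform e f' = 0, sform f e' = 0, sform f f' = 0
      & sform e' f' = m].
  move=> xy0; exists (pr x), ((m / sform (pr x) (pr y)) *: pr y).
  by split; rewrite ?sformZr ?pre ?prf ?mulr0 // divfK.
pose d4 i : 'cV[K]_4 := delta_mx i 0.
have tr1 : sform (pr (d4 o0)) (pr (d4 o3)) + sform (pr (d4 o1)) (pr (d4 o2)) = 1.
  have prE x y : sform (pr x) (pr y) =
      sform x y + (sform x e * sform f y - sform x f * sform e y) / d.
    rewrite /pr -!scaleNr !sformE (sformC e f) -/d (sformC e y) (sformC f y).
    by field.
  rewrite !prE addrACA -mulrDl [X in X / d](_ : _ = - d).
    by rewrite [X in X + _](_ : _ = 2) /sform /d4 ?mxE /=; field.
  by rewrite /d /sform /d4 !mxE /=; ring.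
have [x0|/sc//] := eqVneq (sform (pr (d4 o0)) (pr (d4 o3))) 0.
apply: (sc (d4 o1) (d4 o2)); move: tr1; rewrite x0 add0r => ->.
exact: oner_neq0.
Qed.

Hypothesis h_isotropic : forall u w, sform u w = 0 -> quad u w.

Lemma homogeneous2 c u : h (c *: u) = c ^+ 2 * h u.
Proof.
have /(quad_polar c 0) := h_isotropic (sformxx u).
by rewrite scale0r addr0 => ->; ring.
Qed.

Lemma isotropic_parallelogram x y : sform x y = 0 ->
  h (x + y) + h (x - y) = 2 * h x + 2 * h y.
Proof.
move=> /h_isotropic q; have := quad_polar 1 1 q; have := quad_polar 1 (-1) q.
by rewrite !scale1r scaleN1r => -> ->; ring.
Qed.

(** The planes spanned by [e + e', f + f'] and [e - e', f - f'] are totally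
    isotropic, being the graphs of an anti-isometry and of its opposite.  A
    vector is orthogonal to its image, so the values of [h] on the two graphs
    add up to [2 * h x + 2 * h (T x)]. *)
Lemma quadratic_anti_isometry e f e' f' :
    [/\ sform e e' = 0, sform e f' = 0, sform f e' = 0, sform f f' = 0
      & sform e' f' = - sform e f] ->
  quadratic2 (fun a b => h (a *: e + b *: f) + h (a *: e' + b *: f')).
Proof.
move=> [ee ef fe ff s].
have [] : quad (e + e') (f + f') /\ quad (e - e') (f - f').
  split; apply: h_isotropic; rewrite -?scaleN1r !sformE ef (sformC f e') fe s; ring.
move=> [A [B [C hE]]] [A' [B' [C' hE']]].
exists ((A + A') / 2), ((B + B') / 2), ((C + C') / 2) => a b.
set x := a *: e + b *: f; set y := a *: e' + b *: f'.
have xy : sform x y = 0 by rewrite !sformE ee ef fe ff; ring.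
have := isotropic_parallelogram xy.
have -> : x + y = a *: (e + e') + b *: (f + f').
  by rewrite !scalerDr addrACA.
have -> : x - y = a *: (e - e') + b *: (f - f').
  by rewrite !scalerBr opprD addrACA.
rewrite hE hE' => E; apply: (mulfI two_neq0); rewrite mulrDr -E; by field.
Qed.

Variables (n : nat) (s : K).
Hypotheses (n0 : n%:R = 0 :> K) (xn : forall x : K, x ^+ n = x).
Hypotheses (s_neq0 : s != 0) (s2_neq1 : s ^+ 2 != 1).

(** On a hyperbolic plane, compose the anti-isometry onto the complement with an
    element of SL2 and subtract: the part on the complement cancels. *)
Lemma quadratic_plane u w : quad u w.
Proof.
have [/h_isotropic //|uw0] := eqVneq (sform u w) 0.
have [u' [w' [uu' uw' wu' ww' s']]] := sform_complement (- sform u w) uw0.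
have base : quadratic2 (fun a b => h (a *: u + b *: w) + h (a *: u' + b *: w')).
  by apply: quadratic_anti_isometry.
apply: (SL2_invariant_quadratic two_neq0 n0 xn s_neq0 s2_neq1).
- by move=> c a b; rewrite -!scalerA -scalerDr homogeneous2.
- move=> t; have [A [B [C hE]]] := base.
  have [|A' [B' [C' hE']]] := @quadratic_anti_isometry u (t *: u + w) u' w'.
    by rewrite !sformE; split=> //; rewrite ?s' ?uu' ?wu' ?uw' ?ww'; ring.
  exists (A' - A), (B' - B), (C' - C) => a b.
  have := hE' a b; have := hE a b.
  have -> : a *: u + b *: (t *: u + w) = (a + t * b) *: u + b *: w.
    by rewrite scalerDr scalerA addrA -scalerDl (mulrC b).
  by move=> /(canRL (addrK _)) -> /(canRL (addrK _)) ->; ring.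
- move=> t t0; have [A [B [C hE]]] := base.
  have [|A' [B' [C' hE']]] := @quadratic_anti_isometry (t *: u) (t^-1 *: w) u' w'.
    by rewrite !sformE; split=> //; rewrite ?s' ?uu' ?wu' ?uw' ?ww'; field.
  exists (A' - A), (B' - B), (C' - C) => a b.
  have := hE' a b; have := hE a b.
  rewrite !scalerA (mulrC a t) (mulrC b t^-1).
  by move=> /(canRL (addrK _)) -> /(canRL (addrK _)) ->; ring.
Qed.

Lemma parallelogram x y : h (x + y) + h (x - y) = 2 * h x + 2 * h y.
Proof.
have q := quadratic_plane x y.
have := quad_polar 1 1 q; have := quad_polar 1 (-1) q.
by rewrite !scale1r scaleN1r => -> ->; ring.
Qed.

(** The Jordan and von Neumann argument. *)
Lemma polarizationDl x y z :
  polarization h (x + y) z = polarization h x z + polarization h y z.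
Proof.
apply: (mulfI two_neq0); rewrite /polarization.
have E1 := parallelogram (x + y) z.
have E2 := parallelogram x (y - z).
have E3 := parallelogram (x + z) y.
have E4 := parallelogram y z.
move: E1 E2 E3; rewrite (addrAC x z y) !opprB !addrA (addrAC x z (- y)).
rewrite (addrAC x (- y) z).
set p := h (x + y + z); set q := h (x + y - z); set r := h (x + z - y).
rewrite -/p => /(canRL (addrK _)) E1 E2 E3.
have {}E2 : q = 2 * h x + 2 * h (y - z) - r by rewrite -E2; ring.
have {}E3 : r = 2 * h (x + z) + 2 * h y - p by rewrite -E3; ring.
have {}E4 : h (y - z) = 2 * h y + 2 * h z - h (y + z) by rewrite -E4; ring.
have : 2 * p = 2 * h (x + y) + 2 * h z - q + p by rewrite E1; ring.
rewrite E2 E3 E4 !mulrBr => ->; ring.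
Qed.

Lemma polarizationZ a b x y :
  polarization h (a *: x) (b *: y) = a * b * polarization h x y.
Proof.
rewrite {1}/polarization (quad_polar _ _ (quadratic_plane x y)) !homogeneous2.
by ring.
Qed.

Theorem quadratic_of_isotropic u :
  h u = \sum_(k < 10) u (sym_pos k).1 0 * u (sym_pos k).2 0 *
    (let d i : 'cV[K]_4 := delta_mx i 0 in
     if (sym_pos k).1 == (sym_pos k).2 then h (d (sym_pos k).1)
     else polarization h (d (sym_pos k).1) (d (sym_pos k).2)).
Proof.
rewrite {1}[u]col4E !big_ord_recl big_ord0 /sym_pos /=.
have hD x y : h (x + y) = h x + h y + polarization h x y.
  by rewrite /polarization; ring.
by rewrite !(hD, polarizationDl, polarizationZ, homogeneous2); ring.
Qed.

End QuadraticOnTotallyIsotropic.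

(** * Uniqueness of the irreducible module with a given highest weight *)

(** A subspace of maximal dimension among those inside [S] is the whole of [S]. *)
Lemma vspace_of_pred (K : fieldType) (V : vectType K) (S : V -> Prop) :
    S 0 -> (forall a u w, S u -> S w -> S (a *: u + w)) ->
  exists U : {vspace V}, forall u, u \in U <-> S u.
Proof.
move=> S0 SL.
have ext d (U : {vspace V}) : (forall u, u \in U -> S u) ->
    (\dim {:V} - \dim U <= d)%N -> exists U : {vspace V}, forall u, u \in U <-> S u.
  elim: d U => [|d IHd] U US dU.
    exists U => u; split=> [/US //|_].
    suff -> : U = fullv by rewrite memvf.
    by apply/eqP; rewrite eqEdim subvf /= -subn_eq0 -leqn0.
  case: (classic (exists2 u, S u & u \notin U)) => [[u Su uU]|noU].
    have US' w : w \in (U + <[u]>)%VS -> S w.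
      case/memv_addP=> w1 w1U [w2 /vlineP[a ->] ->].
      by rewrite addrC; apply: SL => //; apply: US.
    apply: (IHd _ US'); move: dU; rewrite !leq_subLR addnS -addSn => /leq_trans.
    apply; rewrite leq_add2r.
    have -> : \dim (U + <[u]>) = (\dim U + \dim <[u]>)%N.
      apply/dimv_disjoint_sum/eqP; rewrite -subv0; apply/subvP=> w.
      rewrite memv_cap => /andP[wU /vlineP[a wE]]; rewrite memv0 wE.
      apply/negPn/negP; rewrite scaler_eq0 negb_or => /andP[a0 _].
      by case/negP: uU; rewrite -[u](scalerK a0) -wE memvZ.
    rewrite dim_vline; case: eqVneq uU => [->|_ _]; first by rewrite mem0v.
    by rewrite addn1.
  exists U => u; split=> [/US //|Su]; apply/negPn/negP=> uU; apply: noU.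
  by exists u.
apply: (ext (\dim {:V}) 0%VS) => [u|]; last exact: leq_subr.
by rewrite memv0 => /eqP ->.
Qed.

Section HighestWeightUniqueness.
Variables (n : nat) (e f e' f' : 'I_2 -> 'M[rat]_n) (lam : 'rV[int]_2).
Variables (v v' : 'cV[rat]_n).

(** The submodule generated by the pair [(v, v')] in a direct sum of two modules;
    lowering operators suffice, since raising operators kill the generator. *)
Inductive graph : 'cV[rat]_n -> 'cV[rat]_n -> Prop :=
| Graph_gen : graph v v'
| Graph_lin a u u' w w' : graph u u' -> graph w w' ->
    graph (a *: u + w) (a *: u' + w')
| Graph_f i u u' : graph u u' -> graph (f i *m u) (f' i *m u').

Lemma graph0 : graph 0 0.
Proof.
by have := Graph_lin (-1) Graph_gen Graph_gen; rewrite !scaleN1r !addNr.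
Qed.

Lemma graphZ a u u' : graph u u' -> graph (a *: u) (a *: u').
Proof. by move=> g; have := Graph_lin a g graph0; rewrite !addr0. Qed.

Lemma graphB u u' w w' : graph u u' -> graph w w' -> graph (u - w) (u' - w').
Proof. by move=> g g'; have := Graph_lin (-1) g' g; rewrite !scaleN1r ![- _ + _]addrC. Qed.

Lemma graphD u u' w w' : graph u u' -> graph w w' -> graph (u + w) (u' + w').
Proof. by move=> g g'; have := Graph_lin 1 g g'; rewrite !scale1r. Qed.

Hypotheses (act : B2_action e f) (act' : B2_action e' f').
Hypotheses (wv : weight_vector e f lam v) (wv' : weight_vector e' f' lam v').
Hypotheses (ev : forall i, e i *m v = 0) (ev' : forall i, e' i *m v' = 0).

Lemma coroot_f (g h : 'I_2 -> 'M[rat]_n) (u : 'cV_n) i j : B2_action g h ->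
  coroot g h i *m (h j *m u) =
  h j *m (coroot g h i *m u) - (cartan_B2 i j)%:~R *: (h j *m u).
Proof.
case=> _ _ _ /(_ i j) /(canRL (subrK _)) E _.
by rewrite !mulmxA E mulmxDl mulNmx -scalemxAl addrC.
Qed.

Lemma e_f (g h : 'I_2 -> 'M[rat]_n) (u : 'cV_n) i j : B2_action g h ->
  g i *m (h j *m u) =
  h j *m (g i *m u) + (if i == j then coroot g h i *m u else 0).
Proof.
case=> _ /(_ i j) E _ _ _; rewrite !mulmxA addrC.
have -> : g i *m h j = lie (g i) (h j) + h j *m g i by rewrite subrK.
rewrite mulmxDl; congr (_ + _); case: eqVneq E => [<- _ //|_ -> //].
by rewrite mul0mx.
Qed.

Lemma graph_coroot i u u' : graph u u' ->
  graph (coroot e f i *m u) (coroot e' f' i *m u').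
Proof.
move=> g; elim: g i => {u u'} [|a u u' w w' _ IHu _ IHw|j u u' gu IHu] i.
- by rewrite wv wv'; apply/graphZ/Graph_gen.
- by rewrite !mulmxDr -!scalemxAr; apply: Graph_lin.
- rewrite (coroot_f _ _ _ act) (coroot_f _ _ _ act').
  by apply: graphB; [apply: Graph_f (IHu i)|apply/graphZ/Graph_f].
Qed.

(** Move the raising operator to the right, past the lowering ones. *)
Lemma graph_e i u u' : graph u u' -> graph (e i *m u) (e' i *m u').
Proof.
move=> g; elim: g i => {u u'} [|a u u' w w' _ IHu _ IHw|j u u' gu IHu] i.
- by rewrite ev ev'; apply: graph0.
- by rewrite !mulmxDr -!scalemxAr; apply: Graph_lin.
- rewrite (e_f _ _ _ act) (e_f _ _ _ act').
  apply: graphD; first exact: Graph_f (IHu i).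
  by case: eqP => _; [apply: graph_coroot|apply: graph0].
Qed.

Let pres X X' := forall u u', graph u u' -> graph (X *m u) (X' *m u').

Lemma graph_divided_power r k :
  pres (divided_power e f r k) (divided_power e' f' r k).
Proof.
have presZ a X X' : pres X X' -> pres (a *: X) (a *: X').
  by move=> XP u u' /XP g; rewrite -!scalemxAl; apply: graphZ.
have presM X X' Y Y' : pres X X' -> pres Y Y' -> pres (X *m Y) (X' *m Y').
  by move=> XP YP u u' /YP /XP g; rewrite -!mulmxA.
have presL X X' Y Y' : pres X X' -> pres Y Y' -> pres (lie X Y) (lie X' Y').
  move=> XP YP u u' g; rewrite /lie !mulmxBl.
  by apply: graphB; apply: presM g.
apply: (presZ); have re i : pres (e i) (e' i) := @graph_e i.
have rf i : pres (f i) (f' i) by move=> u u'; apply: Graph_f.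
have rr : pres (root_vector e f r) (root_vector e' f' r).
  case: r => -[|[|[|[|[|[|[|[|//]]]]]]]] ?; rewrite /root_vector /=;
    by do ?[exact: re | exact: rf | apply: (presL) | apply: (presZ)].
elim: k => [|k IHk]; last by rewrite !exprS; apply: presM.
by rewrite !expr0 => u u'; rewrite !mul1mx.
Qed.

Lemma kostant_graph_l u : kostant_span e f v u ->
  exists2 u', kostant_span e' f' v' u' & graph u u'.
Proof.
elim=> {u} [|u w _ [u' ku' gu] _ [w' kw' gw]|r k u _ [u' ku' gu]].
- by exists v'; [apply: Kostant_gen|apply: Graph_gen].
- by exists (u' - w'); [apply: Kostant_sub|apply: graphB].
- by exists (divided_power e' f' r k *m u');
    [apply: Kostant_act|apply: graph_divided_power].
Qed.

Lemma kostant_graph_r u' : kostant_span e' f' v' u' ->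
  exists2 u, kostant_span e f v u & graph u u'.
Proof.
elim=> {u'} [|u' w' _ [u ku gu] _ [w kw gw]|r k u' _ [u ku gu]].
- by exists v; [apply: Kostant_gen|apply: Graph_gen].
- by exists (u - w); [apply: Kostant_sub|apply: graphB].
- by exists (divided_power e f r k *m u);
    [apply: Kostant_act|apply: graph_divided_power].
Qed.

Section Kill.
Variables (g h : 'I_2 -> 'M[rat]_n).
Let T := 4%:R *: coroot g h 0 + 3%:R *: coroot g h 1.

(** The product of the operators [T - (c - 2 * k)] for [k < m].  Both simple
    roots take the value 2 on [T], so [T] grades the module by depth below the
    highest weight, and the product kills a sum of vectors of the first [m]
    depths when [c] is the eigenvalue of the top one. *)
Fixpoint kill (c : rat) m (u : 'cV[rat]_n) : 'cV[rat]_n :=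
  if m is m'.+1 then T *m kill c m' u - (c - 2 * m'%:R) *: kill c m' u else u.

Lemma kill_lin c m a u w : kill c m (a *: u + w) = a *: kill c m u + kill c m w.
Proof.
elim: m => //= m ->; rewrite mulmxDr -scalemxAr (scalerDr (c - _)) opprD addrACA.
by rewrite scalerBr !scalerA (mulrC a).
Qed.

Lemma killZ c m a u : kill c m (a *: u) = a *: kill c m u.
Proof.
elim: m => //= m ->.
by rewrite -scalemxAr scalerBr !scalerA (mulrC a).
Qed.

Lemma kill_add c m k u : kill c m u = 0 -> kill c (k + m) u = 0.
Proof.
by move=> u0; elim: k => //= k ->; rewrite mulmx0 scaler0 subrr.
Qed.

Lemma kill_peel c m u : kill c m.+1 u = kill (c - 2) m (T *m u - c *: u).
Proof.
elim: m => [|m IHm]; first by rewrite /= mulr0 subr0.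
rewrite [LHS]/= -/(kill c m.+1 u) IHm /=; congr (_ - _ *: _).
by rewrite -addn1 natrD; ring.
Qed.

Hypothesis actg : B2_action g h.

Lemma T_h j (u : 'cV_n) : T *m (h j *m u) = h j *m (T *m u) - 2 *: (h j *m u).
Proof.
have TE (x : 'cV_n) : T *m x = 4%:R *: (coroot g h 0 *m x) + 3%:R *: (coroot g h 1 *m x).
  by rewrite mulmxDl -!scalemxAl.
rewrite !TE !(coroot_f _ _ _ actg) !scalerBr !scalerA addrACA -opprD -scalerDl.
have -> : 4%:R * (cartan_B2 0 j)%:~R + 3%:R * (cartan_B2 1 j)%:~R = 2 :> rat.
  by case: j => [[|[|//]]] ?; rewrite /cartan_B2 -!val_eqE /=.
by rewrite mulmxDr -!scalemxAr.
Qed.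

Lemma kill_h c m j u : kill c m (h j *m u) = h j *m kill (c + 2) m u.
Proof.
elim: m => //= m ->; rewrite T_h mulmxBr -scalemxAr -addrA -opprD -scalerDl.
by congr (_ - _ *: _); ring.
Qed.

Lemma kill_T c m u : kill c m (T *m u) = T *m kill c m u.
Proof. by elim: m => //= m ->; rewrite mulmxBr -scalemxAr. Qed.

Variable (w : 'cV[rat]_n).
Let a : rat := 4%:R * (lam 0 0)%:~R + 3%:R * (lam 0 1)%:~R.
Hypothesis ww : weight_vector g h lam w.

Lemma T_w : T *m w = a *: w.
Proof. by rewrite mulmxDl -!scalemxAl !ww !scalerA -scalerDl. Qed.

Lemma kill_w m : exists2 b, b != 0 & kill (a - 2) m w = b *: w.
Proof.
elim: m => [|m [b b0 E]]; first by exists 1; rewrite ?scale1r.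
exists (b * (2 * m.+1%:R)); first by rewrite !mulf_neq0 ?pnatr_eq0.
rewrite /= E -scalemxAr T_w !scalerA -scalerBl; congr (_ *: _).
by rewrite -addn1 natrD; ring.
Qed.

Lemma kill_raise c0 m j u :
  kill (a - 2) m (u - c0 *: w) = 0 -> kill (a - 2) m.+1 (h j *m u) = 0.
Proof.
move=> u0; rewrite kill_h subrK kill_peel.
have -> : T *m u - a *: u = T *m (u - c0 *: w) - a *: (u - c0 *: w).
  by rewrite mulmxBr -scalemxAr T_w scalerBr !scalerA (mulrC a) opprB addrA subrK.
by rewrite [T *m _ - _]addrC -scaleNr kill_lin kill_T u0 mulmx0 scaler0 addr0 mulmx0.
Qed.

End Kill.

(** In the direct sum, the highest weight space of the graph is the line of
    [(v, v')]: all words in the lowering operators have smaller weights.  The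
    scalar [c] is the same on both sides. *)
Lemma graph_weight u u' : graph u u' -> exists c m m',
  let a : rat := 4%:R * (lam 0 0)%:~R + 3%:R * (lam 0 1)%:~R in
  kill e f (a - 2) m (u - c *: v) = 0 /\ kill e' f' (a - 2) m' (u' - c *: v') = 0.
Proof.
elim=> {u u'} [|b u u' w w' _ [c [m [m' [E E']]]] _ [d [k [k' [D D']]]]|i u u' _ [c [m [m' [E E']]]]].
- by exists 1, 0%N, 0%N; rewrite !scale1r !subrr.
- exists (b * c + d), (k + m)%N, (k' + m')%N.
  have lin (x y z : 'cV[rat]_n) :
      b *: x + y - (b * c + d) *: z = b *: (x - c *: z) + (y - d *: z).
    by rewrite scalerBr scalerA addrACA -opprD -scalerDl.
  rewrite /= !lin !kill_lin; split.
    by rewrite (kill_add k E) addnC (kill_add m D) scaler0 addr0.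
  by rewrite (kill_add k' E') addnC (kill_add m' D') scaler0 addr0.
- exists 0, m.+1, m'.+1; rewrite /= !scale0r !subr0.
  by split; [apply: kill_raise E|apply: kill_raise E'].
Qed.

Hypotheses (v_neq0 : v != 0) (v'_neq0 : v' != 0).
Hypothesis irr : irreducible_action e f.

(** The vectors [u] with [(u, 0)] in the graph form a submodule.  If it were
    everything, the graph would contain [(v, 0)], which has the highest weight
    but is not on the line of [(v, v')]. *)
Lemma graph_inj u : graph u 0 -> u = 0.
Proof.
have S0 : graph 0 0 := graph0.
have [|U UE] := @vspace_of_pred _ _ (fun u => graph u 0) S0.
  by move=> a w w' gw gw'; have := Graph_lin a gw gw'; rewrite scaler0 addr0.
have [i w wU|U0|UT] := @irr U.
- move/UE: wU => gw; split; apply/UE; first by have := graph_e i gw; rewrite mulmx0.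
  by have := Graph_f i gw; rewrite mulmx0.
- by move/UE; rewrite U0 memv0 => /eqP.
have /UE gv : v \in U by rewrite UT memvf.
have [c [m [m' /= []]]] := graph_weight gv.
move=> E; rewrite sub0r -scaleNr killZ; have [b b0 ->] := kill_w wv' m'.
move=> /eqP; rewrite scalerA scaler_eq0 (negPf v'_neq0) orbF mulf_eq0 (negPf b0).
rewrite orbF oppr_eq0 => /eqP c0; move: E; rewrite c0 scale0r subr0.
have [b' b'0 ->] := kill_w wv m; move/eqP.
by rewrite scaler_eq0 (negPf b'0) (negPf v_neq0).
Qed.

Hypothesis lat : forall u, kostant_span e f v u <-> integral_vector u.
Hypothesis lat' : forall u, kostant_span e' f' v' u <-> integral_vector u.

Lemma integral_delta k : integral_vector (delta_mx k 0 : 'cV[rat]_n).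
Proof. by move=> i; rewrite !mxE; case: (_ && _). Qed.

(** The graph is that of an isomorphism.  It carries one minimal lattice onto the
    other, so its matrix and the inverse matrix are integral; this is what
    allows the comparison to be reduced to another field. *)
Theorem highest_weight_iso : exists A A' : 'M[int]_n,
  let P : 'M[rat]_n := map_mx intr A in
  [/\ A *m A' = 1%:M, forall i, e i *m P = P *m e' i, forall i, f i *m P = P *m f' i
    & P *m v' = v].
Proof.
have intP (u : 'cV[rat]_n) : integral_vector u ->
    exists z : 'cV[int]_n, u = map_mx intr z.
  move=> uZ; exists (\col_i Num.floor (u i 0)); apply/matrixP=> i j.
  by rewrite !mxE (ord1 j) (floorK (uZ i)).
have gr k : exists z : 'cV[int]_n, graph (map_mx intr z) (delta_mx k 0).
  have /lat' /kostant_graph_r[u /lat /intP[z ->] g] := integral_delta k.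
  by exists z.
have gl k : exists z : 'cV[int]_n, graph (delta_mx k 0) (map_mx intr z).
  have /lat /kostant_graph_l[u /lat' /intP[z ->] g] := integral_delta k.
  by exists z.
have colchoice (R : 'I_n -> 'cV[int]_n -> Prop) :
    (forall k, exists z, R k z) -> exists A : 'M[int]_n, forall k, R k (col k A).
  move=> Rz.
  have : forall m : nat, (m <= n)%N -> exists A : 'M[int]_n,
     forall k : 'I_n, (k < m)%N -> R k (col k A).
    elim=> [_|m IHm lt_mn]; first by exists 0.
    have [A AP] := IHm (ltnW lt_mn).
    have [z zP] := Rz (Ordinal lt_mn).
    exists (\matrix_(i, j) if j == m :> nat then z i 0 else A i j) => k.
    rewrite ltnS leq_eqVlt => /orP[/eqP km|km].
      have -> : k = Ordinal lt_mn by apply: val_inj.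
      suff -> : col (Ordinal lt_mn) (\matrix_(i, j) if j == m :> nat then z i 0 else A i j) = z by [].
      by apply/matrixP=> i j; rewrite !mxE eqxx (ord1 j).
    suff -> : col k (\matrix_(i, j) if j == m :> nat then z i 0 else A i j) = col k A by exact: AP.
    by apply/matrixP=> i j; rewrite !mxE (ltn_eqF km).
  by move/(_ n (leqnn n)) => [A AP]; exists A => k; apply: AP.
have [A AP] := colchoice _ gr; have [A' A'P] := colchoice _ gl.
pose P : 'M[rat]_n := map_mx intr A; pose P' : 'M[rat]_n := map_mx intr A'.
have sumP (B : 'M[int]_n) (u : 'cV[rat]_n) :
    map_mx intr B *m u = \sum_k u k 0 *: map_mx intr (col k B).
  apply/matrixP=> i j; rewrite !mxE summxE (ord1 j).
  by apply: eq_bigr => k _; rewrite !mxE mulrC.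
have sumD (u : 'cV[rat]_n) : u = \sum_k u k 0 *: delta_mx k 0.
  by rewrite [LHS]matrix_sum_delta; apply: eq_bigr => k _; rewrite big_ord1.
have graph_sum (I : Type) (r : seq I) (c : I -> rat) U U' :
    (forall k, graph (U k) (U' k)) ->
  graph (\sum_(k <- r) c k *: U k) (\sum_(k <- r) c k *: U' k).
  move=> gU; elim: r => [|k r IHr]; first by rewrite !big_nil; apply: graph0.
  by rewrite !big_cons; apply: Graph_lin.
have gP u' : graph (P *m u') u'.
  by rewrite sumP [X in graph _ X]sumD; apply: graph_sum.
have gP' u : graph u (P' *m u).
  by rewrite sumP [X in graph X _]sumD; apply: graph_sum.
have uniq u w u' : graph u u' -> graph w u' -> u = w.
  move=> gu gw; apply/eqP; rewrite -subr_eq0; apply/eqP/graph_inj.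
  by have := graphB gu gw; rewrite subrr.
have mx_ext (X Y : 'M[rat]_n) : (forall u : 'cV_n, X *m u = Y *m u) -> X = Y.
  move=> XY; apply/matrixP=> i j; have /matrixP/(_ i 0) := XY (delta_mx j 0).
  by rewrite -!colE !mxE.
exists A, A' => /=; split.
- have inj : injective (map_mx intr : 'M[int]_n -> 'M[rat]_n).
    by move=> X Y /matrixP XY; apply/matrixP=> i j; have := XY i j; rewrite !mxE; apply: intr_inj.
  apply: inj; rewrite map_mxM map_mx1; apply: mx_ext => u.
  by rewrite mul1mx -mulmxA; apply: (uniq _ _ (P' *m u)).
- by move=> i; apply: mx_ext => u; rewrite -!mulmxA; apply: (uniq _ _ (e' i *m u)) => //;
    apply: graph_e.
- by move=> i; apply: mx_ext => u; rewrite -!mulmxA; apply: (uniq _ _ (f' i *m u)) => //;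
    apply: Graph_f.
- exact: (uniq _ _ v' (gP _) Graph_gen).
Qed.

End HighestWeightUniqueness.

(** * The spin module *)

Section Transpose.
Variables (R : pzRingType) (m n : nat).
Implicit Types A B : 'M[R]_(m, n).
Lemma trmxD A B : (A + B)^T = A^T + B^T. Proof. exact: linearD. Qed.
Lemma trmxB A B : (A - B)^T = A^T - B^T. Proof. exact: linearB. Qed.
Lemma trmxN A : (- A)^T = - A^T. Proof. exact: linearN. Qed.
Lemma trmxZ a A : (a *: A)^T = a *: A^T. Proof. exact: linearZ. Qed.
End Transpose.

Ltac delta_calc := rewrite
  ?(trmxD, trmxB, trmxN, trmxZ, trmx_delta)
  ?(mulmxDl, mulmxDr, mulmxBl, mulmxBr, mulNmx, mulmxN, mul_delta_mx_cond,
    mul0mx, mulmx0) /=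
  ?mulr0n ?mulr1n ?(mul0mx, mulmx0) ?oppr0 ?addr0 ?add0r ?opprK.

Ltac entry_ring := let i := fresh in let j := fresh in
  repeat (match goal with |- context [@delta_mx ?R ?m ?n ?k ?l] =>
    let x := fresh in set x := (@delta_mx _ m n k l); clearbody x end);
  apply/matrixP=> i j; rewrite !mxE; first [ring | by field].

Section SpinRoots.
Variable R : comNzRingType.
Let E i j : 'M[R]_4 := delta_mx i j.

(** The eight root vectors in the order of [root_vector], acting on the
    4-dimensional module; the signs are those produced by the brackets. *)
Definition spin_root (r : nat) : 'M[R]_4 :=
  nth 0 [:: E o1 o2; E o0 o1 - E o2 o3; - E o0 o2 - E o1 o3; E o0 o3;
            E o2 o1; E o1 o0 - E o3 o2; - E o2 o0 - E o3 o1; E o3 o0] r.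

Definition spin_form : 'M[R]_4 := E o0 o3 + E o1 o2 - E o2 o1 - E o3 o0.

Definition sp_lie (X : 'M[R]_4) := X^T *m spin_form + spin_form *m X = 0.
Definition sp_grp (a : 'M[R]_4) := a^T *m spin_form *m a = spin_form.

Lemma spin_root_sq r : spin_root r *m spin_root r = 0.
Proof.
case: r => [|[|[|[|[|[|[|[|r]]]]]]]]; rewrite /spin_root /= ?nth_nil ?mul0mx //;
  by rewrite /E; delta_calc.
Qed.

Lemma spin_root_lie r : sp_lie (spin_root r).
Proof.
rewrite /sp_lie; case: r => [|[|[|[|[|[|[|[|r]]]]]]]];
  rewrite /spin_root /= ?nth_nil ?trmx0 ?mul0mx ?mulmx0 ?addr0 //;
  rewrite /E /spin_form /E; delta_calc; entry_ring.
Qed.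

Lemma sp_grp1 : sp_grp 1%:M.
Proof. by rewrite /sp_grp trmx1 mul1mx mulmx1. Qed.

Lemma sp_grpM a b : sp_grp a -> sp_grp b -> sp_grp (a *m b).
Proof.
move=> Ha Hb; rewrite /sp_grp.
transitivity (b^T *m (a^T *m spin_form *m a) *m b); last by rewrite Ha.
by rewrite trmx_mul !mulmxA.
Qed.

Lemma spin_root_grp r t : sp_grp (1%:M + t *: spin_root r).
Proof.
have /eqP := spin_root_lie r; have := spin_root_sq r; rewrite addr_eq0 /sp_grp.
move: (spin_root r) spin_form => X J XX /eqP XJ.
have -> : (1%:M + t *: X)^T = 1%:M + t *: X^T by rewrite linearD linearZ /= trmx1.
rewrite mulmxDl mul1mx -scalemxAl XJ mulmxDr mulmx1 -scalemxAr mulmxDl.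
rewrite -scalemxAl mulNmx -mulmxA XX mulmx0 oppr0 scaler0 addr0.
by rewrite scalerN subrK.
Qed.

End SpinRoots.

Lemma map_spin_root (R S : comNzRingType) (g : {rmorphism R -> S}) r :
  map_mx g (spin_root R r) = spin_root S r.
Proof.
case: r => [|[|[|[|[|[|[|[|r]]]]]]]];
  rewrite /spin_root /= ?nth_nil ?map_mx0 // ?(map_mxB, map_mxN, map_delta_mx) //.
Qed.

Definition spin_e (i : 'I_2) : 'M[rat]_4 := spin_root rat i.
Definition spin_f (i : 'I_2) : 'M[rat]_4 := spin_root rat (4 + i).

Lemma spin_root_vector (r : 'I_8) : root_vector spin_e spin_f r = spin_root rat r.
Proof.
case: r => [[|[|[|[|[|[|[|[|//]]]]]]]] ?]; rewrite /root_vector /spin_e /spin_f /spin_root //= /lie;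
  rewrite ?modn_small //=; delta_calc; 
  entry_ring.
Qed.

Lemma ord2_ind (P : 'I_2 -> Prop) : P 0 -> P 1 -> forall i, P i.
Proof.
by move=> P0 P1 [[|[|//]] lti]; [move: P0|move: P1]; congr P; apply: val_inj.
Qed.

Lemma spin_coroot0 : coroot spin_e spin_f 0 = delta_mx o1 o1 - delta_mx o2 o2.
Proof. by rewrite /coroot /lie /spin_e /spin_f /spin_root /=; delta_calc. Qed.

Lemma spin_coroot1 : coroot spin_e spin_f 1 =
  delta_mx o0 o0 - delta_mx o1 o1 + delta_mx o2 o2 - delta_mx o3 o3.
Proof.
by rewrite /coroot /lie /spin_e /spin_f /spin_root /=; delta_calc; entry_ring.
Qed.

Lemma spin_action : B2_action spin_e spin_f.
Proof.
split.
- by do 2!apply: ord2_ind; rewrite ?spin_coroot0 ?spin_coroot1 /lie; delta_calc; entry_ring.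
- by apply: ord2_ind; apply: ord2_ind => // _; rewrite /lie /spin_e /spin_f /spin_root /=; delta_calc; rewrite oppr0.
- by do 2!apply: ord2_ind; rewrite ?spin_coroot0 ?spin_coroot1 /lie /spin_e /spin_root /cartan_B2 /=; delta_calc; entry_ring.
- by do 2!apply: ord2_ind; rewrite ?spin_coroot0 ?spin_coroot1 /lie /spin_f /spin_root /cartan_B2 /=; delta_calc; entry_ring.
- by apply: ord2_ind; apply: ord2_ind => // _; rewrite /cartan_B2 /lie /spin_e /spin_f /spin_root /=; split; delta_calc; try entry_ring.
Qed.

(** * Submodules of the tensor square of the spin module *)

(** Integral coordinates on a space of 4 by 4 matrices, seen as tensors: a basis,
    and for each basis vector the matrix entry that reads off its coefficient.
    Integrality lets the same data describe a rational module, its lattice and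
    its reductions. *)
Record frame n := Frame {
  frame_basis : 'I_n -> 'M[int]_4;
  frame_pos : 'I_n -> 'I_4 * 'I_4
}.

Section FrameRing.
Variables (R : comNzRingType) (n : nat) (b : frame n).

Definition emb (c : 'cV[R]_n) : 'M[R]_4 :=
  \sum_k c k 0 *: map_mx intr (frame_basis b k).
Definition crd (A : 'M[R]_4) : 'cV[R]_n :=
  \col_k A (frame_pos b k).1 (frame_pos b k).2.
(** The action of [x] tensor [y], compressed to the space of the frame. *)
Definition frame_mx (x y : 'M[R]_4) : 'M[R]_n :=
  \matrix_(i, j) crd (x *m map_mx intr (frame_basis b j) *m y^T) i 0.
Definition frame_lie (x : 'M[R]_4) : 'M[R]_n := frame_mx x 1%:M + frame_mx 1%:M x.

Lemma crdD A B : crd (A + B) = crd A + crd B.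
Proof. by apply/matrixP=> i j; rewrite !mxE. Qed.
Lemma crdZ a A : crd (a *: A) = a *: crd A.
Proof. by apply/matrixP=> i j; rewrite !mxE. Qed.
Lemma crdB A B : crd (A - B) = crd A - crd B.
Proof. by apply/matrixP=> i j; rewrite !mxE. Qed.
Lemma crd0 : crd 0 = 0.
Proof. by apply/matrixP=> i j; rewrite !mxE. Qed.

Lemma embZ a c : emb (a *: c) = a *: emb c.
Proof. by rewrite scaler_sumr; apply: eq_bigr => k _; rewrite mxE scalerA. Qed.
Lemma embD c d : emb (c + d) = emb c + emb d.
Proof. by rewrite -big_split; apply: eq_bigr => k _; rewrite mxE scalerDl. Qed.

Lemma frame_mxE x y c : frame_mx x y *m c = crd (x *m emb c *m y^T).
Proof.
apply/matrixP=> i j; rewrite (ord1 j) mxE [in RHS]mxE /emb mulmx_sumr mulmx_suml.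
rewrite summxE; apply: eq_bigr => k _; rewrite -scalemxAr -scalemxAl.
by rewrite mxE [in LHS]mxE [in RHS]mxE mulrC.
Qed.

Definition adj_act (x A : 'M[R]_4) := x *m A + A *m x^T.

Lemma frame_lieE x c : frame_lie x *m c = crd (adj_act x (emb c)).
Proof. by rewrite mulmxDl !frame_mxE -crdD trmx1 mulmx1 mul1mx. Qed.

End FrameRing.

Lemma map_frame_mx (R S : comNzRingType) (g : {rmorphism R -> S}) n (b : frame n) x y :
  map_mx g (frame_mx b x y) = frame_mx b (map_mx g x) (map_mx g y).
Proof.
apply/matrixP=> i j; rewrite mxE [in LHS]mxE [in LHS]mxE [in RHS]mxE [in RHS]mxE.
have -> : map_mx intr (frame_basis b j) = map_mx g (map_mx intr (frame_basis b j)).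
  by apply/matrixP=> k l; rewrite !mxE rmorph_int.
by rewrite map_trmx -!map_mxM [in RHS]mxE.
Qed.

Lemma map_frame_lie (R S : comNzRingType) (g : {rmorphism R -> S}) n (b : frame n) x :
  map_mx g (frame_lie b x) = frame_lie b (map_mx g x).
Proof. by rewrite map_mxD !map_frame_mx map_mx1. Qed.

Lemma colmx_ext (R : nzRingType) m n (X Y : 'M[R]_(m, n)) :
  (forall u : 'cV_n, X *m u = Y *m u) -> X = Y.
Proof.
move=> XY; apply/matrixP=> i j; have /matrixP/(_ i 0) := XY (delta_mx j 0).
by rewrite -!colE !mxE.
Qed.

(** The span of a frame, with its stability under the symplectic Lie algebra and
    the symplectic group. *)
Record frame_space (R : comNzRingType) n (b : frame n) (S : 'M[R]_4 -> Prop) := {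
  space_emb : forall c, S (emb b c);
  space_crd : forall A, S A -> emb b (crd b A) = A;
  emb_crd : forall c : 'cV[R]_n, crd b (emb b c) = c;
  space_lie : forall x A, sp_lie x -> S A -> S (adj_act x A);
  space_grp : forall x A, sp_grp x -> S A -> S (x *m A *m x^T)
}.

Section FrameSpace.
Variables (R : comNzRingType) (n : nat) (b : frame n) (S : 'M[R]_4 -> Prop).
Hypothesis bS : frame_space b S.

Lemma frame_mx11 : frame_mx b 1%:M 1%:M = 1%:M :> 'M[R]_n.
Proof.
by apply: colmx_ext => u; rewrite frame_mxE trmx1 mulmx1 !mul1mx (emb_crd bS).
Qed.

Lemma emb_grp (x : 'M[R]_4) (c : 'cV[R]_n) : sp_grp x -> emb b (frame_mx b x x *m c) = x *m emb b c *m x^T.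
Proof.
by move=> xG; rewrite frame_mxE (space_crd bS) //; apply/(space_grp bS)/(space_emb bS).
Qed.

Lemma emb_lie (x : 'M[R]_4) (c : 'cV[R]_n) : sp_lie x -> emb b (frame_lie b x *m c) = adj_act x (emb b c).
Proof.
by move=> xL; rewrite frame_lieE (space_crd bS) //; apply/(space_lie bS)/(space_emb bS).
Qed.

Lemma frame_grpM (x y : 'M[R]_4) : sp_grp y ->
  frame_mx b x x *m frame_mx b y y = frame_mx b (x *m y) (x *m y).
Proof.
move=> yG; apply: colmx_ext => u.
by rewrite -mulmxA frame_mxE emb_grp // frame_mxE trmx_mul !mulmxA.
Qed.

Lemma frame_lie_sq (x : 'M[R]_4) : sp_lie x -> x *m x = 0 ->
  frame_lie b x *m frame_lie b x = 2%:R *: frame_mx b x x.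
Proof.
move=> xL xx; apply: colmx_ext => u; rewrite -mulmxA frame_lieE emb_lie //.
rewrite -scalemxAl frame_mxE -crdZ; congr crd; rewrite /adj_act.
rewrite mulmxDr mulmxDl !mulmxA xx mul0mx add0r -(mulmxA _ x^T).
by rewrite -trmx_mul xx trmx0 mulmx0 addr0 scaler_nat mulr2n.
Qed.

Lemma frame_lie_cube (x : 'M[R]_4) : sp_lie x -> x *m x = 0 ->
  frame_mx b x x *m frame_lie b x = 0.
Proof.
move=> xL xx; apply: colmx_ext => u; rewrite -mulmxA frame_mxE emb_lie //.
rewrite /adj_act mulmxDr mulmxDl !mulmxA xx !mul0mx add0r -(mulmxA _ x^T).
by rewrite -trmx_mul xx trmx0 mulmx0 crd0.
Qed.

(** Both sides are [exp (t x)] acting on tensors, for [x] of square zero. *)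
Lemma frame_exp (x : 'M[R]_4) t : x *m x = 0 ->
  frame_mx b (1%:M + t *: x) (1%:M + t *: x) =
  1%:M + t *: frame_lie b x + t ^+ 2 *: frame_mx b x x.
Proof.
move=> xx; apply: colmx_ext => u.
rewrite !mulmxDl mul1mx -!scalemxAl frame_lieE !frame_mxE -!crdZ -[u in RHS](emb_crd bS).
rewrite -!crdD; congr crd; rewrite /adj_act (emb_crd bS).
have -> : (1%:M + t *: x)^T = 1%:M + t *: x^T by rewrite linearD linearZ /= trmx1.
rewrite mulmxDl mul1mx mulmxDr mulmx1 -scalemxAl -scalemxAr mulmxDl -scalemxAl.
by rewrite !scalerDr scalerA -expr2 !addrA.
Qed.

End FrameSpace.

Section FrameModule.
Variables (n : nat) (b : frame n) (S : 'M[rat]_4 -> Prop).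
Hypothesis bS : frame_space b S.

Definition frame_e (i : 'I_2) := frame_lie b (spin_e i).
Definition frame_f (i : 'I_2) := frame_lie b (spin_f i).

Let D := @frame_lie rat n b.

Lemma frame_lieZ a x : D (a *: x) = a *: D x.
Proof.
apply: colmx_ext => u; rewrite -scalemxAl !frame_lieE -crdZ; congr crd.
by rewrite /adj_act -scalemxAl linearZ /= -scalemxAr scalerDr.
Qed.

Lemma frame_lie0 : D 0 = 0.
Proof. by rewrite -(scale0r 0) frame_lieZ scale0r. Qed.

Lemma sp_lie_lie x y : sp_lie x -> sp_lie y -> sp_lie (lie x y).
Proof.
rewrite /sp_lie => /eqP; rewrite addr_eq0 => /eqP xJ /eqP; rewrite addr_eq0 => /eqP yJ.
rewrite /lie trmxB !trmx_mul mulmxBl -!mulmxA xJ yJ !mulmxN !mulmxA xJ yJ.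
rewrite mulmxBr !mulmxA; move: spin_form => J.
by rewrite !mulNmx !opprK -opprB addNr.
Qed.

Lemma frame_lie_lie x y : sp_lie x -> sp_lie y -> lie (D x) (D y) = D (lie x y).
Proof.
move=> xL yL; apply: colmx_ext => u; rewrite mulmxBl -!mulmxA.
rewrite [D x *m _]frame_lieE [D y *m (D x *m u)]frame_lieE !(emb_lie bS) //.
rewrite [D _ *m u]frame_lieE -crdB; congr crd.
rewrite /adj_act /lie trmxB !trmx_mul; move: (emb b u) => A.
rewrite ?(mulmxDr, mulmxDl, mulNmx, mulmxN) ?mulmxA.
move: (x *m y *m A) (y *m x *m A) (x *m A *m y^T) (y *m A *m x^T).
move: (A *m y^T *m x^T) (A *m x^T *m y^T) => B1 B2 B3 B4 B5 B6.
by apply/matrixP=> i j; rewrite !mxE; ring.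
Qed.

Lemma sp_lie_e i : sp_lie (spin_e i). Proof. exact: spin_root_lie. Qed.
Lemma sp_lie_f i : sp_lie (spin_f i). Proof. exact: spin_root_lie. Qed.

Lemma frame_coroot i : coroot frame_e frame_f i = D (coroot spin_e spin_f i).
Proof. by apply: frame_lie_lie; apply: spin_root_lie. Qed.

Lemma frame_iter k x y : sp_lie x -> sp_lie y ->
  iter k (lie (D x)) (D y) = D (iter k (lie x) y) /\ sp_lie (iter k (lie x) y).
Proof.
move=> xL yL; elim: k => //= k [-> kL].
by rewrite frame_lie_lie //; split=> //; apply: sp_lie_lie.
Qed.

Lemma frame_action : B2_action frame_e frame_f.
Proof.
have hL i : sp_lie (coroot spin_e spin_f i).
  by apply: sp_lie_lie; apply: spin_root_lie.
have [hh ef he hf serre] := spin_action.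
split=> [i j|i j ij|i j|i j|i j ij].
- by rewrite !frame_coroot frame_lie_lie // hh frame_lie0.
- by rewrite frame_lie_lie ?ef ?frame_lie0 //; apply: spin_root_lie.
- by rewrite frame_coroot frame_lie_lie ?he ?frame_lieZ //; apply: spin_root_lie.
- rewrite frame_coroot frame_lie_lie ?hf //; last exact: spin_root_lie.
  by rewrite -scaleNr frame_lieZ scaleNr.
- have [Ee Ef] := serre i j ij.
  split; [rewrite -[RHS]frame_lie0 -Ee | rewrite -[RHS]frame_lie0 -Ef].
    exact: (frame_iter _ (sp_lie_e i) (sp_lie_e j)).1.
  exact: (frame_iter _ (sp_lie_f i) (sp_lie_f j)).1.
Qed.

Lemma frame_root_vector (r : 'I_8) :
  root_vector frame_e frame_f r = D (spin_root rat r).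
Proof.
have L := spin_root_lie rat.
rewrite -spin_root_vector.
case: r => [[|[|[|[|[|[|[|[|//]]]]]]]] ?]; rewrite /root_vector /= ?frame_lieZ //;
  by rewrite -?frame_lie_lie //; do ?[exact: L | apply: sp_lie_lie].
Qed.

(** The divided powers of a root vector on tensors: the square acts as twice
    [x] tensor [x] and the cube vanishes, as root vectors square to zero on the
    spin module. *)
Definition frame_divided (R : comNzRingType) r k : 'M[R]_n :=
  match k with
  | 0 => 1%:M
  | 1 => frame_lie b (spin_root R r)
  | 2 => frame_mx b (spin_root R r) (spin_root R r)
  | _ => 0
  end.

Lemma map_frame_divided (R R' : comNzRingType) (g : {rmorphism R -> R'}) r k :
  map_mx g (frame_divided R r k) = frame_divided R' r k.
Proof.
case: k => [|[|[|k]]] /=; first exact: map_mx1.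
- by rewrite map_frame_lie map_spin_root.
- by rewrite map_frame_mx map_spin_root.
- exact: map_mx0.
Qed.

Lemma frame_divided_power r k :
  divided_power frame_e frame_f r k = frame_divided rat r k.
Proof.
rewrite /divided_power frame_root_vector; set X := D _.
have XX : X *m X = 2%:R *: frame_mx b (spin_root rat r) (spin_root rat r).
  by apply: (frame_lie_sq bS); [apply: spin_root_lie|apply: spin_root_sq].
have XXX : frame_mx b (spin_root rat r) (spin_root rat r) *m X = 0.
  by apply: (frame_lie_cube bS); [apply: spin_root_lie|apply: spin_root_sq].
case: k => [|[|[|k]]] /=; first by rewrite expr0 invr1 scale1r.
- by rewrite expr1 invr1 scale1r.
- by rewrite expr2 -[X * X]/(X *m X) XX scalerA mulVf // scale1r.
- rewrite -addn3 exprD (_ : X ^+ 3 = 0) ?mulr0 ?scaler0 //.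
  by rewrite exprSr expr2 -[_ * _]/(X *m X *m X) XX -scalemxAl XXX scaler0.
Qed.

Lemma frame_root_element (F : fieldType) r (t : F) : (2 < n)%N ->
  root_element frame_e frame_f r t =
  1%:M + t *: frame_lie b (spin_root F r) +
  t ^+ 2 *: frame_mx b (spin_root F r) (spin_root F r).
Proof.
move=> n3; rewrite /root_element.
have E k : map_mx ratr (divided_power frame_e frame_f r k) = frame_divided F r k.
  rewrite frame_divided_power -(map_frame_divided (intmul 1) _ _).
  rewrite -(map_frame_divided (intmul 1 : int -> F) _ _).
  by apply/matrixP=> i j; rewrite !mxE ratr_int.
under eq_bigr => k _ do rewrite E.
rewrite -(big_mkord xpredT (fun k => t ^+ k *: frame_divided F r k)).
have n2 : (1 < n)%N by apply: ltnW.
rewrite (big_ltn (ltnW n2)) (big_ltn n2) (big_ltn n3) big_nat big1 => [|[|[|[|k]]] //= _].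
  by rewrite expr0 scale1r expr1 addr0 !addrA.
by rewrite scaler0.
Qed.

End FrameModule.

(** * Lattices and reductions of the tensor modules *)

Section FrameLattice.
Variables (n : nat) (b : frame n).
Variables (S : forall R : comNzRingType, 'M[R]_4 -> Prop).
Hypothesis bSQ : frame_space b (@S rat).
Hypothesis bSZ : frame_space b (@S int).
Variables (k0 : 'I_n) (lam : 'rV[int]_2).
Local Notation v0 := (delta_mx k0 0 : 'cV[rat]_n).
Local Notation e := (frame_e b).
Local Notation f := (frame_f b).

(** Membership in the lattice that the Kostant form generates from the [k0]-th
    basis vector. *)
Definition reachable (A : 'M[int]_4) :=
  kostant_span e f v0 (map_mx intr (crd b A)) /\ S A.

Lemma reachable_lie (r : 'I_8) A : reachable A -> reachable (adj_act (spin_root int r) A).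
Proof.
case=> kA SA; split; last by apply: (space_lie bSZ) => //; apply: spin_root_lie.
have := @Kostant_act _ e f v0 r 1 _ kA.
rewrite (frame_divided_power bSQ) -(map_frame_divided b (intmul 1)) -map_mxM.
by rewrite [frame_divided _ _ _ _]/= frame_lieE (space_crd bSZ).
Qed.

Lemma reachable_sq (r : 'I_8) A : reachable A ->
  S (spin_root int r *m A *m (spin_root int r)^T) ->
  reachable (spin_root int r *m A *m (spin_root int r)^T).
Proof.
case=> kA SA SrA; split=> //.
have := @Kostant_act _ e f v0 r 2 _ kA.
rewrite (frame_divided_power bSQ) -(map_frame_divided b (intmul 1)) -map_mxM.
by rewrite [frame_divided _ _ _ _]/= frame_mxE (space_crd bSZ).
Qed.

Lemma kostant0 : kostant_span e f v0 0.
Proof. by rewrite -(subrr v0); apply: Kostant_sub; apply: Kostant_gen. Qed.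

Lemma kostantN u : kostant_span e f v0 u -> kostant_span e f v0 (- u).
Proof. by move=> ku; rewrite -sub0r; apply: Kostant_sub => //; apply: kostant0. Qed.

Lemma kostantD u w : kostant_span e f v0 u -> kostant_span e f v0 w ->
  kostant_span e f v0 (u + w).
Proof. by move=> ku kw; rewrite -[w]opprK; apply: Kostant_sub => //; apply: kostantN. Qed.

Lemma reachableN A : reachable A -> S (- A) -> reachable (- A).
Proof.
move=> [kA SA] SNA; split=> //.
have -> : crd b (- A) = - crd b A by apply/matrixP=> i j; rewrite !mxE.
by rewrite map_mxN; apply: kostantN.
Qed.

Lemma emb_delta (R : comNzRingType) k :
  emb b (delta_mx k 0 : 'cV[R]_n) = map_mx intr (frame_basis b k).
Proof.
rewrite /emb (bigD1 k) //= big1 => [|i ik]; last by rewrite mxE (negPf ik) scale0r.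
by rewrite mxE !eqxx scale1r addr0.
Qed.

Lemma crd_basis (R : comNzRingType) (bSR : frame_space b (@S R)) k :
  crd b (map_mx intr (frame_basis b k) : 'M[R]_4) = delta_mx k 0.
Proof. by rewrite -emb_delta (emb_crd bSR). Qed.

Lemma reachable_basis0 : reachable (frame_basis b k0).
Proof.
have -> : frame_basis b k0 = map_mx intr (frame_basis b k0) :> 'M[int]_4.
  by apply/matrixP=> i j; rewrite !mxE intz.
split; last by rewrite -emb_delta; apply: (space_emb bSZ).
by rewrite (crd_basis bSZ) map_delta_mx; apply: Kostant_gen.
Qed.

Hypothesis reach : forall k, reachable (frame_basis b k).

(** Divided powers are integral in a frame, and all the basis vectors are
    reached from the highest one. *)
Lemma frame_lattice u : kostant_span e f v0 u <-> integral_vector u.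
Proof.
split.
  elim=> {u} [i|u w _ uZ _ wZ i|r k u _ uZ i].
  - by rewrite mxE; case: (_ && _).
  - by rewrite !mxE rpredB.
  - rewrite (frame_divided_power bSQ) -(map_frame_divided b (intmul 1)) mxE.
    by apply: rpred_sum => j _; rewrite mxE rpredM //; apply: intr_int.
move=> uZ.
have kZ (m : int) w : kostant_span e f v0 w -> kostant_span e f v0 (m%:~R *: w).
  move=> kw; have kn (k : nat) : kostant_span e f v0 (k%:R *: w).
    elim: k => [|k IHk]; first by rewrite scale0r; apply: kostant0.
    by rewrite mulrSr scalerDl scale1r; apply: kostantD.
  by case: m => k; [|rewrite NegzE mulrNz scaleNr; apply: kostantN]; apply: kn.
have -> : u = \sum_k (Num.floor (u k 0))%:~R *: delta_mx k 0.
  rewrite [LHS]matrix_sum_delta; apply: eq_bigr => k _.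
  by rewrite big_ord1 floorK.
elim/big_ind: _ => [|x y|k _]; [exact: kostant0|exact: kostantD|].
apply: kZ; have [kA _] := reach k.
rewrite -(_ : map_mx intr (crd b (frame_basis b k)) = delta_mx k 0) //.
have -> : frame_basis b k = map_mx intr (frame_basis b k) :> 'M[int]_4.
  by apply/matrixP=> i j; rewrite !mxE intz.
by rewrite (crd_basis bSZ) map_delta_mx.
Qed.

Hypothesis wv : weight_vector e f lam v0.
Hypothesis ev : forall i, e i *m v0 = 0.
Hypothesis n_gt2 : (2 < n)%N.

Section Chevalley.
Variables (F : finFieldType) (gT : finGroupType) (G : {group gT}).
Variables (x : 'I_8 -> F -> gT) (rG : mx_representation F G n) (w0 : 'cV[F]_n).
Hypothesis bSF : frame_space b (@S F).

(** A Weyl module becomes the module of the frame after a change of basis over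
    the finite field: the integral isomorphism of highest weight modules is
    reduced entrywise. *)
Theorem weyl_module_frame : weyl_module x lam rG w0 ->
  exists C : 'M[F]_n, [/\ C \in unitmx,
    forall r t, rG (x r t) *m C =
      C *m frame_mx b (1%:M + t *: spin_root F r) (1%:M + t *: spin_root F r)
    & w0 = C *m delta_mx k0 0].
Proof.
case=> e1 [f1 [v1 [B [[act irr [v1n wv1 ev1] lat] Bu rB ->]]]].
have v0n : v0 != 0.
  by apply/eqP=> /matrixP/(_ k0 0)/eqP; rewrite !mxE !eqxx oner_eq0.
have [A [A' [AA' eP fP vP]]] :=
  highest_weight_iso act (frame_action bSQ) wv1 wv ev1 ev v1n v0n irr lat frame_lattice.
pose PF : 'M[F]_n := map_mx intr A; pose PF' : 'M[F]_n := map_mx intr A'.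
have PP' : PF *m PF' = 1%:M by rewrite -map_mxM AA' map_mx1.
have PQ' : (map_mx intr A : 'M[rat]_n) *m map_mx intr A' = 1%:M.
  by rewrite -map_mxM AA' map_mx1.
have PP'1 := mulmx1C PP'; have PQ'1 := mulmx1C PQ'.
have root r : root_vector e1 f1 r *m map_mx intr A = map_mx intr A *m root_vector e f r.
  have L X Y X' Y' : X *m map_mx intr A = map_mx intr A *m X' ->
      Y *m map_mx intr A = map_mx intr A *m Y' ->
      lie X Y *m map_mx intr A = map_mx intr A *m lie X' Y' :> 'M[rat]_n.
    move=> EX EY; rewrite /lie mulmxBl -!mulmxA EX EY !mulmxA EX EY.
    by rewrite mulmxBr !mulmxA.
  have Z a X X' : X *m map_mx intr A = map_mx intr A *m X' ->
      (a *: X) *m map_mx intr A = map_mx intr A *m (a *: X') :> 'M[rat]_n.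
    by move=> E; rewrite -scalemxAl E scalemxAr.
  case: r => -[|[|[|[|[|[|[|[|//]]]]]]]] ?; rewrite /root_vector /=;
    by do ?[exact: eP | exact: fP | apply: (L) | apply: (Z)].
have rootX r k : divided_power e1 f1 r k = map_mx intr (A *m frame_divided b int r k *m A').
  rewrite !map_mxM map_frame_divided -(frame_divided_power bSQ) /divided_power.
  rewrite -scalemxAr -scalemxAl; congr (_ *: _).
  rewrite -[LHS]mulmx1 -PQ' mulmxA; congr (_ *m _).
  elim: k => [|k IHk]; first by rewrite !expr0 mulmx1 mul1mx.
  by rewrite !exprS -mulmxA IHk !mulmxA root.
have rootF r t : root_element e1 f1 r t *m PF =
    PF *m root_element e f r t.
  rewrite /root_element mulmx_suml mulmx_sumr; apply: eq_bigr => k _.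
  rewrite -scalemxAl -scalemxAr; congr (_ *: _).
  rewrite rootX (frame_divided_power bSQ) -(map_frame_divided b (intmul 1 : int -> rat)).
  have ratrZ (X : 'M[int]_n) : map_mx ratr (map_mx intr X : 'M[rat]_n) = map_mx intr X :> 'M[F]_n.
    by apply/matrixP=> i j; rewrite !mxE ratr_int.
  by rewrite !ratrZ !map_mxM -!mulmxA -/PF -/PF' PP'1 mulmx1.
exists (B *m PF); split=> [|r t|].
- by rewrite unitmx_mul Bu; case/mulmx1_unit: PP'.
- rewrite mulmxA rB -!(mulmxA B) rootF (frame_root_element bSQ) //.
  by rewrite (frame_exp bSF) ?spin_root_sq.
- rewrite -mulmxA -vP; congr (_ *m _).
  by apply/matrixP=> i j; rewrite (ord1 j) -!colE !mxE ratr_int.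
Qed.

End Chevalley.
End FrameLattice.

(** * Symmetric tensors and traceless alternating tensors *)

Definition sym_frame : frame 10 := {|
  frame_basis k := let ij := sym_pos k in
    if ij.1 == ij.2 then delta_mx ij.1 ij.2
    else delta_mx ij.1 ij.2 + delta_mx ij.2 ij.1;
  frame_pos := sym_pos |}.

Definition sym_space (R : comNzRingType) (A : 'M[R]_4) := A^T = A.

Lemma ord4_ind (P : 'I_4 -> Prop) : P o0 -> P o1 -> P o2 -> P o3 -> forall i, P i.
Proof.
move=> P0 P1 P2 P3 [[|[|[|[|//]]]] lti];
  [move: P0|move: P1|move: P2|move: P3]; by congr P; apply: val_inj.
Qed.

Lemma sym_frameP (R : comNzRingType) : frame_space sym_frame (@sym_space R).
Proof.
split=> [c|A|c|x A _|x A _].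
- rewrite /sym_space /emb linear_sum; apply: eq_bigr => k _.
  rewrite /= linearZ /= map_trmx; congr (_ *: map_mx _ _); case: eqP => [->|_].
    by rewrite trmx_delta.
  by rewrite trmxD !trmx_delta addrC.
- move=> AT; have At i j : A i j = A j i by rewrite -{1}AT mxE.
  apply/matrixP=> i j; rewrite /emb !big_ord_recl big_ord0 !mxE /sym_pos /=.
  by move: i j; do 2![apply: ord4_ind]; rewrite ?mxE /= ?(mulr0, mulr1, addr0, add0r).
- apply/matrixP=> k l; rewrite (ord1 l) !mxE /emb !big_ord_recl big_ord0.
  rewrite !mxE /sym_pos /=.
  case: k => [[|[|[|[|[|[|[|[|[|[|//]]]]]]]]]] ?] /=;
   rewrite ?mxE /= ?(mulr0, mulr1, addr0, add0r); by congr (c _ _); apply: val_inj.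
- by rewrite /sym_space /adj_act trmxD !trmx_mul trmxK => ->; rewrite addrC.
- by rewrite /sym_space !trmx_mul trmxK mulmxA => ->.
Qed.

Definition alt_pos (k : 'I_5) : 'I_4 * 'I_4 :=
  nth (o0, o0) [:: (o0, o1); (o0, o2); (o1, o2); (o1, o3); (o2, o3)] k.

(** The third vector is the zero weight vector of the traceless alternating
    tensors. *)
Definition alt_frame : frame 5 := {|
  frame_basis k := let E i j : 'M[int]_4 := delta_mx i j - delta_mx j i in
    nth 0 [:: E o0 o1; E o0 o2; E o1 o2 - E o0 o3; E o1 o3; E o2 o3] k;
  frame_pos := alt_pos |}.

(** On [u *m w^T - w *m u^T] the trace is [- 2] times the value of the
    symplectic form at [u] and [w]. *)
Definition alt_space (R : comNzRingType) (A : 'M[R]_4) :=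
  A^T = - A /\ \tr (spin_form R *m A) = 0.

Lemma mxtrace_delta (R : pzRingType) n (i j : 'I_n) :
  \tr (delta_mx i j : 'M[R]_n) = (i == j)%:R.
Proof.
rewrite /mxtrace (bigD1 i) //= big1 => [|k ki]; last by rewrite mxE (negPf ki).
by rewrite mxE eqxx addr0.
Qed.

Lemma alt_frameP (R : comNzRingType) : (forall a : R, a + a = 0 -> a = 0) ->
  frame_space alt_frame (@alt_space R).
Proof.
move=> two_inj; split=> [c|A|c|x A xL [AT trA]|x A xG [AT trA]].
- split.
    rewrite /emb linear_sum -sumrN; apply: eq_bigr => k _.
    rewrite /= linearZ /= map_trmx -scalerN -map_mxN; congr (_ *: map_mx _ _).
    case: k => [[|[|[|[|[|//]]]]] ?] /=; rewrite ?(trmxB, trmx_delta) ?opprB //;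
      by rewrite addrC.
  rewrite /emb mulmx_sumr linear_sum big1 //= => k _.
  rewrite -scalemxAr linearZ /= [\tr _](_ : _ = 0) ?mulr0 //.
  rewrite [spin_form R](_ : _ = map_mx intr (spin_form int)).
    rewrite -map_mxM trace_map_mx (_ : \tr _ = 0) ?rmorph0 //.
    case: k => [[|[|[|[|[|//]]]]] ?] /=; rewrite /spin_form;
      delta_calc; rewrite ?(raddfD, raddfB, raddfN) /= ?mxtrace0 ?mxtrace_delta //=.
  by rewrite /spin_form ?(map_mxB, map_mxD, map_delta_mx).
- case=> AT.
  have At i j : A i j = - A j i by move/matrixP/(_ j i): AT; rewrite !mxE.
  have Aii i : A i i = 0 by apply: two_inj; rewrite {1}At addNr.
  rewrite /spin_form !mulmxBl !mulmxDl /mxtrace !big_ord_recl big_ord0 !mxE.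
  rewrite !big_ord_recl !big_ord0 !mxE /=.
  rewrite ?(mul0r, mul1r, mulr0, addr0, add0r, subr0, oppr0, sub0r) => tr0.
  have A03 : A o0 o3 = - A o1 o2.
    have {}tr0 : A o3 o0 + (A o2 o1 + (- A o1 o2 - A o0 o3)) = 0.
      by rewrite -[RHS]tr0; congr (A _ _ + (A _ _ + (- A _ _ - A _ _))); apply: val_inj.
    apply/eqP; rewrite -subr_eq0 opprK; apply/eqP/two_inj; rewrite -[RHS]oppr0 -tr0.
    by rewrite (At o3) (At o2); ring.
  apply/matrixP=> i j; rewrite /emb !big_ord_recl big_ord0 !mxE /alt_pos /=.
  by move: i j; do 2![apply: ord4_ind];
    rewrite ?mxE /= ?(mulr0, mulr1, addr0, add0r, Aii) ?mulrN1z ?mulrN ?mulr1 ?(At o1 o0) ?(At o2 o0) ?(At o3 o0)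
    ?(At o2 o1) ?(At o3 o1) ?(At o3 o2) ?A03 ?opprK.
- apply/matrixP=> k l; rewrite (ord1 l) !mxE /emb !big_ord_recl big_ord0.
  rewrite !mxE /alt_pos /=.
  case: k => [[|[|[|[|[|//]]]]] ?] /=; rewrite ?mxE /= ?(mulr0, mulr1, addr0, add0r, subr0);
  by congr (c _ _); apply: val_inj.
- split.
    by rewrite /adj_act trmxD !trmx_mul trmxK AT mulNmx mulmxN addrC -opprD.
  rewrite /adj_act mulmxDr mxtraceD [in X in _ + X]mulmxA [X in _ + X]mxtrace_mulC.
  by rewrite !mulmxA -mxtraceD -mulmxDl addrC xL mul0mx mxtrace0.
- split; first by rewrite !trmx_mul trmxK AT mulmxA mulmxN mulNmx.
  by rewrite mulmxA mxtrace_mulC !mulmxA xG.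
Qed.

(** * The two Weyl modules *)

Notation "''r_' k" := (@Ordinal 8 k isT) (at level 8, k at level 2, format "''r_' k").

Lemma two_inj_char (R : idomainType) : 2%:R != 0 :> R -> forall a : R, a + a = 0 -> a = 0.
Proof.
by move=> two a /eqP; rewrite -mulr2n -mulr_natl mulf_eq0 (negPf two) => /eqP.
Qed.

Lemma alt_frameQ : frame_space alt_frame (@alt_space rat).
Proof. exact/alt_frameP/two_inj_char. Qed.
Lemma alt_frameZ : frame_space alt_frame (@alt_space int).
Proof. exact/alt_frameP/two_inj_char. Qed.
Lemma sym_frameQ : frame_space sym_frame (@sym_space rat).
Proof. exact: sym_frameP. Qed.
Lemma sym_frameZ : frame_space sym_frame (@sym_space int).
Proof. exact: sym_frameP. Qed.

Section ReachRules.
Variables (n : nat) (b : frame n) (S : forall R : comNzRingType, 'M[R]_4 -> Prop).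
Hypotheses (bSQ : frame_space b (@S rat)) (bSZ : frame_space b (@S int)).
Variable k0 : 'I_n.
Local Notation reach := (reachable b S k0).
Local Notation basis := (frame_basis b).
Local Notation X r := (spin_root int r).

Lemma frame_basis_space k : S (basis k).
Proof.
have -> : basis k = map_mx intr (basis k) :> 'M[int]_4.
  by apply/matrixP=> i j; rewrite !mxE intz.
by rewrite -emb_delta; apply: (space_emb bSZ).
Qed.

Lemma reach_lie (r : 'I_8) k l : reach (basis k) ->
  adj_act (X r) (basis k) = basis l -> reach (basis l).
Proof. by move=> rk <-; apply: reachable_lie. Qed.

Lemma reach_lieN (r : 'I_8) k l : reach (basis k) ->
  adj_act (X r) (basis k) = - basis l -> reach (basis l).
Proof.
move=> rk kl; rewrite -[basis l]opprK; apply: reachableN.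
  by rewrite -kl; apply: reachable_lie.
by rewrite opprK; apply: frame_basis_space.
Qed.

Lemma reach_sq (r : 'I_8) k l : reach (basis k) ->
  X r *m basis k *m (X r)^T = basis l -> reach (basis l).
Proof.
by move=> rk kl; have := frame_basis_space l; rewrite -kl; apply: reachable_sq.
Qed.

Lemma reach_sqN (r : 'I_8) k l : reach (basis k) ->
  X r *m basis k *m (X r)^T = - basis l ->
  S (- basis l) -> reach (basis l).
Proof.
move=> rk kl Sl; rewrite -[basis l]opprK; apply: reachableN.
  by move: Sl; rewrite -kl; apply: reachable_sq.
by rewrite opprK; apply: frame_basis_space.
Qed.

End ReachRules.

Ltac basis_calc := rewrite /adj_act /= /spin_root /=; delta_calc;
  rewrite ?subr0 ?oppr0 ?opprD ?opprK ?addr0 ?add0r //;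
  try (by rewrite addrC); try entry_ring.

(** A root vector taking a weight vector of the spin module to another one up to
    sign takes the square of the former to that of the latter through its
    divided square, and to their symmetric product through its first power. *)
Lemma sym_reach k : reachable sym_frame sym_space ord0 (frame_basis sym_frame k).
Proof.
pose o k (lt_k : (k < 10)%N) := Ordinal lt_k.
have L := @reach_lie _ _ _ sym_frameQ sym_frameZ ord0.
have LN := @reach_lieN _ _ _ sym_frameQ sym_frameZ ord0.
have Sq := @reach_sq _ _ _ sym_frameQ sym_frameZ ord0.
have r0 := reachable_basis0 sym_frameZ ord0.
have r4 : reachable sym_frame sym_space ord0 (frame_basis sym_frame (@o 4 isT)).
  by apply: (Sq 'r_5 _ _ r0); basis_calc.
have r7 : reachable sym_frame sym_space ord0 (frame_basis sym_frame (@o 7 isT)).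
  by apply: (Sq 'r_6 _ _ r0); basis_calc.
have r9 : reachable sym_frame sym_space ord0 (frame_basis sym_frame (@o 9 isT)).
  by apply: (Sq 'r_7 _ _ r0); basis_calc.
have r1 : reachable sym_frame sym_space ord0 (frame_basis sym_frame (@o 1 isT)).
  by apply: (L 'r_5 _ _ r0); basis_calc.
have r2 : reachable sym_frame sym_space ord0 (frame_basis sym_frame (@o 2 isT)).
  by apply: (LN 'r_6 _ _ r0); basis_calc.
have r3 : reachable sym_frame sym_space ord0 (frame_basis sym_frame (@o 3 isT)).
  by apply: (L 'r_7 _ _ r0); basis_calc.
have r5 : reachable sym_frame sym_space ord0 (frame_basis sym_frame (@o 5 isT)).
  by apply: (L 'r_4 _ _ r4); basis_calc.
have r6 : reachable sym_frame sym_space ord0 (frame_basis sym_frame (@o 6 isT)).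
  by apply: (LN 'r_6 _ _ r4); basis_calc.
have r8 : reachable sym_frame sym_space ord0 (frame_basis sym_frame (@o 8 isT)).
  by apply: (LN 'r_5 _ _ r7); basis_calc.
by case: k => [[|[|[|[|[|[|[|[|[|[|//]]]]]]]]]] lt_k]; rewrite (bool_irrelevance lt_k isT).
Qed.

Lemma alt_reach k : reachable alt_frame alt_space ord0 (frame_basis alt_frame k).
Proof.
pose o k (lt_k : (k < 5)%N) := Ordinal lt_k.
have L := @reach_lie _ _ _ alt_frameQ alt_frameZ ord0.
have SqN := @reach_sqN _ _ _ alt_frameQ alt_frameZ ord0.
have r0 := reachable_basis0 alt_frameZ ord0.
have r1 : reachable alt_frame alt_space ord0 (frame_basis alt_frame (@o 1 isT)).
  by apply: (L 'r_4 _ _ r0); basis_calc.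
have r2 : reachable alt_frame alt_space ord0 (frame_basis alt_frame (@o 2 isT)).
  by apply: (L 'r_5 _ _ r1); basis_calc.
have r3 : reachable alt_frame alt_space ord0 (frame_basis alt_frame (@o 3 isT)).
  apply: (SqN 'r_5 _ _ r1); first by basis_calc.
  have [AT trA] := frame_basis_space alt_frameZ (@o 3 isT).
  by split; [rewrite trmxN AT | rewrite mulmxN raddfN /= trA oppr0].
have r4 : reachable alt_frame alt_space ord0 (frame_basis alt_frame (@o 4 isT)).
  by apply: (L 'r_4 _ _ r3); basis_calc.
by case: k => [[|[|[|[|[|//]]]]] lt_k]; rewrite (bool_irrelevance lt_k isT).
Qed.

Lemma frame_weight n (b : frame n) (S : forall R : comNzRingType, 'M[R]_4 -> Prop)
    (bSQ : frame_space b (@S rat)) k0 (lam : 'rV[int]_2) :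
    (forall i, adj_act (coroot spin_e spin_f i) (map_mx intr (frame_basis b k0)) =
       (lam 0 i)%:~R *: map_mx intr (frame_basis b k0)) ->
  weight_vector (frame_e b) (frame_f b) lam (delta_mx k0 0).
Proof.
move=> E i; rewrite (frame_coroot bSQ) frame_lieE emb_delta E crdZ.
by rewrite (crd_basis bSQ).
Qed.

Lemma frame_highest n (b : frame n) (S : forall R : comNzRingType, 'M[R]_4 -> Prop)
    (bSQ : frame_space b (@S rat)) k0 :
    (forall i, adj_act (spin_e i) (map_mx intr (frame_basis b k0)) = 0 :> 'M[rat]_4) ->
  forall i, frame_e b i *m (delta_mx k0 0 : 'cV[rat]_n) = 0.
Proof. by move=> E i; rewrite frame_lieE emb_delta E crd0. Qed.

Section Modules.
Variables (F : finFieldType) (gT : finGroupType) (G : {group gT}).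
Variables (x : 'I_8 -> F -> gT).
Hypothesis two_neq0 : 2%:R != 0 :> F.

Let root_grp r t : 'M[F]_4 := 1%:M + t *: spin_root F r.

Theorem weyl_module_sym (rG : mx_representation F G 10) w0 :
  weyl_module x (omega 1 *+ 2) rG w0 ->
  exists C : 'M[F]_10, [/\ C \in unitmx,
    forall r t, rG (x r t) *m C =
      C *m frame_mx sym_frame (root_grp r t) (root_grp r t)
    & w0 = C *m delta_mx ord0 0].
Proof.
apply: (weyl_module_frame sym_frameQ sym_frameZ sym_reach) => //; last exact: sym_frameP.
  apply: (frame_weight sym_frameQ); apply: ord2_ind;
    rewrite ?spin_coroot0 ?spin_coroot1 map_delta_mx /omega !mxE /adj_act;
    by delta_calc; entry_ring.
by apply: (frame_highest sym_frameQ); apply: ord2_ind;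
  rewrite map_delta_mx /adj_act /spin_e /spin_root /=; delta_calc.
Qed.

Theorem weyl_module_alt (rG : mx_representation F G 5) w0 :
  weyl_module x (omega 0) rG w0 ->
  exists C : 'M[F]_5, [/\ C \in unitmx,
    forall r t, rG (x r t) *m C =
      C *m frame_mx alt_frame (root_grp r t) (root_grp r t)
    & w0 = C *m delta_mx ord0 0].
Proof.
apply: (weyl_module_frame alt_frameQ alt_frameZ alt_reach) => //;
  last exact/alt_frameP/two_inj_char.
  apply: (frame_weight alt_frameQ); apply: ord2_ind;
    rewrite ?spin_coroot0 ?spin_coroot1 map_mxB !map_delta_mx /omega !mxE /adj_act;
    by delta_calc; entry_ring.
by apply: (frame_highest alt_frameQ); apply: ord2_ind;
  rewrite map_mxB !map_delta_mx /adj_act /spin_e /spin_root /=; delta_calc;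
  rewrite ?addNr.
Qed.

End Modules.

(** * The symplectic group and the Clifford action *)

Ltac col4_calc :=
  let i := fresh "i" in let j := fresh "j" in
  apply/matrixP=> i j; rewrite (ord1 j) ?mxE; move: i; apply: ord4_ind;
  rewrite ?mxE ?big_ord_recl ?big_ord0 ?mxE /=; try ring.

Notation p0 := (@Ordinal 5 0 isT).
Notation p1 := (@Ordinal 5 1 isT).
Notation p2 := (@Ordinal 5 2 isT).
Notation p3 := (@Ordinal 5 3 isT).
Notation p4 := (@Ordinal 5 4 isT).

Section Clifford.
Variable F : fieldType.
Hypothesis two_neq0 : 2%:R != 0 :> F.

Local Notation J := (spin_form F).
Local Notation alt := (emb alt_frame).

Let bF : frame_space alt_frame (@alt_space F).
Proof. exact/alt_frameP/two_inj_char. Qed.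

Definition col4 (a b c d : F) : 'cV[F]_4 := \col_i nth 0 [:: a; b; c; d] i.

Lemma col4P (u : 'cV[F]_4) : u = col4 (u o0 0) (u o1 0) (u o2 0) (u o3 0).
Proof. by apply/matrixP=> i j; rewrite (ord1 j) !mxE; move: i; apply: ord4_ind. Qed.

Lemma spin_root_col4 r t a b c d :
  (1%:M + t *: spin_root F r) *m col4 a b c d =
  nth (col4 a b c d)
   [:: col4 a (b + t * c) c d; col4 (a + t * b) b (c - t * d) d;
       col4 (a - t * c) (b - t * d) c d; col4 (a + t * d) b c d;
       col4 a b (c + t * b) d; col4 a (b + t * a) c (d - t * c);
       col4 a b (c - t * a) (d - t * b); col4 a b c (d + t * a)] r.
Proof.
rewrite mulmxDl mul1mx -scalemxAl.
case: r => [|[|[|[|[|[|[|[|r]]]]]]]]; rewrite /spin_root /=;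
  last by rewrite !nth_nil mul0mx scaler0 addr0.
all: by col4_calc.
Qed.

(** The group generated by the symplectic root elements; only products of them
    are needed, since inverses are again products. *)
Inductive spin : 'M[F]_4 -> Prop :=
| Spin1 : spin 1%:M
| SpinM (r : 'I_8) t a : spin a -> spin ((1%:M + t *: spin_root F r) *m a).

Lemma spin_sp a : spin a -> sp_grp a.
Proof.
elim=> {a} [|r t a _ aS]; first exact: sp_grp1.
by apply: sp_grpM => //; apply: spin_root_grp.
Qed.

Lemma spin_mul a b : spin a -> spin b -> spin (a *m b).
Proof.
move=> aS bS; elim: aS => {a} [|r t a _ IH]; first by rewrite mul1mx.
by rewrite -mulmxA; apply: SpinM.
Qed.

Lemma spin_rootK r t :
  (1%:M + - t *: spin_root F r) *m (1%:M + t *: spin_root F r) = 1%:M.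
Proof.
rewrite mulmxDl !mul1mx mulmxDr mulmx1 -scalemxAl -scalemxAr spin_root_sq.
by rewrite !scaler0 addr0 scaleNr addrK.
Qed.

Lemma spin_root_spin (r : 'I_8) t : spin (1%:M + t *: spin_root F r).
Proof. by rewrite -[_ + _]mulmx1; apply/SpinM/Spin1. Qed.

Lemma spin_inv a : spin a -> exists2 a', spin a' & a' *m a = 1%:M.
Proof.
elim=> {a} [|r t a aS [a' a'S a'a]]; first by exists 1%:M; [apply: Spin1|rewrite mulmx1].
exists (a' *m (1%:M + - t *: spin_root F r)).
  by apply: spin_mul => //; apply: spin_root_spin.
by rewrite mulmxA -(mulmxA a') spin_rootK mulmx1.
Qed.

Let orb (u : 'cV[F]_4) := exists a (s : F),
  [/\ spin a, s != 0 & a *m col4 1 0 0 0 = s *: u].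

(** Root elements make the first coordinate nonzero, then clear the three others. *)
Lemma spin_transitive u : u != 0 -> orb u.
Proof.
have step (r : 'I_8) t w : orb ((1%:M + t *: spin_root F r) *m w) -> orb w.
  case=> a [s [aS s0 E]]; exists ((1%:M + - t *: spin_root F r) *m a), s; split=> //.
    exact: SpinM.
  by rewrite -mulmxA E -scalemxAr mulmxA spin_rootK mul1mx.
have orb_head a b c d : a != 0 -> orb (col4 a b c d).
  move=> a0.
  apply: (step 'r_5 (- b / a)); rewrite spin_root_col4 /=.
  set d1 := (d - _); rewrite mulrVK ?unitfE // subrr.
  apply: (step 'r_6 (c / a)); rewrite spin_root_col4 /= divfK // subrr.
  apply: (step 'r_7 (- (d1 - c / a * 0) / a)); rewrite spin_root_col4 /= divfK // subrr.
  exists 1%:M, a^-1; split; [exact: Spin1|exact: invr_neq0|].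
  by rewrite mul1mx; col4_calc; rewrite mulVf.
rewrite [u]col4P; move: (u o0 0) (u o1 0) (u o2 0) (u o3 0) => a b c d.
have [-> | a0 _] := eqVneq a 0; last exact: orb_head.
have [-> | d0 _] := eqVneq d 0; last first.
  apply: (step 'r_3 1); rewrite spin_root_col4 /=; apply: orb_head.
  by rewrite add0r mul1r.
have [-> | b0 _] := eqVneq b 0; last first.
  apply: (step 'r_1 1); rewrite spin_root_col4 /=; apply: orb_head.
  by rewrite add0r mul1r.
have [-> | c0 _] := eqVneq c 0; last first.
  apply: (step 'r_2 1); rewrite spin_root_col4 /=; apply: orb_head.
  by rewrite sub0r mul1r oppr_eq0.
by case/eqP; col4_calc.
Qed.

(** The Pfaffian on traceless alternating tensors. *)
Definition quad5 (c : 'cV[F]_5) : F :=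
  c p0 0 * c p4 0 - c p1 0 * c p3 0 - c p2 0 ^+ 2.

(** The Clifford action of the natural module on the spin module: composing an
    alternating tensor with the form gives an operator whose square is the
    scalar [- quad5 c]. *)
Definition cliff (c : 'cV[F]_5) : 'M[F]_4 := alt c *m J.

Lemma ord5_ind (P : 'I_5 -> Prop) :
  P p0 -> P p1 -> P p2 -> P p3 -> P p4 -> forall i, P i.
Proof.
move=> P0 P1 P2 P3 P4 [[|[|[|[|[|//]]]]] lti];
  [move: P0|move: P1|move: P2|move: P3|move: P4]; by congr P; apply: val_inj.
Qed.

Lemma emb_altE (c : 'cV[F]_5) : alt c = \matrix_(i, j)
  nth 0 (nth [::] [:: [:: 0; c p0 0; c p1 0; - c p2 0];
                      [:: - c p0 0; 0; c p2 0; c p3 0];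
                      [:: - c p1 0; - c p2 0; 0; c p4 0];
                      [:: c p2 0; - c p3 0; - c p4 0; 0]] i) j.
Proof.
have big5 (f : 'I_5 -> F) : \sum_i f i = f p0 + (f p1 + (f p2 + (f p3 + f p4))).
  rewrite !big_ord_recl big_ord0 addr0.
  by congr (f _ + (f _ + (f _ + (f _ + f _)))); apply: val_inj.
apply/matrixP=> i j; rewrite summxE big5 !mxE /=.
by move: i j; do 2![apply: ord4_ind]; rewrite ?mxE /= ?(mulr0, mulr1, addr0, add0r) ?mulrN1z ?mulrN ?mulr1.
Qed.

Lemma cliff_col4 e a b c d : cliff e *m col4 a b c d =
  col4 (e p2 0 * a - e p1 0 * b + e p0 0 * c)
       (- e p3 0 * a - e p2 0 * b - e p0 0 * d)
       (- e p4 0 * a - e p2 0 * c - e p1 0 * d)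
       (e p4 0 * b - e p3 0 * c + e p2 0 * d).
Proof.
have -> : cliff e *m col4 a b c d = alt e *m col4 d c (- b) (- a).
  by rewrite -mulmxA; congr (_ *m _); rewrite /spin_form; col4_calc.
by rewrite emb_altE; col4_calc.
Qed.

End Clifford.

(** * Singular vectors and their kernels in the spin module *)

Section Clifford2.
Variable F : fieldType.
Hypothesis two_neq0 : 2%:R != 0 :> F.
Local Notation J := (spin_form F).
Local Notation alt := (emb alt_frame).
Local Notation altg a := (frame_mx alt_frame a a).

Lemma alt_frameF : frame_space alt_frame (@alt_space F).
Proof. exact/alt_frameP/two_inj_char. Qed.
Let bF := alt_frameF.

Lemma col4D a b c d a' b' c' d' :
  col4 a b c d + col4 a' b' c' d' = col4 (a + a') (b + b') (c + c') (d + d') :> 'cV[F]_4.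
Proof. by col4_calc. Qed.
Lemma col4Z t a b c d : t *: col4 a b c d = col4 (t * a) (t * b) (t * c) (t * d) :> 'cV[F]_4.
Proof. by col4_calc. Qed.

Lemma col4_inj (a b c d a' b' c' d' : F) : col4 a b c d = col4 a' b' c' d' ->
  [/\ a = a', b = b', c = c' & d = d'].
Proof.
move=> /matrixP E; split; [move: (E o0 0)|move: (E o1 0)|move: (E o2 0)|move: (E o3 0)];
  by rewrite !mxE.
Qed.

Lemma cliffZ a c : cliff (a *: c) = a *: cliff c :> 'M[F]_4.
Proof. by rewrite /cliff embZ scalemxAl. Qed.
Lemma cliff_anticomm (c d : 'cV[F]_5) (u : 'cV[F]_4) :
  cliff c *m (cliff d *m u) + cliff d *m (cliff c *m u) =
  - polar (@quad5 F) c d *: u.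
Proof.
rewrite [u]col4P; move: (u o0 0) (u o1 0) (u o2 0) (u o3 0) => x y z w.
rewrite !cliff_col4 col4D col4Z /polar /quad5 !mxE.
by congr col4; ring.
Qed.

Lemma cliff_sq (c : 'cV[F]_5) (u : 'cV[F]_4) : cliff c *m (cliff c *m u) = - quad5 c *: u.
Proof.
rewrite [u]col4P; move: (u o0 0) (u o1 0) (u o2 0) (u o3 0) => x y z w.
by rewrite !cliff_col4 col4Z /quad5; congr col4; ring.
Qed.

Lemma spin_form_sq : J *m J = - 1%:M.
Proof.
apply: colmx_ext => u; rewrite [u]col4P mulNmx mul1mx -mulmxA.
have JE a b c d : J *m col4 a b c d = col4 d c (- b) (- a).
  by rewrite /spin_form; col4_calc.
by rewrite !JE -scaleN1r col4Z; congr col4; ring.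
Qed.

Lemma sp_grp_unit (a : 'M[F]_4) : sp_grp a -> a \in unitmx.
Proof.
move=> aG; have : (- J *m a^T *m J) *m a = 1%:M.
  by rewrite !mulNmx -!mulmxA (mulmxA a^T) aG spin_form_sq opprK.
by case/mulmx1_unit.
Qed.

Lemma cliff_eq0 (c : 'cV[F]_5) : (forall u : 'cV[F]_4, cliff c *m u = 0) -> c = 0.
Proof.
move=> c0; rewrite -(emb_crd bF c).
have -> : alt c = - (cliff c *m J) by rewrite -mulmxA spin_form_sq mulmxN mulmx1 opprK.
suff -> : cliff c = 0 by rewrite mul0mx oppr0 crd0.
by apply: colmx_ext => u; rewrite c0 mul0mx.
Qed.

Lemma cliff_grp (a : 'M[F]_4) c (u : 'cV[F]_4) : sp_grp a ->
  cliff (altg a *m c) *m (a *m u) = a *m (cliff c *m u).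
Proof.
move=> aG; rewrite /cliff (emb_grp bF) // -!mulmxA; congr (a *m (_ *m _)).
by rewrite !mulmxA aG.
Qed.

(** The operators of [c] and [d] anticommute and square to zero.  Any nonzero
    value of [cliff c \o cliff d] is killed by both; if this product vanishes,
    any nonzero value of [cliff d] is. *)
Lemma cliff_common_kernel (c d : 'cV[F]_5) :
    d != 0 -> quad5 c = 0 -> quad5 d = 0 -> polar (@quad5 F) c d = 0 ->
  exists2 u : 'cV[F]_4, u != 0 & cliff c *m u = 0 /\ cliff d *m u = 0.
Proof.
move=> d0 qc qd bcd.
have ac (u : 'cV[F]_4) : cliff c *m (cliff d *m u) = - (cliff d *m (cliff c *m u)).
  apply/eqP; rewrite -addr_eq0 cliff_anticomm bcd oppr0 scale0r //.
have cc (u : 'cV[F]_4) : cliff c *m (cliff c *m u) = 0 by rewrite cliff_sq qc oppr0 scale0r.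
have dd (u : 'cV[F]_4) : cliff d *m (cliff d *m u) = 0 by rewrite cliff_sq qd oppr0 scale0r.
have [cd0|] := eqVneq (cliff c *m cliff d) 0.
  have [i di] : exists i, cliff d *m delta_mx i 0 != (0 : 'cV_4).
    apply/existsP; apply: contraNT d0; rewrite negb_exists => /forallP dd0.
    apply/eqP/cliff_eq0 => u; suff -> : cliff d = 0 by rewrite mul0mx.
    apply/matrixP=> i j; have := dd0 j; rewrite negbK -colE => /eqP/matrixP/(_ i 0).
    by rewrite !mxE.
  by exists (cliff d *m delta_mx i 0) => //; rewrite mulmxA cd0 mul0mx dd.
move=> cd0; have [i cdi] : exists i, cliff c *m cliff d *m delta_mx i 0 != (0 : 'cV_4).
  apply/existsP; apply: contraNT cd0; rewrite negb_exists => /forallP dd0.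
  apply/eqP/matrixP=> i j; have := dd0 j; rewrite negbK -colE => /eqP/matrixP/(_ i 0).
  by rewrite !mxE.
exists (cliff c *m cliff d *m delta_mx i 0) => //.
by rewrite -mulmxA cc ac mulmxN dd oppr0.
Qed.

(** Because [cliff c] squares to a scalar. *)
Lemma cliff_kernel_singular (c : 'cV[F]_5) (u : 'cV[F]_4) : u != 0 -> cliff c *m u = 0 -> quad5 c = 0.
Proof.
move=> u0 cu; have /eqP := cliff_sq c u; rewrite cu mulmx0 eq_sym scaler_eq0.
by rewrite (negPf u0) orbF oppr_eq0 => /eqP.
Qed.

Lemma quad5_polar_self (c : 'cV[F]_5) : polar (@quad5 F) c c = 2%:R * quad5 c.
Proof. by rewrite /polar /quad5 !mxE; ring. Qed.

Lemma cliff_kernel (c : 'cV[F]_5) : c != 0 -> quad5 c = 0 ->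
  exists2 u : 'cV[F]_4, u != 0 & cliff c *m u = 0.
Proof.
move=> c0 qc; have [|u u0 [cu _]] := cliff_common_kernel c0 qc qc.
  by rewrite quad5_polar_self qc mulr0.
by exists u.
Qed.

Lemma spin_head (u : 'cV[F]_4) : u != 0 -> exists a a' s,
  [/\ spin a, spin a', a' *m a = 1%:M, s != 0 & a *m col4 1 0 0 0 = s *: u].
Proof.
move=> /spin_transitive[a [s [aS s0 E]]]; have [a' a'S a'a] := spin_inv aS.
by exists a, a', s.
Qed.

Lemma cliff_head (c : 'cV[F]_5) : cliff c *m col4 1 0 0 0 = 0 <->
  [/\ c p2 0 = 0, c p3 0 = 0 & c p4 0 = 0].
Proof.
rewrite cliff_col4 !mulr0 !mulr1 ?(subr0, addr0); split=> [E|[-> -> ->]].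
  have : col4 (c p2 0) (- c p3 0) (- c p4 0) 0 = col4 0 0 0 0 :> 'cV[F]_4.
    by rewrite E; col4_calc.
  by case/col4_inj=> -> /eqP; rewrite oppr_eq0 => /eqP -> /eqP; rewrite oppr_eq0 => /eqP ->.
by rewrite oppr0; col4_calc.
Qed.

Lemma altg_eq0 (a : 'M[F]_4) c : sp_grp a -> (altg a *m c == 0 :> 'cV[F]_5) = (c == 0).
Proof.
move=> aG; apply/eqP/eqP=> [E|->]; last by rewrite mulmx0.
apply: cliff_eq0 => u; apply: (can_inj (mulKmx (sp_grp_unit aG))).
rewrite -cliff_grp // E mulmx0.
have -> : cliff (0 : 'cV[F]_5) = 0 by rewrite -(scale0r 0) cliffZ scale0r.
by rewrite mul0mx.
Qed.

Lemma altgK (a a' : 'M[F]_4) (c : 'cV[F]_5) : sp_grp a -> sp_grp a' -> a' *m a = 1%:M ->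
  altg a' *m (altg a *m c) = c.
Proof.
by move=> aG a'G E; rewrite mulmxA (frame_grpM bF) // E (frame_mx11 bF) mul1mx.
Qed.

(** Move a spinor killed by [c] to the first basis vector. *)
Lemma singular_head (c : 'cV[F]_5) : c != 0 -> quad5 c = 0 -> exists a a' c',
  [/\ spin a, spin a', a' *m a = 1%:M, c' = altg a' *m c &
      [/\ c' p2 0 = 0, c' p3 0 = 0 & c' p4 0 = 0]].
Proof.
move=> c0 qc; have [u u0 cu] := cliff_kernel c0 qc.
have [a [a' [s [aS a'S a'a s0 au]]]] := spin_head u0.
exists a, a', (altg a' *m c); split=> //; apply/cliff_head.
have -> : col4 1 0 0 0 = a' *m (s *: u) by rewrite -au mulmxA a'a mul1mx.
by rewrite (cliff_grp _ _ (spin_sp a'S)) -scalemxAr cu scaler0 mulmx0.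
Qed.

(** The spinors killed by a singular vector form a plane.  The dual forms [l1]
    and [l2] make it possible to extend a quadratic form from the symmetric
    square of this plane to all symmetric tensors. *)
Lemma cliff_kernel_plane (c : 'cV[F]_5) : c != 0 -> quad5 c = 0 ->
  exists (v1 v2 : 'cV[F]_4) (l1 l2 : 'rV[F]_4),
    [/\ l1 *m v1 = 1%:M, l1 *m v2 = 0, l2 *m v1 = 0, l2 *m v2 = 1%:M &
      forall u : 'cV[F]_4, cliff c *m u = 0 <-> exists x y, u = x *: v1 + y *: v2].
Proof.
move=> c0 qc; have [a [a' [c' [aS a'S a'a c'E [c2 c3 c4]]]]] := singular_head c0 qc.
have c'0 : c' != 0 by rewrite c'E altg_eq0 //; apply: spin_sp.
set x0 := c' p0 0; set x1 := c' p1 0.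
have x01 : (x0 != 0) || (x1 != 0).
  apply: contraNT c'0; rewrite negb_or !negbK => /andP[/eqP x00 /eqP x10].
  by apply/eqP/matrixP=> i j; rewrite (ord1 j) mxE; move: i; apply: ord5_ind.
pose row4 x y z w : 'rV[F]_4 := (col4 x y z w)^T.
have rowE x y z w b d e f : row4 x y z w *m col4 b d e f =
    (x * b + y * d + z * e + w * f)%:M.
  apply/matrixP=> i j; rewrite (ord1 i) (ord1 j) !mxE !big_ord_recl big_ord0 !mxE /=.
  by ring.
have kE (u : 'cV[F]_4) : cliff c *m u = 0 <-> exists x y, a' *m u = col4 x (y * x0) (y * x1) 0.
  have -> : cliff c *m u = 0 <-> cliff c' *m (a' *m u) = 0.
    rewrite c'E (cliff_grp _ _ (spin_sp a'S)); split=> [->|E]; first by rewrite mulmx0.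
    by apply: (can_inj (mulKmx (sp_grp_unit (spin_sp a'S)))); rewrite E mulmx0.
  rewrite [a' *m u]col4P; move: ((a' *m u) o0 0) ((a' *m u) o1 0) ((a' *m u) o2 0)
    ((a' *m u) o3 0) => b d e f.
  rewrite cliff_col4 -/x0 -/x1 c2 c3 c4 !(mul0r, oppr0, sub0r, add0r, addr0, subr0).
  split=> [E|[x [y /col4_inj[_ -> -> ->]]]]; last first.
    by col4_calc.
  have {}E : col4 (- (x1 * d) + x0 * e) (- (x0 * f)) (- (x1 * f)) 0 = col4 0 0 0 0 :> 'cV[F]_4.
    by rewrite E; col4_calc.
  case/col4_inj: E => E1 E2 E3 _.
  have f0 : f = 0.
    by move/eqP: E2; move/eqP: E3; rewrite !oppr_eq0 !mulf_eq0; case/orP: x01 => /negPf -> /=;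
      [move=> _ /eqP|move=> /eqP].
  have {}E1 : x0 * e = x1 * d by apply/eqP; rewrite -subr_eq0 addrC E1.
  exists b; rewrite f0; have [x00|x00] := eqVneq x0 0.
    move: x01; rewrite x00 eqxx /= => x10; exists (e / x1); rewrite mulr0 divfK //.
    by move/eqP: E1; rewrite x00 mul0r eq_sym mulf_eq0 (negPf x10) => /eqP ->.
  exists (d / x0); rewrite divfK //; congr col4; apply: (mulfI x00).
  by rewrite E1; field.
have aa' : a *m a' = 1%:M by apply: mulmx1C.
pose v1 := a *m col4 1 0 0 0; pose v2 := a *m col4 0 x0 x1 0.
have a'v x y : a' *m (x *: v1 + y *: v2) = col4 x (y * x0) (y * x1) 0.
  rewrite mulmxDr -!scalemxAr /v1 /v2 !mulmxA a'a !mul1mx !col4Z col4D.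
  by congr col4; ring.
have kP (u : 'cV[F]_4) : cliff c *m u = 0 <-> exists x y, u = x *: v1 + y *: v2.
  rewrite kE; split=> [[x [y E]]|[x [y ->]]]; exists x, y => //.
  by rewrite -[u]mul1mx -aa' -mulmxA E -a'v mulmxA aa' mul1mx.
pose l2 : 'rV[F]_4 := if x0 == 0 then row4 0 0 x1^-1 0 else row4 0 x0^-1 0 0.
exists v1, v2, (row4 1 0 0 0 *m a'), (l2 *m a'); rewrite /v1 /v2.
have aK (v : 'rV[F]_4) (w : 'cV[F]_4) : v *m a' *m (a *m w) = v *m w.
  by rewrite -mulmxA (mulmxA a') a'a mul1mx.
have scE (x y : F) : x = y -> x%:M = y%:M :> 'M[F]_1 by move=> ->.
rewrite !aK; split=> //; rewrite ?rowE.
- by apply: scE; ring.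
- by apply/matrixP=> i j; rewrite !mxE !(mul0r, mulr0, addr0) mul0rn.
- rewrite /l2; case: ifP => _; rewrite rowE;
  by apply/matrixP=> i j; rewrite !mxE !(mul0r, mulr0, addr0) mul0rn.
- rewrite /l2; case: (eqVneq x0 0) x01 => [_ /= x10 | x00 _]; rewrite rowE; apply: scE.
    by rewrite mulVf //; ring.
  by rewrite mulVf //; ring.
Qed.

End Clifford2.

(** * Invariant quadratic forms on the natural module *)

Section InvariantForm.
Variable F : fieldType.
Hypothesis two_neq0 : 2%:R != 0 :> F.
Local Notation altg a := (frame_mx alt_frame a a).

Definition col5 (a b c d e : F) : 'cV[F]_5 := \col_i nth 0 [:: a; b; c; d; e] i.

Lemma col5P (u : 'cV[F]_5) :
  u = col5 (u p0 0) (u p1 0) (u p2 0) (u p3 0) (u p4 0).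
Proof. by apply/matrixP=> i j; rewrite (ord1 j) !mxE; move: i; apply: ord5_ind. Qed.

Lemma altg_long t a b c d e :
  altg (1%:M + t *: spin_root F 3) *m col5 a b c d e =
  col5 (a - t * d) (b - t * e) c d e.
Proof.
have bF := alt_frameF two_neq0.
rewrite -[RHS](emb_crd bF) frame_mxE; congr crd.
have -> : (1%:M + t *: spin_root F 3)^T = 1%:M + t *: delta_mx o3 o0.
  by rewrite trmxD trmxZ /spin_root /= trmx_delta trmx1.
rewrite /spin_root /= !emb_altE mulmxDl mulmxDr mul1mx mulmxDl !mulmx1.
rewrite -!scalemxAl -!scalemxAr; set A := \matrix_(i, j) _.
have lE (B : 'M[F]_4) i j : (delta_mx o0 o3 *m B) i j = (i == o0)%:R * B o3 j.
  rewrite mxE (bigD1 o3) //= big1 => [|k /negPf k3]; rewrite !mxE.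
    by rewrite eqxx andbT addr0.
  by rewrite k3 andbF mul0r.
have rE (B : 'M[F]_4) i j : (B *m delta_mx o3 o0) i j = B i o3 * (j == o0)%:R.
  rewrite mxE (bigD1 o3) //= big1 => [|k /negPf k3]; rewrite !mxE.
    by rewrite eqxx addr0.
  by rewrite k3 mulr0.
have addE (C B : 'M[F]_4) i j : (C + B) i j = C i j + B i j by rewrite mxE.
have sclE x (B : 'M[F]_4) i j : (x *: B) i j = x * B i j by rewrite mxE.
apply/matrixP=> i j; rewrite !(addE, sclE, rE, lE).
by rewrite !mxE; move: i j; do 2![apply: ord4_ind]; rewrite /= ?mxE /=; ring.
Qed.

Variable q : 'cV[F]_5 -> F.
Hypothesis quad_q : quadratic_form q.
Hypothesis inv_q : forall a c, spin a -> q (altg a *m c) = q c.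

Lemma quadratic_form0 : q 0 = 0.
Proof. by case: quad_q => /(_ 0 0); rewrite scaler0 expr0n /= mul0r. Qed.

Lemma quadratic_formD a u w : q (a *: u + w) = a ^+ 2 * q u + a * polar q u w + q w.
Proof.
case: quad_q => qZ pl _; rewrite -qZ.
have := pl a u 0 w; rewrite addr0 [polar q 0 w]/polar add0r quadratic_form0.
by rewrite subr0 subrr addr0 => <-; rewrite /polar; ring.
Qed.

(** A long root element translates a suitable vector [d] by [- t c], so
    [q (d - t c)] does not depend on [t]; the coefficient of [t ^ 2] is [q c]. *)
Lemma invariant_singular c : quad5 c = 0 -> q c = 0.
Proof.
move=> qc; have [->|c0] := eqVneq c 0; first exact: quadratic_form0.
have [a [a' [c' [aS a'S a'a c'E [c2 c3 c4]]]]] := singular_head two_neq0 c0 qc.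
rewrite -(inv_q c a'S) -c'E [c']col5P c2 c3 c4.
move: (c' p0 0) (c' p1 0) => x y; pose d := col5 0 0 0 x y.
have E t : q (- t *: col5 x y 0 0 0 + d) = q d.
  rewrite -[RHS](inv_q _ (spin_root_spin 'r_3 t)) altg_long; congr q.
  by apply/matrixP=> i j; rewrite (ord1 j) !mxE; move: i; apply: ord5_ind => /=; ring.
have := E 1; have := E (-1); rewrite !quadratic_formD => E1 E2.
apply: (mulfI two_neq0); rewrite mulr0.
set p := polar q _ _ in E1 E2; set z := q _ in E1 E2 *.
have : (- -1) ^+ 2 * z + - -1 * p + q d + ((- 1) ^+ 2 * z + - 1 * p + q d) - 2%:R * q d = 0.
  by rewrite E1 E2; ring.
by move=> <-; ring.
Qed.

(** A quadratic form that vanishes on the singular vectors of [quad5] is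
    proportional to it: compare coefficients on the basis vectors, on
    orthogonal pairs of them, and on two families of conics.  The values at
    [1], [-1] and [s] separate the coefficients. *)
Lemma invariant_form (s : F) : s != 0 -> s ^+ 2 != 1 ->
  exists alpha, forall c, q c = alpha * quad5 c.
Proof.
move=> s0 s1; pose d i : 'cV[F]_5 := delta_mx i 0.
have [_ _ pr] := quad_q.
have p0r w : polar q w 0 = 0 by rewrite /polar addr0 quadratic_form0 subr0 subrr.
have pZr w a i : polar q w (a *: d i) = a * polar q w (d i).
  by have := pr a (d i) 0 w; rewrite addr0 p0r addr0.
have qZ a i : q (a *: d i) = a ^+ 2 * q (d i) by case: quad_q.
have col5E a b c x y : col5 a b c x y =
    a *: d p0 + (b *: d p1 + (c *: d p2 + (x *: d p3 + y *: d p4))).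
  apply/matrixP=> i j; rewrite (ord1 j) !mxE; move: i; apply: ord5_ind => /=; ring.
have qE a b c x y : q (col5 a b c x y) =
  a ^+ 2 * q (d p0) + b ^+ 2 * q (d p1) + c ^+ 2 * q (d p2) + x ^+ 2 * q (d p3) +
  y ^+ 2 * q (d p4) + a * b * polar q (d p0) (d p1) + a * c * polar q (d p0) (d p2) +
  a * x * polar q (d p0) (d p3) + a * y * polar q (d p0) (d p4) +
  b * c * polar q (d p1) (d p2) + b * x * polar q (d p1) (d p3) +
  b * y * polar q (d p1) (d p4) + c * x * polar q (d p2) (d p3) +
  c * y * polar q (d p2) (d p4) + x * y * polar q (d p3) (d p4).
  by rewrite col5E !quadratic_formD !pr !pZr qZ; ring.
move: (q (d p0)) (q (d p1)) (q (d p2)) (q (d p3)) (q (d p4)) qE => q0 q1 q2 q3 q4.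
move: (polar q (d p0) (d p1)) (polar q (d p0) (d p2)) (polar q (d p0) (d p3))
  (polar q (d p0) (d p4)) (polar q (d p1) (d p2)) (polar q (d p1) (d p3))
  (polar q (d p1) (d p4)) (polar q (d p2) (d p3)) (polar q (d p2) (d p4))
  (polar q (d p3) (d p4)) => b01 b02 b03 b04 b12 b13 b14 b23 b24 b34 qE.
have S a b c x y : a * y - b * x - c ^+ 2 = 0 -> q (col5 a b c x y) = 0.
  by move=> E; apply: invariant_singular; rewrite /quad5 !mxE.
have z0 : q0 = 0 by rewrite -(S 1 0 0 0 0) ?qE; ring.
have z1 : q1 = 0 by rewrite -(S 0 1 0 0 0) ?qE; ring.
have z3 : q3 = 0 by rewrite -(S 0 0 0 1 0) ?qE; ring.
have z4 : q4 = 0 by rewrite -(S 0 0 0 0 1) ?qE; ring.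
rewrite {}z0 {}z1 {}z3 {}z4 in qE.
have z01 : b01 = 0 by rewrite -(S 1 1 0 0 0) ?qE; ring.
have z03 : b03 = 0 by rewrite -(S 1 0 0 1 0) ?qE; ring.
have z14 : b14 = 0 by rewrite -(S 0 1 0 0 1) ?qE; ring.
have z34 : b34 = 0 by rewrite -(S 0 0 0 1 1) ?qE; ring.
rewrite {}z01 {}z03 {}z14 {}z34 in qE.
have T t : t ^+ 2 * (b04 + q2) + t * (b02 + t ^+ 2 * b24) = 0.
  by rewrite -(S 1 0 t 0 (t ^+ 2)) ?qE; ring.
have U t : t ^+ 2 * (q2 - b13) + t * (b12 - t ^+ 2 * b23) = 0.
  by rewrite -(S 0 1 t (- t ^+ 2) 0) ?qE; ring.
have key A B C : (forall t : F, t ^+ 2 * A + t * (B + t ^+ 2 * C) = 0) ->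
    [/\ A = 0, B = 0 & C = 0].
  move=> H; have H1 := H 1; have H2 := H (-1); have H3 := H s.
  have A0 : A = 0.
    apply: (mulfI two_neq0); rewrite mulr0.
    have -> : 2%:R * A = (1 ^+ 2 * A + 1 * (B + 1 ^+ 2 * C)) +
        ((-1) ^+ 2 * A + -1 * (B + (-1) ^+ 2 * C)) by ring.
    by rewrite H1 H2 addr0.
  have B0 : B = - C by rewrite -[LHS]subr0 -H1 A0; ring.
  have C0 : C = 0.
    move/eqP: H3; rewrite A0 B0 mulr0 add0r mulf_eq0 (negPf s0) /=.
    rewrite [X in X == 0](_ : _ = (s ^+ 2 - 1) * C); last by ring.
    by rewrite mulf_eq0 subr_eq0 (negPf s1) => /eqP.
  by rewrite A0 B0 C0 oppr0.
have [/eqP A0 B0 C0] := key _ _ _ T.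
have [/eqP A1 B1 C1] : [/\ q2 - b13 = 0, b12 = 0 & - b23 = 0].
  by apply: key => t; rewrite -[RHS](U t); ring.
exists b04 => c; rewrite [c in LHS]col5P qE B0 C0 B1 /quad5.
move: A0; rewrite addr_eq0 => /eqP ->.
move: A1; rewrite subr_eq0 => /eqP <-.
have -> : b23 = 0 by apply/eqP; rewrite -oppr_eq0 C1.
by ring.
Qed.

End InvariantForm.

Section Wedge.
Variable F : fieldType.
Hypothesis two_neq0 : 2%:R != 0 :> F.
Local Notation J := (spin_form F).

Lemma sformE (u w : 'cV[F]_4) : u^T *m J *m w = (sform u w)%:M.
Proof.
apply/matrixP=> i j; rewrite (ord1 i) (ord1 j) /sform [RHS]mxE eqxx mulr1n.
have JE : J *m w = col4 (w o3 0) (w o2 0) (- w o1 0) (- w o0 0).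
  rewrite {1}[w]col4P /spin_form; apply/matrixP=> k l; rewrite (ord1 l) ?mxE.
  move: k; apply: ord4_ind; rewrite ?mxE ?big_ord_recl ?big_ord0 ?mxE /=; ring.
rewrite -mulmxA JE !mxE !big_ord_recl big_ord0 !mxE /=.
rewrite (_ : lift ord0 ord0 = o1); last exact: val_inj.
rewrite (_ : lift ord0 (lift ord0 ord0) = o2); last exact: val_inj.
rewrite (_ : lift ord0 (lift ord0 (lift ord0 ord0)) = o3); last exact: val_inj.
by rewrite (_ : ord0 = o0); [ring | exact: val_inj].
Qed.

Definition wedge (u w : 'cV[F]_4) : 'cV[F]_5 := crd alt_frame (u *m w^T - w *m u^T).

(** For orthogonal [u] and [w] the wedge is traceless, so its coordinates lose
    no information. *)
Lemma cliff_wedge u w v : sform u w = 0 ->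
  cliff (wedge u w) *m v = sform w v *: u - sform u v *: w.
Proof.
move=> uw; rewrite /cliff (space_crd (alt_frameF two_neq0)).
  rewrite !mulmxBl -!mulmxA (mulmxA w^T) (mulmxA u^T) !sformE.
  by rewrite !mul_mx_scalar.
split; first by rewrite trmxB !trmx_mul !trmxK opprB.
rewrite mulmxBr raddfB /= !mulmxA ![\tr (_ *m _^T)]mxtrace_mulC !mulmxA !sformE.
have -> : sform w u = 0 by move: uw; rewrite /sform => E; rewrite -[RHS]oppr0 -E; ring.
by rewrite uw subrr.
Qed.

Lemma wedge_neq0 u w : (forall x y, x *: u + y *: w = 0 -> x = 0 /\ y = 0) ->
  sform u w = 0 -> wedge u w != 0.
Proof.
move=> free uw; apply/eqP=> E.
have c0 v : sform w v *: u - sform u v *: w = 0.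
  rewrite -cliff_wedge // E.
  by rewrite (_ : cliff 0 = 0) ?mul0mx // -(scale0r 0) cliffZ scale0r.
have uJ v : sform u v = 0.
  by have := c0 v; rewrite -scaleNr => /free[_ /eqP]; rewrite oppr_eq0 => /eqP.
have u0 : u = 0.
  have z0 : u o0 0 = 0 by rewrite -(uJ (col4 0 0 0 1)) /sform !mxE /=; ring.
  have z1 : u o1 0 = 0 by rewrite -(uJ (col4 0 0 1 0)) /sform !mxE /=; ring.
  have z2 : u o2 0 = 0.
    by rewrite -[RHS]oppr0 -(uJ (col4 0 1 0 0)) /sform !mxE /=; ring.
  have z3 : u o3 0 = 0.
    by rewrite -[RHS]oppr0 -(uJ (col4 1 0 0 0)) /sform !mxE /=; ring.
  by rewrite [u]col4P z0 z1 z2 z3; apply/matrixP=> i j; rewrite (ord1 j) !mxE;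
    move: i; apply: ord4_ind.
have [] := free 1 0; first by rewrite u0 scaler0 scale0r addr0.
by move/eqP; rewrite oner_eq0.
Qed.

End Wedge.

(** * The dual polar space in terms of spinors *)

Definition veronese (F : comNzRingType) (u : 'cV[F]_4) : 'cV[F]_10 :=
  crd sym_frame (u *m u^T).

Lemma emb_veronese (F : comNzRingType) (u : 'cV[F]_4) :
  emb sym_frame (veronese u) = u *m u^T.
Proof.
by rewrite (space_crd (sym_frameP F)) // /sym_space trmx_mul trmxK.
Qed.

Lemma frame_mx_veronese (F : comNzRingType) a (u : 'cV[F]_4) :
  frame_mx sym_frame a a *m veronese u = veronese (a *m u).
Proof. by rewrite frame_mxE emb_veronese /veronese trmx_mul !mulmxA. Qed.

Lemma veroneseZ (F : comNzRingType) s (u : 'cV[F]_4) :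
  veronese (s *: u) = s ^+ 2 *: veronese u.
Proof. by rewrite /veronese trmxZ -scalemxAl -scalemxAr scalerA crdZ. Qed.

Section LinearAlgebra.
Variables (F : fieldType) (V : vectType F).

Lemma vline1 (U : {vspace V}) : \dim U = 1 -> exists2 z, z != 0 & U = <[z]>%VS.
Proof.
move=> U1; exists (vpick U); first by rewrite vpick0 -dimv_eq0 U1.
apply/eqP; rewrite eq_sym eqEdim -memvE memv_pick U1 dim_vline.
by rewrite vpick0 -dimv_eq0 U1.
Qed.

Lemma dim_plane (z w : V) : z != 0 -> w \notin <[z]>%VS -> \dim (<[z]> + <[w]>)%VS = 2.
Proof.
move=> z0 wz; have w0 : w != 0 by apply: contraNneq wz => ->; rewrite mem0v.
rewrite dimv_disjoint_sum ?dim_vline ?z0 ?w0 //; apply/eqP; rewrite -subv0.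
apply/subvP=> v; rewrite memv_cap memv0 => /andP[/vlineP[a ->] /vlineP[b E]].
rewrite E scaler_eq0; have [//|b0] := eqVneq b 0; case/negP: wz.
by rewrite -[w](scalerK b0) -E memvZ // memvZ // memv_line.
Qed.

Lemma vplane2 (U : {vspace V}) : \dim U = 2 ->
  exists z w, [/\ z != 0, w != 0 & U = (<[z]> + <[w]>)%VS].
Proof.
move=> U2; have U0 : vpick U != 0 by rewrite vpick0 -dimv_eq0 U2.
have /subvPn[w wU wz] : ~~ (U <= <[vpick U]>)%VS.
  by apply/negP=> /dimvS; rewrite U2 dim_vline U0.
exists (vpick U), w; split=> //.
  by apply: contraNneq wz => ->; rewrite mem0v.
apply/eqP; rewrite eq_sym eqEdim subv_add -!memvE memv_pick wU U2.
by rewrite dim_plane.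
Qed.

End LinearAlgebra.

Local Notation gact := Defs.gact.

Section Coordinates.
Variable F : finFieldType.
Hypothesis two_neq0 : 2%:R != 0 :> F.
Variable s : F.
Hypotheses (s_neq0 : s != 0) (s2_neq1 : s ^+ 2 != 1).
Variable Q : 'cV[F]_5 -> F.
Hypotheses (quadQ : quadratic_form Q) (nsQ : nonsingular_on Q fullv).
Variables (gT : finGroupType) (G : {group gT}) (x : 'I_8 -> F -> gT).
Hypothesis xG : forall r t, x r t \in G.
Variables (rV : mx_representation F G 5) (rW : mx_representation F G 10).
Hypothesis Qinv : forall g u, g \in G -> Q (rV g *m u) = Q u.
Variables (C : 'M[F]_5) (D : 'M[F]_10).
Hypothesis Cu : C \in unitmx.
Local Notation altg a := (frame_mx alt_frame a a).
Local Notation symg a := (frame_mx sym_frame a a).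
Local Notation rt r t := (1%:M + t *: spin_root F r).
Hypothesis rVx : forall r t, rV (x r t) *m C = C *m altg (rt r t).
Hypothesis rWx : forall r t, rW (x r t) *m D = D *m symg (rt r t).

Lemma spin_lift a : spin a -> exists g,
  [/\ g \in G, rV g *m C = C *m altg a & rW g *m D = D *m symg a].
Proof.
elim=> {a} [|r t a aS [g [gG gV gW]]].
  exists 1%g; rewrite group1 !repr_mx1 !mul1mx; split=> //.
    by rewrite (frame_mx11 (alt_frameF two_neq0)) mulmx1.
  by rewrite (frame_mx11 (sym_frameP F)) mulmx1.
have aG := spin_sp aS.
exists (x r t * g)%g; rewrite groupM // !repr_mxM // -!mulmxA gV gW; split=> //.
  by rewrite mulmxA rVx -mulmxA (frame_grpM (alt_frameF two_neq0)).
by rewrite mulmxA rWx -mulmxA (frame_grpM (sym_frameP F)).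
Qed.

(** The pulled back form is invariant under root elements, and it is nonzero
    because [Q] is nonsingular. *)
Lemma Q_quad5 : exists2 al, al != 0 & forall c, Q (C *m c) = al * quad5 c.
Proof.
pose q c := Q (C *m c).
have q_quad : quadratic_form q.
  case: quadQ => QZ Ql Qr; rewrite /q; split=> [a u|a u v w|a u v w].
  - by rewrite -scalemxAr QZ.
  - by rewrite /polar !mulmxDr -!scalemxAr; apply: Ql.
  - by rewrite /polar !mulmxDr -!scalemxAr; apply: Qr.
have q_inv a c : spin a -> q (altg a *m c) = q c.
  by move=> /spin_lift[g [gG E _]]; rewrite /q mulmxA -E -mulmxA Qinv.
have [al qE] := invariant_form two_neq0 q_quad q_inv s_neq0 s2_neq1.
exists al; last exact: qE.
apply/eqP=> al0; have Q0 z : Q z = 0.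
  by rewrite -[z](mulKVmx Cu) -/(q _) qE al0 mul0r.
have /matrixP/(_ p0 0)/eqP : (delta_mx p0 0 : 'cV[F]_5) = 0.
  by apply: nsQ; rewrite ?memvf // => w _; rewrite /polar !Q0 !subr0.
by rewrite !mxE !eqxx oner_eq0.
Qed.

Lemma Q_singular c : Q (C *m c) = 0 <-> quad5 c = 0.
Proof.
have [al al0 ->] := Q_quad5; split=> [/eqP|->]; last by rewrite mulr0.
by rewrite mulf_eq0 (negPf al0) => /eqP.
Qed.

(** A matrix, so that [spinor_plane] is the kernel of a linear map. *)
Definition clifford_kernel_mx (u : 'cV[F]_4) : 'M[F]_(4, 5) :=
  (\matrix_(i, j) (cliff (delta_mx j 0) *m u) i 0) *m invmx C.

Lemma clifford_kernel_mxE u z :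
  clifford_kernel_mx u *m z = cliff (invmx C *m z) *m u.
Proof.
rewrite -mulmxA; move: (invmx C *m z) => c; rewrite /cliff {2}/emb.
apply/matrixP=> i j; rewrite (ord1 j) !mulmx_suml summxE mxE; apply: eq_bigr => k _.
by rewrite mxE emb_delta -!scalemxAl [in RHS]mxE mulrC.
Qed.

(** The wedges of [u] with the vectors orthogonal to [u], described without
    choosing such vectors. *)
Definition spinor_plane (u : 'cV[F]_4) : {vspace 'cV[F]_5} :=
  lker (linfun (mulmx (clifford_kernel_mx u))).

Lemma mem_spinor_plane u z : (z \in spinor_plane u) = (cliff (invmx C *m z) *m u == 0).
Proof. by rewrite memv_ker lfunE /= clifford_kernel_mxE. Qed.

Lemma mem_spinor_planeC u c : (C *m c \in spinor_plane u) = (cliff c *m u == 0).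
Proof. by rewrite mem_spinor_plane mulKmx. Qed.

Lemma spinor_planeZ t u : t != 0 -> spinor_plane (t *: u) = spinor_plane u.
Proof.
move=> t0; apply/vspaceP=> z; rewrite !mem_spinor_plane -scalemxAr scaler_eq0 (negPf t0) //.
Qed.

Lemma gact_spinor_plane a g u : spin a -> g \in G -> rV g *m C = C *m altg a ->
  gact rV g (spinor_plane u) = spinor_plane (a *m u).
Proof.
move=> aS gG gV; have [a' a'S a'a] := spin_inv aS.
have aa' : a *m a' = 1%:M by apply: mulmx1C.
have aG := spin_sp aS; have a'G := spin_sp a'S.
apply/vspaceP=> z; apply/memv_imgP/idP=> [[w wX ->]|zX].
  rewrite lfunE /= -[w](mulKVmx Cu) (mulmxA (rV g)) gV -(mulmxA C) mem_spinor_planeC.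
  move: wX; rewrite mem_spinor_plane => /eqP E.
  by rewrite cliff_grp ?E ?mulmx0.
exists (C *m (altg a' *m (invmx C *m z))).
  rewrite mem_spinor_planeC -(mul1mx u) -a'a -(mulmxA a') cliff_grp //.
  by move: zX; rewrite mem_spinor_plane => /eqP ->; rewrite mulmx0.
by rewrite lfunE /= (mulmxA (rV g)) gV -(mulmxA C) (altgK two_neq0) // mulKVmx.
Qed.

Lemma repr_lker0 g : g \in G -> lker (linfun (mulmx (rV g) : 'cV_5 -> 'cV_5)) = 0%VS.
Proof.
move=> gG; apply/eqP; rewrite -subv0; apply/subvP=> z.
rewrite memv_ker lfunE memv0 /= => /eqP E; apply/eqP.
by rewrite -[z](mulKmx (repr_mx_unit rV gG)) E mulmx0.
Qed.

Local Notation d0 := (col4 1 0 0 0 : 'cV[F]_4).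

Lemma dim_spinor_plane_head : \dim (spinor_plane d0) = 2.
Proof.
pose z0 : 'cV[F]_5 := C *m delta_mx p0 0; pose z1 : 'cV[F]_5 := C *m delta_mx p1 0.
have E i j (k : F) : i != j ->
    C *m delta_mx i 0 = k *: (C *m delta_mx j 0 : 'cV[F]_5) -> False.
  move=> ij; rewrite scalemxAr => /(can_inj (mulKmx Cu))/matrixP/(_ i 0)/eqP.
  by rewrite !mxE eqxx (negPf ij) mulr0 oner_eq0.
have -> : spinor_plane d0 = (<[z0]> + <[z1]>)%VS.
  apply/vspaceP=> z; rewrite -[z](mulKVmx Cu) mem_spinor_planeC; move: (invmx C *m z) => c.
  apply/eqP/memv_addP=> [/cliff_head[c2 c3 c4]|].
    exists (c p0 0 *: z0); first by rewrite memvZ ?memv_line.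
    exists (c p1 0 *: z1); first by rewrite memvZ ?memv_line.
    rewrite !scalemxAr -mulmxDr; congr (_ *m _); apply/matrixP=> i j.
    by rewrite (ord1 j) !mxE; move: i; apply: ord5_ind; rewrite ?c2 ?c3 ?c4 /=; ring.
  case=> w1 /vlineP[k ->] [w2 /vlineP[l ->]]; rewrite !scalemxAr -mulmxDr.
  by move/(can_inj (mulKmx Cu)) => ->; apply/cliff_head; rewrite !mxE /= !mulr0 addr0.
apply: dim_plane.
  by apply/eqP=> z00; apply: (@E p0 p1 0) => //; rewrite scale0r.
by apply/negP=> /vlineP[k]; apply: E.
Qed.

Lemma dim_spinor_plane u : u != 0 -> \dim (spinor_plane u) = 2.
Proof.
move=> u0; have [a [a' [t [aS a'S a'a t0 E]]]] := spin_head u0.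
have [g [gG gV _]] := spin_lift aS.
rewrite -(spinor_planeZ u t0) -E -(gact_spinor_plane _ aS gG gV) limg_dim_eq ?dim_spinor_plane_head //.
by rewrite repr_lker0 // capv0.
Qed.

(** A spinor can be recovered from its plane. *)
Lemma spinor_plane_sub u w : u != 0 -> (spinor_plane u <= spinor_plane w)%VS -> exists k, w = k *: u.
Proof.
move=> u0; have [a [a' [t [aS a'S a'a t0 E]]]] := spin_head u0.
have aa' : a *m a' = 1%:M by apply: mulmx1C.
have [g [gG gV _]] := spin_lift aS => /subvP sub.
have inX c : cliff c *m d0 = 0 -> cliff c *m (a' *m w) = 0.
  move=> c0; have : C *m (altg a *m c) \in spinor_plane w.
    apply: sub; rewrite -(spinor_planeZ u t0) -E mem_spinor_planeC cliff_grp ?c0 ?mulmx0 //.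
    exact: spin_sp.
  rewrite mem_spinor_planeC -[w in X in X -> _]mul1mx -aa' -(mulmxA a) cliff_grp //;
    last exact: spin_sp.
  by move/eqP=> E'; rewrite -[LHS]mul1mx -a'a -(mulmxA a') E' mulmx0.
have [] : cliff (delta_mx p0 0) *m (a' *m w) = 0 /\ cliff (delta_mx p1 0) *m (a' *m w) = 0.
  by split; apply/inX/cliff_head; rewrite !mxE.
have w'E : w = a *m (a' *m w) by rewrite mulmxA aa' mul1mx.
rewrite [a' *m w]col4P in w'E *; move: w'E.
move: ((a' *m w) o0 0) ((a' *m w) o1 0) ((a' *m w) o2 0) ((a' *m w) o3 0) => b c d e ->.
rewrite !cliff_col4 !mxE /= !(mul0r, mul1r, subr0, sub0r, add0r, oppr0, addr0).
have c4_0 : 0 = col4 0 0 0 0 :> 'cV[F]_4.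
  by apply/matrixP=> i j; rewrite (ord1 j) !mxE; move: i; apply: ord4_ind.
rewrite !c4_0 => /col4_inj[-> /eqP + _ _] /col4_inj[/eqP + _ _ _].
rewrite !oppr_eq0 => /eqP -> /eqP ->; exists (b * t); rewrite -scalerA -E scalemxAr.
by rewrite col4Z mulr1 mulr0.
Qed.

Lemma spinor_plane_singular u : u != 0 -> tot_singularb Q (spinor_plane u).
Proof.
move=> u0; apply/tot_singularP=> z; rewrite mem_spinor_plane => /eqP E.
by rewrite -[z](mulKVmx Cu); apply/Q_singular/cliff_kernel_singular/E.
Qed.

Local Notation Delta := (dual_polar_space Q).

Definition represents (p : point Delta) (u : 'cV[F]_4) : Prop := u != 0 /\ val p = spinor_plane u.

(** The Clifford operators of a totally singular plane have a common kernel
    vector [u], and the plane of [u] has the same dimension. *)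
Lemma point_spinor p : exists u, represents p u.
Proof.
case: p => U /= hU; have /andP[/tot_singularP sU /eqP U2] := hU.
have [z [w [z0 w0 UE]]] := vplane2 U2.
have zU : z \in U by rewrite UE (subvP (addvSl _ _)) ?memv_line.
have wU : w \in U by rewrite UE (subvP (addvSr _ _)) ?memv_line.
have qz v : v \in U -> quad5 (invmx C *m v) = 0.
  by move=> vU; apply/Q_singular; rewrite mulKVmx // sU.
have [||||u u0 [zu wu]] := @cliff_common_kernel _ two_neq0 (invmx C *m z) (invmx C *m w).
- by apply: contraNneq w0 => E; rewrite -[w](mulKVmx Cu) E mulmx0.
- exact: qz.
- exact: qz.
- by rewrite /polar -mulmxDr !qz ?subr0 ?memvD.
exists u; split=> //=; apply/eqP; rewrite eqEdim dim_spinor_plane // U2 andbT UE.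
by rewrite subv_add -!memvE !mem_spinor_plane zu wu !eqxx.
Qed.

Lemma spinor_point u : u != 0 -> exists p, represents p u.
Proof.
move=> u0; have h : tot_singularb Q (spinor_plane u) && (\dim (spinor_plane u) == 2%N).
  by rewrite spinor_plane_singular // dim_spinor_plane.
by exists (exist _ (spinor_plane u) h).
Qed.

Lemma represents_inj p p' u t : represents p u -> represents p' (t *: u) -> p = p'.
Proof.
move=> [u0 pu] [tu0 pu']; apply: val_inj; rewrite pu pu' spinor_planeZ //.
by apply: contraNneq tu0 => ->; rewrite scale0r.
Qed.

Definition represents_line (l : line Delta) (c : 'cV[F]_5) :=
  forall p u, represents p u -> (incident p l <-> cliff c *m u = 0).

Lemma line_singular l : exists c, [/\ c != 0, quad5 c = 0 & represents_line l c].
Proof.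
case: l => U /= hU; have /andP[/tot_singularP sU /eqP U1] := hU.
have [z z0 UE] := vline1 U1; exists (invmx C *m z); split.
- by apply: contraNneq z0 => E; rewrite -[z](mulKVmx Cu) E mulmx0.
- by apply/Q_singular; rewrite mulKVmx // sU // UE memv_line.
- move=> p u [u0 pu]; rewrite /= pu UE -memvE mem_spinor_plane.
  by split=> [/eqP|/eqP].
Qed.

Lemma singular_line c : c != 0 -> quad5 c = 0 -> exists l, represents_line l c.
Proof.
move=> c0 qc.
have h : tot_singularb Q <[C *m c]>%VS && (\dim <[C *m c]>%VS == 1%N).
  rewrite dim_vline; apply/andP; split.
    apply/tot_singularP=> w /vlineP[k ->]; case: quadQ => -> _ _.
    by move/Q_singular: qc => ->; rewrite mulr0.
  suff -> : C *m c != 0 by [].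
  by apply: contraNneq c0 => E; rewrite -[c](mulKmx Cu) E mulmx0.
exists (exist _ <[C *m c]>%VS h) => p u [u0 pu] /=; rewrite pu -memvE mem_spinor_planeC.
by split=> /eqP.
Qed.

Variables (eps : point Delta -> {vspace 'cV[F]_10}) (X0 : point Delta).
Let v0 := D *m (delta_mx ord0 0 : 'cV[F]_10).
Hypothesis stab : forall g, g \in G -> gact rW g <[v0]>%VS = <[v0]>%VS ->
  gact rV g (val X0) = val X0.
Hypothesis epsE : forall g X, g \in G -> val X = gact rV g (val X0) ->
  eps X = gact rW g <[v0]>%VS.

Lemma veronese_d0 : veronese d0 = delta_mx ord0 0.
Proof.
rewrite -[RHS](emb_crd (sym_frameP F)) emb_delta /= map_delta_mx; congr crd.
apply/matrixP=> i j; rewrite !mxE big_ord1 !mxE.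
by move: i j; do 2![apply: ord4_ind]; rewrite /=; ring.
Qed.

Lemma gact_line g v : gact rW g <[v]>%VS = <[rW g *m v]>%VS.
Proof. by rewrite /gact limg_line lfunE. Qed.

(** The base point is the plane of some spinor, whose line is fixed by the three
    root elements below, which fix the highest weight vector.  This leaves only
    the highest weight line. *)
Lemma base_pointE : val X0 = spinor_plane d0.
Proof.
have [u [u0 Xu]] := point_spinor X0.
have fix_u a : spin a -> a *m d0 = d0 -> spinor_plane (a *m u) = spinor_plane u.
  move=> aS ad; have [g [gG gV gW]] := spin_lift aS.
  rewrite -(gact_spinor_plane _ aS gG gV) -Xu; apply: stab => //.
  by rewrite gact_line /v0 mulmxA gW -(mulmxA D) -veronese_d0 frame_mx_veronese ad.
have fix_line r : (r < 8)%N -> rt r 1 *m d0 = d0 ->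
    exists k, rt r 1 *m u = k *: u.
  move=> r8 rd; apply: spinor_plane_sub => //.
  by rewrite (fix_u _ (spin_root_spin (Ordinal r8) 1) rd) subvv.
have split0 (y z k : F) : z = k * z -> y + 1 * z = k * y -> z = 0.
  move=> E1 E2; have [//|z0] := eqVneq z 0.
  have k1 : k = 1 by apply: (mulIf z0); rewrite mul1r.
  by move/eqP: E2; rewrite k1 !mul1r -subr_eq0 addrC addKr => /eqP.
move: fix_line; rewrite Xu [u]col4P; rewrite [u]col4P in u0.
move: (u o0 0) (u o1 0) (u o2 0) (u o3 0) u0 => a b c e u0 fix_line.
have fix_d0 r : (r \in [:: 0; 3; 4])%N -> rt r 1 *m d0 = d0.
  rewrite spin_root_col4 !inE => /or3P[]/eqP-> /=; by rewrite mulr0 addr0.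
have [k] := fix_line 0%N isT (fix_d0 0%N isT).
rewrite spin_root_col4 col4Z /= => /col4_inj[_ Eb Ec _]; have c0 := split0 _ _ _ Ec Eb.
have [k'] := fix_line 4%N isT (fix_d0 4%N isT).
rewrite spin_root_col4 col4Z /= => /col4_inj[_ Eb' Ec' _]; have b0 := split0 _ _ _ Eb' Ec'.
have [k''] := fix_line 3%N isT (fix_d0 3%N isT).
rewrite spin_root_col4 col4Z /= => /col4_inj[Ea _ _ Ee]; have e0 := split0 _ _ _ Ee Ea.
rewrite b0 c0 e0 in u0 *; have a0 : a != 0.
  by apply: contraNneq u0 => ->; apply/eqP/matrixP=> i j; rewrite (ord1 j) !mxE;
     move: i; apply: ord4_ind.
by rewrite -(spinor_planeZ d0 a0) col4Z mulr1 mulr0.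
Qed.

Lemma weyl_embeddingE p u : represents p u -> eps p = <[D *m veronese u]>%VS.
Proof.
case=> u0 pu; have [a [a' [t [aS a'S a'a t0 E]]]] := spin_head u0.
have [g [gG gV gW]] := spin_lift aS.
rewrite (epsE gG); last by rewrite base_pointE (gact_spinor_plane _ aS gG gV) E spinor_planeZ.
rewrite gact_line /v0 mulmxA gW -(mulmxA D) -veronese_d0 frame_mx_veronese E veroneseZ.
rewrite -scalemxAr; apply/eqP; rewrite eqEdim -!memvE memvZ ?memv_line //=.
by rewrite !dim_vline scaler_eq0 expf_eq0 (negPf t0).
Qed.

End Coordinates.

(** * The Weyl embedding is veronesean *)

Section Rank1.
Variable F : fieldType.
Implicit Types u w : 'cV[F]_4.

Definition independent u w := forall a b : F, a *: u + b *: w = 0 -> a = 0 /\ b = 0.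

Lemma col_neq0 u : u != 0 -> exists i, u i 0 != 0.
Proof.
move=> u0; apply/existsP; apply: contraNT u0; rewrite negb_exists => /forallP u00.
apply/eqP/matrixP=> i j; rewrite (ord1 j) mxE; apply/eqP; have := u00 i.
by rewrite negbK.
Qed.

Lemma outerE u w i j : (u *m w^T) i j = u i 0 * w j 0.
Proof. by rewrite !mxE big_ord1 !mxE. Qed.

(** Compare a column of both sides. *)
Lemma outer_line u w k : w != 0 -> w *m w^T = k *: (u *m u^T) -> exists t, w = t *: u.
Proof.
move=> /col_neq0[i wi] /matrixP E; exists (k * u i 0 / w i 0).
apply/matrixP=> j l; rewrite (ord1 l) [RHS]mxE; apply: (mulIf wi).
by have := E j i; rewrite [RHS]mxE !outerE => ->; field.
Qed.

(** A nonzero column of the left-hand side is proportional to [u]. *)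
Lemma outer_plane u v1 v2 a b c : u != 0 ->
  u *m u^T = a *: (v1 *m v1^T) + b *: (v1 *m v2^T + v2 *m v1^T) + c *: (v2 *m v2^T) ->
  exists x y, u = x *: v1 + y *: v2.
Proof.
move=> /col_neq0[i ui] /matrixP E.
exists ((a * v1 i 0 + b * v2 i 0) / u i 0), ((b * v1 i 0 + c * v2 i 0) / u i 0).
apply/matrixP=> j l; rewrite (ord1 l); apply: (mulIf ui).
have -> : u j 0 * u i 0 = (u *m u^T) j i by rewrite outerE.
have addE (A B : 'M[F]_4) k m : (A + B) k m = A k m + B k m by rewrite mxE.
have sclE t (A : 'M[F]_4) k m : (t *: A) k m = t * A k m by rewrite mxE.
by rewrite E !(addE, sclE, outerE) !mxE; field.
Qed.

Lemma outer_free u w a b c : independent u w ->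
  a *: (u *m u^T) + b *: (u *m w^T + w *m u^T) + c *: (w *m w^T) = 0 ->
  [/\ a = 0, b = 0 & c = 0].
Proof.
move=> uw /matrixP E.
have addE (A B : 'M[F]_4) k m : (A + B) k m = A k m + B k m by rewrite mxE.
have sclE t (A : 'M[F]_4) k m : (t *: A) k m = t * A k m by rewrite mxE.
have ab i : a * u i 0 + b * w i 0 = 0 /\ b * u i 0 + c * w i 0 = 0.
  apply: uw; apply/matrixP=> j l; rewrite (ord1 l) [RHS]mxE !mxE.
  by have := E j i; rewrite !(addE, sclE, outerE) [RHS]mxE => <-; ring.
have [a0 b0] : a = 0 /\ b = 0.
  by apply: uw; apply/matrixP=> i j; rewrite (ord1 j) !mxE; have [] := ab i.
have [_ c0] : b = 0 /\ c = 0.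
  by apply: uw; apply/matrixP=> i j; rewrite (ord1 j) !mxE; have [] := ab i.
by [].
Qed.

Lemma outerDD u w x y : (x *: u + y *: w) *m (x *: u + y *: w)^T =
  x ^+ 2 *: (u *m u^T) + (x * y) *: (u *m w^T + w *m u^T) + y ^+ 2 *: (w *m w^T).
Proof.
apply/matrixP=> i j.
have addE (A B : 'M[F]_4) k m : (A + B) k m = A k m + B k m by rewrite mxE.
have sclE t (A : 'M[F]_4) k m : (t *: A) k m = t * A k m by rewrite mxE.
by rewrite !(addE, sclE, outerE) !mxE; ring.
Qed.

End Rank1.

Section Span3.
Variables (F : fieldType) (V : vectType F).

Lemma mem_span3 (a b c w : V) :
  w \in <<[:: a; b; c]>>%VS <-> exists x y z, w = x *: a + y *: b + z *: c.
Proof.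
rewrite !span_cons span_nil addv0; split=> [|[x [y [z ->]]]].
  move/memv_addP=> [w1 /vlineP[x ->] [w2 /memv_addP[w3 /vlineP[y ->] [w4 /vlineP[z ->] ->]] ->]].
  by exists x, y, z; rewrite addrA.
by rewrite -addrA; do ?apply: memv_add; rewrite memvZ ?memv_line.
Qed.

Lemma dim_span3 (a b c : V) :
  (forall x y z, x *: a + y *: b + z *: c = 0 -> [/\ x = 0, y = 0 & z = 0]) ->
  \dim <<[:: a; b; c]>>%VS = 3.
Proof.
move=> abc; apply/eqP; change (free [tuple a; b; c]); apply/freeP=> k.
rewrite !big_ord_recl big_ord0 addr0 /= addrA => /abc[bilin0 k1 k2] i.
by case: i => [[|[|[|//]]] lti]; [rewrite -[RHS]bilin0|rewrite -[RHS]k1|rewrite -[RHS]k2];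
  congr k; apply: val_inj.
Qed.

End Span3.

Section Embedding.
Variable (F : finFieldType).
Hypothesis two_neq0 : 2%:R != 0 :> F.
Variables (Gamma : geometry) (rep : point Gamma -> 'cV[F]_4 -> Prop).
Variable lrep : line Gamma -> 'cV[F]_5 -> Prop.
Hypothesis rep_neq0 : forall p u, rep p u -> u != 0.
Hypothesis rep_ex : forall p, exists u, rep p u.
Hypothesis pt_ex : forall u, u != 0 -> exists p, rep p u.
Hypothesis rep_inj : forall p p' u t, rep p u -> rep p' (t *: u) -> p = p'.
Hypothesis lrepP : forall l c p u, lrep l c -> rep p u ->
  (incident p l <-> cliff c *m u = 0).
Hypothesis line_ex : forall l, exists c, [/\ c != 0, quad5 c = 0 & lrep l c].
Variables (D : 'M[F]_10) (eps : point Gamma -> {vspace 'cV[F]_10}).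
Hypothesis Du : D \in unitmx.
Hypothesis eps_rep : forall p u, rep p u -> eps p = <[D *m veronese u]>%VS.

Let phi u := D *m veronese u.
Let symmx z := emb sym_frame (invmx D *m z).
Let symvec A : 'cV[F]_10 := D *m crd sym_frame A.

Lemma symmx_phi u : symmx (phi u) = u *m u^T.
Proof. by rewrite /symmx mulKmx // emb_veronese. Qed.

Lemma symmx_lin a z w : symmx (a *: z + w) = a *: symmx z + symmx w.
Proof. by rewrite /symmx mulmxDr -scalemxAr embD embZ. Qed.

Lemma symmx0 : symmx 0 = 0.
Proof. by rewrite /symmx mulmx0 -(scale0r 0) embZ scale0r. Qed.

Lemma symvecK A : A^T = A -> symmx (symvec A) = A.
Proof. by move=> AT; rewrite /symmx mulKmx // (space_crd (sym_frameP F)). Qed.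

Lemma symmxK z : symvec (symmx z) = z.
Proof. by rewrite /symvec (emb_crd (sym_frameP F)) mulKVmx. Qed.

Lemma symvecZ a A : symvec (a *: A) = a *: symvec A.
Proof. by rewrite /symvec crdZ -scalemxAr. Qed.

Lemma symvecD A B : symvec (A + B) = symvec A + symvec B.
Proof. by rewrite /symvec crdD mulmxDr. Qed.

Lemma phi_neq0 u : u != 0 -> phi u != 0.
Proof.
move=> /col_neq0[i ui]; apply/eqP=> E.
have : symmx (phi u) = 0 by rewrite E /symmx mulmx0 -(scale0r 0) embZ scale0r.
rewrite symmx_phi => /matrixP/(_ i i)/eqP; rewrite outerE mxE mulf_eq0 orbb.
by rewrite (negPf ui).
Qed.

Lemma conic_plane l : exists (v1 v2 : 'cV[F]_4) (l1 l2 : 'rV[F]_4),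
  [/\ l1 *m v1 = 1%:M, l1 *m v2 = 0, l2 *m v1 = 0, l2 *m v2 = 1%:M &
    forall p u, rep p u -> (incident p l <-> exists x y, u = x *: v1 + y *: v2)].
Proof.
have [c [c0 qc lc]] := line_ex l.
have [v1 [v2 [l1 [l2 [E11 E12 E21 E22 ker]]]]] := cliff_kernel_plane two_neq0 c0 qc.
exists v1, v2, l1, l2; split=> // p u pu.
by split=> [/(lrepP lc pu)/ker|/ker/(lrepP lc pu)].
Qed.

Section Conic.
Variables (v1 v2 : 'cV[F]_4) (l1 l2 : 'rV[F]_4).
Hypotheses (E11 : l1 *m v1 = 1%:M) (E12 : l1 *m v2 = 0).
Hypotheses (E21 : l2 *m v1 = 0) (E22 : l2 *m v2 = 1%:M).

Let z1 := symvec (v1 *m v1^T).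
Let z2 := symvec (v1 *m v2^T + v2 *m v1^T).
Let z3 := symvec (v2 *m v2^T).
Definition conic_span : {vspace 'cV[F]_10} := <<[:: z1; z2; z3]>>%VS.
Let k (a b : 'rV[F]_4) z : F := (a *m symmx z *m b^T) 0 0.
(** The discriminant of the symmetric tensor in the basis dual to [l1, l2]. *)
Definition conic_form z : F := k l1 l1 z * k l2 l2 z - k l1 l2 z ^+ 2.

Lemma bilin_lin a b t z w : k a b (t *: z + w) = t * k a b z + k a b w.
Proof. by rewrite /k symmx_lin mulmxDr mulmxDl -scalemxAr -scalemxAl !mxE. Qed.

Lemma bilin0 a b : k a b 0 = 0.
Proof. by rewrite /k symmx0 mulmx0 mul0mx mxE. Qed.

Lemma bilinZ a b t z : k a b (t *: z) = t * k a b z.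
Proof. by rewrite -[t *: z]addr0 bilin_lin bilin0 addr0. Qed.

Lemma conic_bilin x y z :
  [/\ k l1 l1 (x *: z1 + y *: z2 + z *: z3) = x,
      k l1 l2 (x *: z1 + y *: z2 + z *: z3) = y &
      k l2 l2 (x *: z1 + y *: z2 + z *: z3) = z].
Proof.
have St : symmx (x *: z1 + y *: z2 + z *: z3) =
    x *: (v1 *m v1^T) + y *: (v1 *m v2^T + v2 *m v1^T) + z *: (v2 *m v2^T).
  rewrite -!symvecZ -!symvecD symvecK //.
  by rewrite !(trmxD, trmxZ, trmx_mul, trmxK) [in X in y *: X]addrC.
pose ev (a b : 'rV[F]_4) (A : 'M[F]_4) : F := (a *m A *m b^T) 0 0.
have evD a b A B : ev a b (A + B) = ev a b A + ev a b B.
  by rewrite /ev mulmxDr mulmxDl mxE.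
have evZ a b t A : ev a b (t *: A) = t * ev a b A.
  by rewrite /ev -scalemxAr -scalemxAl mxE.
have evO a b (v w : 'cV[F]_4) : ev a b (v *m w^T) = (a *m v) 0 0 * (b *m w) 0 0.
  by rewrite /ev mulmxA -mulmxA -trmx_mul mxE big_ord1 [X in _ * X]mxE.
rewrite /k St -!/(ev _ _ _) !(evD, evZ, evO) E11 E12 E21 E22 !mxE /= !mulr1n.
by split; ring.
Qed.

Lemma conic_dim : \dim conic_span = 3.
Proof.
apply: dim_span3 => x y z E; have [k1 k2 k3] := conic_bilin x y z.
by move: k1 k2 k3; rewrite E !bilin0.
Qed.

Lemma conic_polar z w : polar conic_form z w =
  k l1 l1 z * k l2 l2 w + k l1 l1 w * k l2 l2 z - 2%:R * k l1 l2 z * k l1 l2 w.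
Proof.
rewrite /polar /conic_form; have := fun a b => bilin_lin a b 1 z w.
by rewrite scale1r => kD; rewrite !kD; ring.
Qed.

Lemma conic_quadratic : quadratic_form conic_form.
Proof.
split=> [a u|a u v w|a u v w].
- by rewrite /conic_form !bilinZ; ring.
- by rewrite !conic_polar !bilin_lin; ring.
- by rewrite !conic_polar !bilin_lin; ring.
Qed.

Lemma conic_nonsingular : nonsingular_on conic_form conic_span.
Proof.
move=> u uU _ up; have /mem_span3[x [y [z uE]]] := uU.
have [ku1 ku2 ku3] := conic_bilin x y z; rewrite -uE in ku1 ku2 ku3.
have inU a b c : a *: z1 + b *: z2 + c *: z3 \in conic_span by apply/mem_span3; exists a, b, c.
have zx : x = 0.
  have := up _ (inU 0 0 1); have [k1 k2 k3] := conic_bilin 0 0 1.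
  by rewrite conic_polar k1 k2 k3 ku1 => <-; ring.
have zz : z = 0.
  have := up _ (inU 1 0 0); have [k1 k2 k3] := conic_bilin 1 0 0.
  by rewrite conic_polar k1 k2 k3 ku3 => <-; ring.
have zy : y = 0.
  have := up _ (inU 0 1 0); have [k1 k2 k3] := conic_bilin 0 1 0.
  rewrite conic_polar k1 k2 k3 ku2 => E; apply: (mulfI two_neq0).
  by rewrite mulr0 -[RHS]oppr0 -E; ring.
by rewrite uE zx zy zz !scale0r !addr0.
Qed.

Lemma phi_plane x y :
  phi (x *: v1 + y *: v2) = x ^+ 2 *: z1 + (x * y) *: z2 + y ^+ 2 *: z3.
Proof. by rewrite -!symvecZ -!symvecD -outerDD. Qed.

(** A symmetric tensor [a, b, c] of the plane with [a * c = b ^+ 2] is, up to a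
    scalar, the square of [a *: v1 + b *: v2], or of [v2] when [a = 0]. *)
Lemma conic_points P : [/\ \dim P = 1, (P <= conic_span)%VS & tot_singular conic_form P] <->
  exists2 u, u != 0 /\ (exists x y, u = x *: v1 + y *: v2) & P = <[phi u]>%VS.
Proof.
split=> [[P1 PU Ps]|[u [u0 [x [y uE]]] ->]]; last first.
  split; first by rewrite dim_vline phi_neq0.
    by rewrite -memvE; apply/mem_span3; rewrite uE phi_plane; do 3![eexists].
  move=> w /vlineP[a ->]; case: conic_quadratic => -> _ _.
  rewrite uE phi_plane /conic_form.
  by have [-> -> ->] := conic_bilin (x ^+ 2) (x * y) (y ^+ 2); ring.
have [w w0 PE] := vline1 P1.
have wP : w \in P by rewrite PE memv_line.
have /mem_span3[a [b [c wE]]] := subvP PU _ wP.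
have := Ps _ wP; rewrite /conic_form wE; have [-> -> ->] := conic_bilin a b c => qw.
have bb : b ^+ 2 = a * c by rewrite -[LHS]add0r -qw subrK.
have fin t u : t != 0 -> phi u = t *: w -> (exists x y, u = x *: v1 + y *: v2) ->
  exists2 u, u != 0 /\ (exists x y, u = x *: v1 + y *: v2) & P = <[phi u]>%VS.
  move=> t0 E xy; exists u; first split=> //.
    apply: contraNneq w0 => u0; have : phi u == 0.
      by rewrite u0 /phi /veronese mul0mx crd0 mulmx0.
    by rewrite E scaler_eq0 (negPf t0).
  rewrite PE E; apply/eqP; rewrite eq_sym eqEdim -memvE memvZ ?memv_line //=.
  by rewrite !dim_vline scaler_eq0 (negPf t0).
have [a0|a0] := eqVneq a 0; last first.
  apply: (fin a (a *: v1 + b *: v2)) => //; last by exists a, b.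
  by rewrite phi_plane bb wE !scalerDr !scalerA expr2.
have b0 : b = 0.
  by move/eqP: bb; rewrite a0 mul0r expf_eq0 => /eqP.
have c0 : c != 0 by apply: contraNneq w0 => c0; rewrite wE a0 b0 c0 !scale0r !addr0.
apply: (fin c^-1 (0 *: v1 + 1 *: v2)); [by rewrite invr_eq0| |by exists 0, 1].
by rewrite phi_plane wE a0 b0 !scale0r !add0r scalerA mulVf // expr0n expr1n mul0r !scale0r !add0r.
Qed.

End Conic.

Lemma line_imageP l v1 v2 :
    (forall p u, rep p u -> (incident p l <-> exists x y, u = x *: v1 + y *: v2)) ->
  forall P, line_image eps l P <->
    exists2 u, u != 0 /\ (exists x y, u = x *: v1 + y *: v2) & P = <[phi u]>%VS.
Proof.
move=> inc P; split=> [[p pl ->]|[u [u0 uxy] ->]].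
  have [u pu] := rep_ex p; exists u; last exact: eps_rep.
  by split; [apply: rep_neq0 pu | apply: (inc _ _ pu).1].
have [p pu] := pt_ex u0; exists p; last by rewrite (eps_rep pu).
exact/(inc _ _ pu).
Qed.

(** Disjointness holds because the square of [u] lies in the symmetric square of
    a plane only if [u] lies in the plane; the squares span because products
    are obtained from them by polarization. *)
Theorem eps_veronesean : veronesean_embedding eps.
Proof.
split.
- move=> p; have [u pu] := rep_ex p.
  by rewrite (eps_rep pu) dim_vline phi_neq0 // (rep_neq0 pu).
- move=> p p'; have [u pu] := rep_ex p; have [u' pu'] := rep_ex p'.
  rewrite (eps_rep pu) (eps_rep pu') => E.
  have /vlineP[k Ek] : phi u' \in <[phi u]>%VS by rewrite [<[_]>%VS]E memv_line.
  have [|t ut] := @outer_line _ u u' k (rep_neq0 pu').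
    rewrite -!symmx_phi Ek -[k *: phi u]addr0 symmx_lin.
    by rewrite symmx0 addr0.
  by apply: (@rep_inj p p' u t pu); rewrite -ut.
- move=> l; have [v1 [v2 [l1 [l2 [E11 E12 E21 E22 inc]]]]] := conic_plane l.
  exists (conic_span v1 v2), (conic_form l1 l2); split.
  + exact: conic_dim E11 E12 E21 E22.
  + exact: conic_quadratic.
  + exact: conic_nonsingular E11 E12 E21 E22.
  + move=> P; rewrite (line_imageP inc); apply: iff_sym.
    exact: conic_points E11 E12 E21 E22 P.
- move=> p l npl U [UP Umin]; have [u pu] := rep_ex p.
  have [v1 [v2 [l1 [l2 [E11 E12 E21 E22 inc]]]]] := conic_plane l.
  have sU : (U <= conic_span v1 v2)%VS.
    apply: Umin => P /(line_imageP inc)/(conic_points E11 E12 E21 E22)[].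
    by [].
  apply/eqP; rewrite -subv0; apply/subvP=> w; rewrite memv_cap memv0 => /andP[wp wU].
  have /mem_span3[a [b [c wE]]] := subvP sU _ wU.
  move: wp; rewrite (eps_rep pu) => /vlineP[k Ek]; rewrite Ek scaler_eq0.
  have [//|k0] := eqVneq k 0; case: npl; apply/(inc _ _ pu).
  apply: (@outer_plane _ _ _ _ (k^-1 * a) (k^-1 * b) (k^-1 * c) (rep_neq0 pu)).
  rewrite -symmx_phi -[phi u](scalerK k0) -[k *: phi u]Ek wE !(scalerDr k^-1) !(scalerA k^-1).
  rewrite -!symvecZ -!symvecD symvecK //.
  rewrite !(trmxD, trmxZ, trmx_mul, trmxK).
  by rewrite [in X in (k^-1 * b) *: X]addrC.
- split=> [P _|U' UP]; first exact: subvf.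
  have phiU u : phi u \in U'.
    have [->|u0] := eqVneq u 0; first by rewrite /phi /veronese mul0mx crd0 mulmx0 mem0v.
    have [p pu] := pt_ex u0; rewrite memvE -(eps_rep pu); apply: UP.
    by exists p.
  apply/subvP=> z _; rewrite -(symmxK z) /symmx; move: (invmx D *m z) => c.
  rewrite /emb; elim/big_ind: _ => [|A B AU BU|k _].
  + by rewrite /symvec crd0 mulmx0 mem0v.
  + by rewrite symvecD memvD.
  rewrite symvecZ memvZ //=; case: eqP => [->|_].
    by have := phiU (delta_mx (sym_pos k).2 0); rewrite /phi /veronese trmx_delta
      mul_delta_mx map_delta_mx.
  set i := (sym_pos k).1; set j := (sym_pos k).2.
  pose di : 'cV[F]_4 := delta_mx i 0; pose dj : 'cV[F]_4 := delta_mx j 0.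
  have := memvB (memvB (phiU (1 *: di + 1 *: dj)) (phiU di)) (phiU dj).
  suff -> : phi (1 *: di + 1 *: dj) - phi di - phi dj =
      symvec (map_mx intr (delta_mx i j + delta_mx j i)) by [].
  rewrite /phi /veronese -!/(symvec _) outerDD mulr1 expr1n !scale1r !symvecD.
  rewrite map_mxD !map_delta_mx symvecD /di /dj !trmx_delta !mul_delta_mx.
  by rewrite addrAC addrK addrAC subrr add0r.
Qed.

End Embedding.

(** * Lifting the Weyl embedding *)

Section Universality.
Variable (F : finFieldType).
Hypothesis two_neq0 : 2%:R != 0 :> F.
Variables (n : nat) (s : F).
Hypotheses (n0 : n%:R = 0 :> F) (xn : forall x : F, x ^+ n = x).
Hypotheses (s_neq0 : s != 0) (s2_neq1 : s ^+ 2 != 1).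
Variables (Gamma : geometry) (rep : point Gamma -> 'cV[F]_4 -> Prop).
Variable lrep : line Gamma -> 'cV[F]_5 -> Prop.
Hypothesis rep_neq0 : forall p u, rep p u -> u != 0.
Hypothesis rep_ex : forall p, exists u, rep p u.
Hypothesis pt_ex : forall u, u != 0 -> exists p, rep p u.
Hypothesis rep_inj : forall p p' u t, rep p u -> rep p' (t *: u) -> p = p'.
Hypothesis lrepP : forall l c p u, lrep l c -> rep p u ->
  (incident p l <-> cliff c *m u = 0).
Hypothesis mkline : forall c, c != 0 -> quad5 c = 0 -> exists l, lrep l c.
Variables (D : 'M[F]_10) (eps : point Gamma -> {vspace 'cV[F]_10}).
Hypothesis Du : D \in unitmx.
Hypothesis eps_rep : forall p u, rep p u -> eps p = <[D *m veronese u]>%VS.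

Let phi u := D *m veronese u.

Variables (K : fieldType) (W : vectType K) (eps1 : point Gamma -> {vspace W}).
Variables (f : W -> 'cV[F]_10) (sigma : {rmorphism K -> F}).
Hypotheses (ver1 : veronesean_embedding eps1) (sigma_bij : bijective sigma).
Hypothesis f_lin : forall a u v, f (a *: u + v) = sigma a *: f u + f v.
Hypothesis f_eps : forall p w2, w2 \in eps p <-> exists2 w1, w1 \in eps1 p & f w1 = w2.

Lemma morph0 : f 0 = 0.
Proof.
have := f_lin 1 0 0; rewrite scaler0 addr0 rmorph1 scale1r.
by move/eqP; rewrite -subr_eq0 opprD addrA subrr sub0r oppr_eq0 => /eqP.
Qed.
Lemma morphD u v : f (u + v) = f u + f v.
Proof. by have := f_lin 1 u v; rewrite !scale1r rmorph1 scale1r. Qed.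
Lemma morphZ a u : f (a *: u) = sigma a *: f u.
Proof. by have := f_lin a u 0; rewrite !addr0 morph0 addr0. Qed.
Lemma morphB u v : f (u - v) = f u - f v.
Proof. by rewrite morphD -scaleN1r morphZ rmorphN1 scaleN1r. Qed.

(** A point is mapped onto a point, so it is not killed. *)
Lemma morph_point_inj p w : w \in eps1 p -> f w = 0 -> w = 0.
Proof.
have [w0 w00 E1] := vline1 (ver_point ver1 p).
have [u pu] := rep_ex p.
have veronese_phi0 : phi u != 0 by apply: (phi_neq0 Du); apply: rep_neq0 pu.
have : phi u \in eps p by rewrite (eps_rep pu) memv_line.
case/f_eps => w1; rewrite E1 => /vlineP[k ->] fk /vlineP[a ->] fa.
move: fa veronese_phi0; rewrite -fk !morphZ => /eqP; rewrite !scaler_eq0 negb_or => /orP[|/eqP ->].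
  by rewrite fmorph_eq0 => /eqP ->; rewrite scale0r.
by rewrite eqxx andbF.
Qed.

Let twist (u : 'cV[K]_4) : 'cV[F]_4 := map_mx sigma u.

Lemma twist_eq0 u : (twist u == 0) = (u == 0).
Proof.
apply/eqP/eqP=> [/matrixP E|->]; last exact: map_mx0.
by apply/matrixP=> i j; have := E i j; rewrite !mxE => /eqP; rewrite fmorph_eq0 => /eqP.
Qed.

Lemma twistD u w : twist (u + w) = twist u + twist w. Proof. exact: map_mxD. Qed.
Lemma twistZ a u : twist (a *: u) = sigma a *: twist u. Proof. exact: map_mxZ. Qed.

(** The vector of the covering point that lies over the tensor square of the
    twisted spinor.  Spinors over [K] are used so that [vlift] has scalars in
    the field of its target. *)
Definition vlift_spec u w := [/\ u = 0 -> w = 0, f w = phi (twist u)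
  & forall p, rep p (twist u) -> w \in eps1 p].

Lemma veronese_phi0 : phi 0 = 0.
Proof. by rewrite /phi /veronese mul0mx crd0 mulmx0. Qed.

Lemma vlift_ex u : exists w, vlift_spec u w.
Proof.
have [->|u0] := eqVneq u 0.
  exists 0; split=> //; first by rewrite morph0 /twist map_mx0 veronese_phi0.
  by move=> p /rep_neq0; rewrite twist_eq0 eqxx.
have [p pu] : exists p, rep p (twist u) by apply: pt_ex; rewrite twist_eq0.
have : phi (twist u) \in eps p by rewrite (eps_rep pu) memv_line.
case/f_eps => w wp fw; exists w; split=> //; first by move=> u00; rewrite u00 eqxx in u0.
move=> p' pu'; suff -> : p' = p by [].
by apply: (@rep_inj _ _ (twist u) 1 pu'); rewrite scale1r.
Qed.

Lemma vlift_uniq u w w' : vlift_spec u w -> vlift_spec u w' -> w = w'.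
Proof.
move=> [w0 fw wp] [w'0 fw' w'p].
have [u0|u0] := eqVneq u 0; first by rewrite w0 ?w'0.
have [p pu] : exists p, rep p (twist u) by apply: pt_ex; rewrite twist_eq0.
apply/eqP; rewrite -subr_eq0; apply/eqP/(@morph_point_inj p).
  by rewrite memvB ?wp ?w'p.
by rewrite morphB fw fw' subrr.
Qed.

Definition vlift u : W := proj1_sig (constructive_indefinite_description _ (vlift_ex u)).

Lemma vliftP u : vlift_spec u (vlift u).
Proof. exact: proj2_sig (constructive_indefinite_description _ (vlift_ex u)). Qed.

Lemma morph_vlift u : f (vlift u) = phi (twist u). Proof. by case: (vliftP u). Qed.

Lemma vliftZ a u : vlift (a *: u) = a ^+ 2 *: vlift u.
Proof.
apply: (vlift_uniq (vliftP _)); have [u0 fu up] := vliftP u; split.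
- move/eqP; rewrite scaler_eq0 => /orP[/eqP ->|/eqP/u0 ->].
    by rewrite expr0n scale0r.
  by rewrite scaler0.
- by rewrite morphZ fu twistZ /phi veroneseZ -scalemxAr rmorphXn.
- move=> p pa; have tu0 : twist u != 0.
    by have := rep_neq0 pa; rewrite twistZ; apply: contraNneq => ->; rewrite scaler0.
  have [p' pu'] := pt_ex tu0; rewrite memvZ //.
  by rewrite -(@rep_inj p' p _ (sigma a) pu') -?twistZ ?up.
Qed.

Lemma twist_independent u w : independent u w -> independent (twist u) (twist w).
Proof.
have [tau sK tK] := sigma_bij.
move=> uw a b; rewrite -[a]tK -[b]tK -!twistZ -twistD => /eqP; rewrite twist_eq0 => /eqP/uw[-> ->].
by rewrite rmorph0.
Qed.

(** In terms of the two squares and the symmetric product of [u] and [w], the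
    change of basis is unitriangular; then [outer_free] applies. *)
Lemma veronese_free u w a b c : independent u w ->
  a *: phi u + b *: phi w + c *: phi (u + w) = 0 -> [/\ a = 0, b = 0 & c = 0].
Proof.
move=> uw; rewrite /phi !scalemxAr -!mulmxDr => /(congr1 (fun z => emb sym_frame (invmx D *m z))).
rewrite mulKmx // mulmx0 !embD !embZ -(scale0r 0) embZ scale0r !emb_veronese.
have -> : (u + w) *m (u + w)^T = u *m u^T + (u *m w^T + w *m u^T) + w *m w^T.
  by have := outerDD u w 1 1; rewrite !scale1r mulr1 expr1n !scale1r.
move=> E; have [|ac bc cc] := @outer_free _ u w (a + c) c (b + c) uw.
  rewrite -[RHS]E; move: (u *m u^T) (u *m w^T + w *m u^T) (w *m w^T) => A B C.
  by apply/matrixP=> i j; rewrite !mxE; ring.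
split=> //; first by move: ac; rewrite bc addr0.
by move: cc; rewrite bc addr0.
Qed.

Lemma veroneseDD u w x y : phi (x *: u + y *: w) =
  (x ^+ 2 - x * y) *: phi u + (y ^+ 2 - x * y) *: phi w + (x * y) *: phi (u + w).
Proof.
rewrite /phi !scalemxAr -!mulmxDr; congr (_ *m _); rewrite /veronese -!crdZ -!crdD.
congr crd; rewrite outerDD.
have := outerDD u w 1 1; rewrite !scale1r mulr1 expr1n !scale1r => ->.
move: (u *m u^T) (u *m w^T + w *m u^T) (w *m w^T) => A B C.
by apply/matrixP=> i j; rewrite !mxE; ring.
Qed.

Lemma sform_twist u w : sform (twist u) (twist w) = sigma (sform u w).
Proof. by rewrite /sform !mxE rmorphD !rmorphB !rmorphM. Qed.

(** Three independent vectors of the conic plane upstairs form a basis of it, and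
    a linear combination of them is determined by its image. *)
Lemma vlift_plane u w : sform u w = 0 -> independent u w -> forall x y,
  vlift (x *: u + y *: w) = (x ^+ 2 - x * y) *: vlift u +
    (y ^+ 2 - x * y) *: vlift w + (x * y) *: vlift (u + w).
Proof.
move=> uw0 uw x y.
have tuw0 : sform (twist u) (twist w) = 0 by rewrite sform_twist uw0 rmorph0.
have tuw := twist_independent uw.
have c0 := wedge_neq0 two_neq0 tuw tuw0.
have kerc a b : cliff (wedge (twist u) (twist w)) *m twist (a *: u + b *: w) = 0.
  rewrite cliff_wedge // twistD !twistZ.
  have sf (v : 'cV[F]_4) : sform v v = 0 by rewrite /sform; ring.
  have sC : sform (twist w) (twist u) = 0.
    by move: tuw0; rewrite /sform => E; rewrite -[RHS]oppr0 -E; ring.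
  have -> : sform (twist w) (sigma a *: twist u + sigma b *: twist w) =
      sigma a * sform (twist w) (twist u) + sigma b * sform (twist w) (twist w).
    by rewrite /sform !mxE; ring.
  have -> : sform (twist u) (sigma a *: twist u + sigma b *: twist w) =
      sigma a * sform (twist u) (twist u) + sigma b * sform (twist u) (twist w).
    by rewrite /sform !mxE; ring.
  by rewrite sC tuw0 !sf !mulr0 !addr0 !scale0r subr0.
have u0 : u != 0.
  apply/eqP=> u0; have [] := uw 1 0; first by rewrite u0 scaler0 scale0r addr0.
  by move/eqP; rewrite oner_eq0.
have qc : quad5 (wedge (twist u) (twist w)) = 0.
  apply: (@cliff_kernel_singular _ _ (twist u)); first by rewrite twist_eq0.
  by have := kerc 1 0; rewrite scale1r scale0r addr0.
have [l lc] := mkline c0 qc.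
have [U1 [q1 [U1d _ _ conic]]] := ver_conic ver1 l.
have inU a b : vlift (a *: u + b *: w) \in U1.
  have [v0|v0] := eqVneq (a *: u + b *: w) 0.
    by have [/(_ v0) -> _ _] := vliftP (a *: u + b *: w); rewrite mem0v.
  have [p pv] : exists p, rep p (twist (a *: u + b *: w)) by apply: pt_ex; rewrite twist_eq0.
  have [_ _ /(_ p pv) vp] := vliftP (a *: u + b *: w).
  have [|_ pU _] := (conic (eps1 p)).1; last exact: subvP pU _ vp.
  by exists p => //; apply/(lrepP lc pv)/kerc.
have uU : vlift u \in U1 by have := inU 1 0; rewrite scale1r scale0r addr0.
have wU : vlift w \in U1 by have := inU 0 1; rewrite scale1r scale0r add0r.
have uwU : vlift (u + w) \in U1 by have := inU 1 1; rewrite !scale1r.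
have free3 a b c : a *: vlift u + b *: vlift w + c *: vlift (u + w) = 0 ->
    [/\ a = 0, b = 0 & c = 0].
  move/(congr1 f); rewrite morph0 !morphD !morphZ !morph_vlift twistD => /(veronese_free tuw)[].
  by move=> /eqP + /eqP + /eqP; rewrite !fmorph_eq0 => /eqP -> /eqP -> /eqP ->.
have UE : U1 = <<[:: vlift u; vlift w; vlift (u + w)]>>%VS.
  apply/eqP; rewrite eq_sym eqEdim dim_span3 // U1d andbT.
  by apply/span_subvP=> v; rewrite !inE => /or3P[]/eqP->.
have := inU x y; rewrite UE => /mem_span3[a [b [c E]]]; rewrite E.
have fE : phi (sigma x *: twist u + sigma y *: twist w) =
    sigma a *: phi (twist u) + sigma b *: phi (twist w) + sigma c *: phi (twist u + twist w).
  by rewrite -!twistZ -!twistD -!morph_vlift -!morphZ -!morphD -E.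
have [|/eqP Ea /eqP Eb /eqP Ec] := @veronese_free _ _ (sigma (a - (x ^+ 2 - x * y)))
  (sigma (b - (y ^+ 2 - x * y))) (sigma (c - x * y)) tuw.
  transitivity (phi (sigma x *: twist u + sigma y *: twist w) -
                phi (sigma x *: twist u + sigma y *: twist w)); last exact: subrr.
  rewrite {1}fE veroneseDD !rmorphB !rmorphXn rmorphM.
  move: (phi _) (phi _) (phi _) => A B C.
  by apply/matrixP=> i j; rewrite !mxE; ring.
by move: Ea Eb Ec; rewrite !fmorph_eq0 !subr_eq0 => /eqP -> /eqP -> /eqP ->.
Qed.

(** When [u] and [w] are proportional, homogeneity is enough. *)
Lemma vlift_isotropic (h : W -> K) :
    (forall a u v, h (a *: u + v) = a * h u + h v) ->
  forall u w, sform u w = 0 -> quadratic2 (fun a b => h (vlift (a *: u + b *: w))).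
Proof.
move=> h_lin u w uw0.
have h0 : h 0 = 0.
  by have /eqP := h_lin 1 0 0; rewrite scaler0 addr0 mul1r -subr_eq0 opprD addrA subrr
    sub0r oppr_eq0 => /eqP.
have hZ a v : h (a *: v) = a * h v by rewrite -[a *: v]addr0 h_lin h0 addr0.
have hD v v' : h (v + v') = h v + h v' by have := h_lin 1 v v'; rewrite scale1r mul1r.
case: (classic (independent u w)) => [ind|dep].
  exists (h (vlift u)), (h (vlift (u + w)) - h (vlift u) - h (vlift w)), (h (vlift w)) => a b.
  by rewrite vlift_plane // !hD !hZ; ring.
have [k [ku|kw]] : exists k : K, u = k *: w \/ w = k *: u.
  apply: NNPP => nk; apply: dep => a b ab.
  have [a0|a0] := eqVneq a 0; last first.
    case: nk; exists (- (b / a)); left; apply: (scalerI a0).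
    rewrite scalerA mulrN mulrC divfK // scaleNr; apply/eqP.
    by rewrite -addr_eq0 ab.
  have [b0|b0] := eqVneq b 0; first by [].
  case: nk; exists 0; right; rewrite scale0r; apply: (scalerI b0).
  by rewrite scaler0 -ab a0 scale0r add0r.
- exists (k ^+ 2 * h (vlift w)), (2%:R * k * h (vlift w)), (h (vlift w)) => a b.
  by rewrite ku scalerA -scalerDl vliftZ hZ; ring.
- exists (h (vlift u)), (2%:R * k * h (vlift u)), (k ^+ 2 * h (vlift u)) => a b.
  by rewrite kw scalerA -scalerDl vliftZ hZ; ring.
Qed.

Let d4 i : 'cV[K]_4 := delta_mx i 0.

Definition vlift_basis (k : 'I_10) : W :=
  if (sym_pos k).1 == (sym_pos k).2 then vlift (d4 (sym_pos k).1)
  else polarization vlift (d4 (sym_pos k).1) (d4 (sym_pos k).2).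

(** The coordinates of [vlift] are quadratic by [quadratic_of_isotropic]; the
    arithmetic hypotheses on the finite field are transported to [K]. *)
Lemma vlift_formula u :
  vlift u = \sum_k (u (sym_pos k).1 0 * u (sym_pos k).2 0) *: vlift_basis k.
Proof.
have [tau sK tK] := sigma_bij.
have sinj : injective sigma := bij_inj sigma_bij.
have two_K : 2%:R != 0 :> K by rewrite -(fmorph_eq0 sigma) rmorph_nat.
have n0K : n%:R = 0 :> K by apply: sinj; rewrite rmorph_nat n0 rmorph0.
have xnK (x : K) : x ^+ n = x by apply: sinj; rewrite rmorphXn xn.
have t0 : tau s != 0 by rewrite -(fmorph_eq0 sigma) tK.
have t1 : tau s ^+ 2 != 1.
  by apply: contraNneq s2_neq1 => E; rewrite -[s]tK -rmorphXn E rmorph1.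
have coord_ext (v w : W) :
    (forall i, coord (vbasis fullv) i v = coord (vbasis fullv) i w) -> v = w.
  move=> E; rewrite (coord_vbasis (memvf v)) (coord_vbasis (memvf w)).
  by apply: eq_bigr => i _; rewrite E.
apply: coord_ext => i.
pose h (w : W) : K := coord (vbasis fullv) i w.
have h_lin a v w : h (a *: v + w) = a * h v + h w by rewrite /h linearP.
rewrite -/(h (vlift u)).
have -> := quadratic_of_isotropic (h := fun u => h (vlift u)) two_K
  (vlift_isotropic h_lin) n0K xnK t0 t1 u.
rewrite linear_sum; apply: eq_bigr => k _.
rewrite linearZ /=; congr (_ * _); rewrite /vlift_basis.
case: ifP => // _; rewrite /polarization -/(h _).
have hB v w : h (v - w) = h v - h w by rewrite /h linearB.
by rewrite !hB.
Qed.

Lemma twist_delta i : twist (d4 i) = delta_mx i 0.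
Proof. exact: map_delta_mx. Qed.

Lemma morph_vlift_basis k : f (vlift_basis k) = D *m delta_mx k 0.
Proof.
have E i : phi (delta_mx i 0) = D *m crd sym_frame (delta_mx i i).
  by rewrite /phi /veronese trmx_delta mul_delta_mx.
have := crd_basis (sym_frameP F) k; rewrite /vlift_basis /=.
case: eqP => [->|_] <-; first by rewrite morph_vlift twist_delta E map_delta_mx.
rewrite map_mxD !map_delta_mx /polarization !morphB !morph_vlift twistD !twist_delta.
set i := (sym_pos k).1; set j := (sym_pos k).2.
rewrite /phi /veronese -!mulmxBr -!crdB; congr (_ *m crd _ _).
have := outerDD (delta_mx i 0 : 'cV[F]_4) (delta_mx j 0) 1 1.
rewrite !scale1r mulr1 expr1n !scale1r => ->.
rewrite !trmx_delta !mul_delta_mx.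
by rewrite addrAC addrK addrAC subrr add0r.
Qed.

(** The ten vectors [vlift_basis k] span the covering space and lie over a basis. *)
Lemma morphism_bijective : bijective f.
Proof.
have [tau sK tK] := sigma_bij.
(* [f] composed with [g] is the bijective twist of coordinates by [sigma]. *)
pose g (c : 'cV[K]_10) : W := \sum_k c k 0 *: vlift_basis k.
have fg c : f (g c) = D *m map_mx sigma c.
  have fsum (r : seq 'I_10) : f (\sum_(k <- r) c k 0 *: vlift_basis k) =
      \sum_(k <- r) sigma (c k 0) *: (D *m delta_mx k 0).
    elim: r => [|k r IHr]; first by rewrite !big_nil morph0.
    by rewrite !big_cons morphD morphZ IHr morph_vlift_basis.
  rewrite /g fsum; under eq_bigr => k _ do rewrite scalemxAr.
  rewrite -mulmx_sumr [map_mx sigma c]matrix_sum_delta; congr (_ *m _).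
  by apply: eq_bigr => k _; rewrite big_ord1 mxE.
have g_surj w : exists c, w = g c.
  have [_ span1] := ver_span ver1.
  pose Y := (\sum_(k < 10) <[vlift_basis k]>)%VS.
  have YU k : vlift_basis k \in Y by rewrite memvE (sumv_sup k).
  have : w \in Y.
    apply: subvP (memvf w); apply: span1 => _ [p ->].
    have [u0 pu] := rep_ex p.
    pose u : 'cV[K]_4 := map_mx tau u0.
    have tu : twist u = u0 by apply/matrixP=> i j; rewrite !mxE tK.
    rewrite -tu in pu; have [_ fu /(_ p pu) up] := vliftP u.
    have u_n0 : vlift u != 0.
      apply: contraNneq (phi_neq0 Du (rep_neq0 pu)) => l0.
      by rewrite -/(phi _) -fu l0 morph0.
    have -> : eps1 p = <[vlift u]>%VS.
      by apply/eqP; rewrite eq_sym eqEdim -memvE up (ver_point ver1) dim_vline u_n0.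
    rewrite -memvE vlift_formula; apply: memv_suml => k _; exact: memvZ.
  case/memv_sumP=> v vY ->.
  have [c vc] : exists c : 'I_10 -> K, forall k, v k = c k *: vlift_basis k.
    apply: (@fin_all_exists _ _ (fun k a => v k = a *: vlift_basis k)) => k.
    exact/vlineP/vY.
  by exists (\col_k c k); apply: eq_bigr => k _; rewrite vc mxE.
exists (fun z => g (map_mx tau (invmx D *m z))) => [w|z].
  have [c ->] := g_surj w; rewrite fg mulKmx //; congr g.
  by apply/matrixP=> i j; rewrite !mxE sK.
rewrite fg (_ : map_mx sigma _ = invmx D *m z) ?mulKVmx //.
by apply/matrixP=> i j; rewrite !mxE tK.
Qed.

End Universality.

(** * The theorem *)

Section FiniteField.
Variable F : finFieldType.

Lemma natr_card_eq0 : #|F|%:R = 0 :> F.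
Proof. by have := expg_cardG (in_setT (1 : F)); rewrite cardsT FinRing.zmodXgE. Qed.

Lemma odd_two_neq0 : odd #|F| -> 2%:R != 0 :> F.
Proof.
move=> oF; apply/eqP=> two0; have := natr_card_eq0.
rewrite -(odd_double_half #|F|) oF natrD -muln2 natrM two0 mulr0 addr0.
by move/eqP; rewrite oner_eq0.
Qed.

Lemma exists_square_neq01 : (3 < #|F|)%N -> exists2 s : F, s != 0 & s ^+ 2 != 1.
Proof.
move=> F3; have /subsetPn[s _] : ~~ ([set: F] \subset [set 0; 1; -1]).
  apply: contraL F3 => /subset_leq_card; rewrite cardsT -leqNgt => le.
  apply: (leq_trans le); rewrite -setUA cardsU1 -[3%N]/(1 + 2)%N leq_add ?leq_b1 // cards2.
  by case: eqP.
rewrite !inE !negb_or => /andP[/andP[s0 s1] sN1]; exists s => //.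
by rewrite sqrf_eq1 negb_or s1.
Qed.

End FiniteField.

Theorem theorem5 (F : finFieldType) (oddF : odd #|F|) (F_gt3 : (3 < #|F|)%N)
    (Q : 'cV[F]_5 -> F) (quadQ : quadratic_form Q)
    (nsQ : nonsingular_on Q fullv) (wittQ : witt_index Q 2)
    (gT : finGroupType) (G : {group gT}) (x : 'I_8 -> F -> gT)
    (univG : universal_chevalley_B2 G x)
    (rV : mx_representation F G 5) (natV : natural_orthogonal_module x Q rV)
    (rW : mx_representation F G 10)
    (eps : point (dual_polar_space Q) -> {vspace 'cV[F]_10})
    (weyl_eps : veronesean_weyl_embedding x rV rW eps) :
  relatively_universal eps.
Proof.
have two0 := odd_two_neq0 oddF; have [s s0 s1] := exists_square_neq01 F_gt3.
have xG r t : x r t \in G.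
  by have [GE _] := univG; rewrite GE; apply/mem_gen/imsetP; exists (r, t).
have [[w wV] Qinv] := natV; have [v0 [X0 [wW stab epsE]]] := weyl_eps.
have [C [Cu rVx _]] := weyl_module_alt two0 wV.
have [D [Du rWx v0E]] := weyl_module_sym wW.
rewrite v0E in stab epsE.
have rex := point_spinor two0 s0 s1 quadQ nsQ xG Qinv Cu rVx rWx.
have ptx := spinor_point two0 s0 s1 quadQ nsQ xG Qinv Cu rVx rWx.
have lex := line_singular two0 s0 s1 quadQ nsQ xG Qinv Cu rVx rWx.
have mkl := singular_line two0 s0 s1 quadQ nsQ xG Qinv Cu rVx rWx.
have erep := weyl_embeddingE two0 s0 s1 quadQ nsQ xG Qinv Cu rVx rWx stab epsE.
have rneq (p : point (dual_polar_space Q)) u : represents C p u -> u != 0 by case.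
have rinj (p p' : point (dual_polar_space Q)) u t : represents C p u -> represents C p' (t *: u) -> p = p'.
  exact: represents_inj.
have lP (l : line (dual_polar_space Q)) c p u : represents_line C l c -> represents C p u ->
    (incident p l <-> cliff c *m u = 0) by move=> lc /lc.
split; first exact: (eps_veronesean two0 rneq rex ptx rinj lP lex Du erep).
move=> K W eps1 f ver1 [[sigma sbij f_lin] f_eps].
exact: (morphism_bijective two0 (natr_card_eq0 F) (@expf_card F) s0 s1 rneq rex ptx rinj lP
  mkl Du erep ver1 sbij f_lin f_eps).
Qed.
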